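(* Let $V_1,\dots,V_n\in\mathbf{Z}^n$ be such that $M=(V_1,\dots,V_n)$ is non-singular, let $p$ be a prime not dividing $\det M$, and let $f=\sum_{j=1}^na_jx^{V_j}$ with $a_j\in\mathbf{F}_q^*$ ($q$ a power of $p$). Then $f$ is ordinary over $\mathbf{F}_q$ if and only if the norm $|r|=r_1+\cdots+r_n$ on $S(\Delta)$ is stable under the $p$-action, i.e. $|\{pr\}|=|r|$ for every $r\in S(\Delta)$. Equivalently, $f$ is ordinary if and only if $w(\{pu\})=w(u)$ for every lattice point $u$ in the fundamental domain $\mathbf{R}V_1+\cdots+\mathbf{R}V_n \pmod{\mathbf{Z}V_1+\cdots+\mathbf{Z}V_n}$, where for $u=Mr$ with $r\in S(\Delta)$ one sets $\{pu\}=M\{pr\}$.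
   Context: Here $\Delta$ is the simplex with vertices $0,V_1,\dots,V_n$; such an $f$ is non-degenerate. $S(\Delta)$ is the set of $r=(r_1,\dots,r_n)\in(\mathbf{Q}\cap[0,1))^n$ with $Mr\in\mathbf{Z}^n$ (identified with the lattice points $u=Mr$ of the fundamental domain); the $p$-action is $r\mapsto\{pr\}=(\{pr_1\},\dots,\{pr_n\})$, $\{\cdot\}$ the fractional part. The weight $w(u)$ of $u\in\mathbf{R}^n$ is the smallest $c\ge0$ with $u\in c\Delta$ ($+\infty$ if none); for $u=Mr$, $r\ge0$, $w(u)=|r|$. Ordinary: with $\zeta_p$ a primitive $p$-th root of unity in $\Omega$ (completion of an algebraic closure of $\mathbf{Q}_p$), $S_k^*(f)=\sum_{x\in(\mathbf{F}_{q^k}^* )^n}\zeta_p^{\mathrm{Tr}_k f(x)}$, $L^*(f/\mathbf{F}_q,t)=\exp(\sum_k S_k^*(f)t^k/k)$, and $L^*(f/\mathbf{F}_q,t)^{(-1)^{n-1}}$ is a polynomial with constant term 1. Its Newton polygon w.r.t. $q$ is the lower convex hull of $(k,\mathrm{ord}_q c_k)$ for its coefficients $c_k$ ($\mathrm{ord}_q q=1$). Let $D(\Delta)$ be the smallest positive integer $D$ with $w(\mathbf{Z}^n)\subseteq\frac1D\mathbf{Z}_{\ge0}\cup\{\infty\}$, $W(k)=\#\{u\in\mathbf{Z}^n:w(u)=k/D(\Delta)\}$ ($0$ for $k<0$), $H(k)=\sum_{i=0}^n(-1)^i\binom ni W(k-iD(\Delta))$, and $HP(\Delta)$ the polygon with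 vertices $(0,0)$ and $(\sum_{k\le m}H(k),\frac1{D(\Delta)}\sum_{k\le m}kH(k))$, $0\le m\le nD(\Delta)$. $f$ is ordinary over $\mathbf{F}_q$ if that Newton polygon equals $HP(\Delta)$. *)

(* Defs.v *)
From HB Require Import structures.
From mathcomp Require Import all_boot all_order all_algebra finmap.
From mathcomp Require Import boolp classical_sets functions cardinality.
From mathcomp Require Import reals constructive_ereal.

Set Implicit Arguments.
Unset Strict Implicit.
Unset Printing Implicit Defensive.

Import Order.TTheory GRing.Theory Num.Theory.

Local Open Scope classical_set_scope.
Local Open Scope ring_scope.

Definition padic_ord (R : realType) (p : nat) (x : rat) : R :=
  (logn p `|numq x|%N)%:R - (logn p `|denq x|%N)%:R.

(* Valuations are written additively; [v 0], mathematically +oo, is a junk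
   value that is never used. *)
Definition is_valuation (R : realType) (K : fieldType) (v : K -> R) : Prop :=
  (forall x y, x != 0 -> y != 0 -> v (x * y) = v x + v y) /\
  (forall x y, x != 0 -> y != 0 -> x + y != 0 ->
     Num.min (v x) (v y) <= v (x + y)).

(* [v x >= N], with the convention [v 0 = +oo]. *)
Definition ord_ge (R : realType) (K : fieldType) (v : K -> R) (x : K) (N : R)
    : Prop :=
  x != 0 -> N <= v x.

Definition complete_for (R : realType) (K : fieldType) (v : K -> R) : Prop :=
  forall u : nat -> K,
    (forall N : R, exists m, forall i j,
        (m <= i)%N -> (m <= j)%N -> ord_ge v (u i - u j) N) ->
    exists l : K, forall N : R, exists m, forall i,
        (m <= i)%N -> ord_ge v (u i - l) N.

Definition extends_along (R : realType) (K L : fieldType) (vK : K -> R)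
    (vL : L -> R) (h : K -> L) : Prop :=
  forall x, x != 0 -> vL (h x) = vK x.

Definition is_completion (R : realType) (K L : fieldType) (vK : K -> R)
    (vL : L -> R) (h : K -> L) : Prop :=
  [/\ is_valuation vL, extends_along vK vL h, complete_for vL
    & forall (y : L) (N : R), exists x : K, ord_ge vL (y - h x) N].

(* These data determine [Omega] with its valuation up to isomorphism: it is
   the field usually denoted C_p, with [ord p = 1]. *)
Record padicOmega (R : realType) (p : nat) := PadicOmega {
  Qp : fieldType;
  ord_Qp : Qp -> R;
  rat_to_Qp : {rmorphism rat -> Qp};
  Qp_completion : is_completion (padic_ord R p) ord_Qp rat_to_Qp;
  Qpbar : closedFieldType;
  ord_Qpbar : Qpbar -> R;
  Qp_to_Qpbar : {rmorphism Qp -> Qpbar};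
  Qpbar_algebraic : forall x : Qpbar, algebraicOver Qp_to_Qpbar x;
  ord_Qpbar_valuation : is_valuation ord_Qpbar;
  ord_Qpbar_extends : extends_along ord_Qp ord_Qpbar Qp_to_Qpbar;
  Omega : fieldType;
  ord : Omega -> R;
  Qpbar_to_Omega : {rmorphism Qpbar -> Omega};
  Omega_completion : is_completion ord_Qpbar ord Qpbar_to_Omega
}.

Definition fps_trunc (K : fieldType) (k : nat) (c : nat -> K) : {poly K} :=
  \poly_(i < k.+1) c i.

(* A formal power series is given by its sequence of coefficients.
   For [c 0 = 0], the coefficient of t^k in \sum_m c^m / m! only depends on the
   terms with m <= k and on the coefficients of [c] up to k. *)
Definition fps_exp (K : fieldType) (c : nat -> K) (k : nat) : K :=
  (\sum_(m < k.+1) (m`!%:R)^-1 *: fps_trunc k c ^+ m)`_k.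

(* For [c 0 = 1], the geometric series \sum_m (1 - c)^m. *)
Definition fps_inv (K : fieldType) (c : nat -> K) (k : nat) : K :=
  (\sum_(m < k.+1) (1 - fps_trunc k c) ^+ m)`_k.

(* Throughout, V_j is the j-th column of [M]; here f = \sum_j b_j x^{V_j}. *)
Definition laurent_eval (E : fieldType) (n : nat) (M : 'M[int]_n)
    (b : 'I_n -> E) (x : 'I_n -> E) : E :=
  \sum_(j < n) b j * \prod_(i < n) x i ^ (M i j).

Definition abs_trace (p : nat) (E : finFieldType) (x : E) : E :=
  \sum_(i < logn p #|E|) x ^+ (p ^ i).

(* The residue in {0, ..., p-1} representing the absolute trace, which lies in
   the prime field of [E]. *)
Definition abs_trace_nat (p : nat) (E : finFieldType) (x : E) : nat :=
  find (fun m : nat => m%:R == abs_trace p x) (iota 0 p).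

Definition exp_sum (K : fieldType) (zeta : K) (p : nat) (E : finFieldType)
    (n : nat) (M : 'M[int]_n) (b : 'I_n -> E) : K :=
  \sum_(x : {ffun 'I_n -> E} | [forall i, x i != 0])
     zeta ^+ abs_trace_nat p (laurent_eval M b x).

(* [E k] stands for F_{q^k} and [iota k] for the embedding of F_q in it; both
   are irrelevant for k = 0. *)
Definition Lstar (K : fieldType) (zeta : K) (p : nat) (F : finFieldType)
    (E : nat -> finFieldType) (iota : forall k, {rmorphism F -> E k})
    (n : nat) (M : 'M[int]_n) (a : 'I_n -> F) : nat -> K :=
  fps_exp (fun k => if k == 0%N then 0 else
    exp_sum zeta p M (fun j => iota k (a j)) / k%:R).

(* L^* to the power (-1)^(n-1), for n >= 1. *)
Definition Lstar_signed (K : fieldType) (zeta : K) (p : nat) (F : finFieldType)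
    (E : nat -> finFieldType) (iota : forall k, {rmorphism F -> E k})
    (n : nat) (M : 'M[int]_n) (a : 'I_n -> F) : nat -> K :=
  if odd n then Lstar zeta p iota M a else fps_inv (Lstar zeta p iota M a).

Definition convex_hull (R : realType) (A : set (R * R)) : set (R * R) :=
  [set P | exists (N : nat) (Q : 'I_N -> R * R) (t : 'I_N -> R),
     [/\ forall i, A (Q i), forall i, 0 <= t i, \sum_i t i = 1
       & P = (\sum_i t i * (Q i).1, \sum_i t i * (Q i).2)]].

Definition lower_hull (R : realType) (A : set (R * R)) : set (R * R) :=
  [set P | convex_hull A P /\
     forall y, convex_hull A (P.1, y) -> P.2 <= y].

(* Coefficients equal to 0 (of infinite order) contribute no point. *)
Definition newton_polygon (R : realType) (K : fieldType) (v : K -> R)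
    (c : nat -> K) : set (R * R) :=
  lower_hull [set (k%:R, v (c k)) | k in [set k | c k != 0]].

Definition intmx_to (K : fieldType) (m n : nat) (A : 'M[int]_(m, n))
    : 'M[K]_(m, n) :=
  map_mx intr A.

(* The convex hull of 0, V_1, ..., V_n; the vertex 0 carries the remaining coefficient 1 - \sum_j t_j. *)
Definition Delta (R : realType) (n : nat) (M : 'M[int]_n) : set 'cV[R]_n :=
  [set u | exists t : 'cV[R]_n,
     [/\ forall j, 0 <= t j 0, \sum_j t j 0 <= 1 & u = intmx_to R M *m t]].

Definition dilate (R : realType) (n : nat) (c : R) (A : set 'cV[R]_n)
    : set 'cV[R]_n :=
  [set c *: u | u in A].

Definition weight (R : realType) (n : nat) (M : 'M[int]_n) (u : 'cV[R]_n)
    : \bar R :=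
  xget +oo%E [set c%:E%E | c in [set c : R |
    [/\ 0 <= c, dilate c (Delta M) u
      & forall c' : R, 0 <= c' -> dilate c' (Delta M) u -> c <= c']]].

Definition is_weight_denom (R : realType) (n : nat) (M : 'M[int]_n) (D : nat)
    : Prop :=
  (0 < D)%N /\
  forall u : 'cV[int]_n,
    weight M (intmx_to R u) = +oo%E \/
    exists k : nat, weight M (intmx_to R u) = (k%:R / D%:R)%:E%E.

Definition weight_denom (R : realType) (n : nat) (M : 'M[int]_n) : nat :=
  xget 0%N [set D | is_weight_denom R M D /\
                    forall D', is_weight_denom R M D' -> (D <= D')%N].

(* Weights being nonnegative, [W M k = 0] for [k < 0]. *)
Definition W (R : realType) (n : nat) (M : 'M[int]_n) (k : int) : nat :=
  #|` fset_set [set u : 'cV[int]_n |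
        weight M (intmx_to R u) = (k%:~R / (weight_denom R M)%:R)%:E%E]|.

Definition H (R : realType) (n : nat) (M : 'M[int]_n) (k : nat) : int :=
  \sum_(i < n.+1)
    (-1) ^+ i * ('C(n, i))%:Z * (W R M (k%:Z - (i * weight_denom R M)%:Z))%:Z.

(* Vertex number 0 is the origin; vertex number m.+1 has coordinates
   (\sum_(k <= m) H k, 1/D \sum_(k <= m) k H k). *)
Definition HP_vertex (R : realType) (n : nat) (M : 'M[int]_n) (m : nat)
    : R * R :=
  ((\sum_(k < m) H R M k)%:~R,
   (\sum_(k < m) k%:Z * H R M k)%:~R / (weight_denom R M)%:R).

Definition segment (R : realType) (P Q : R * R) : set (R * R) :=
  [set ((1 - t) * P.1 + t * Q.1, (1 - t) * P.2 + t * Q.2)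
     | t in [set t : R | 0 <= t <= 1]].

Definition HP (R : realType) (n : nat) (M : 'M[int]_n) : set (R * R) :=
  [set P | exists2 m, (m <= n * weight_denom R M)%N &
           segment (HP_vertex R M m) (HP_vertex R M m.+1) P].

(* ord_q, normalized by ord_q q = 1, with q = #|F|. *)
Definition ord_q (R : realType) (p : nat) (C : padicOmega R p)
    (F : finFieldType) (x : Omega C) : R :=
  ord x / ord (#|F|%:R : Omega C).

Definition ordinary (R : realType) (p : nat) (C : padicOmega R p)
    (zeta : Omega C) (F : finFieldType) (E : nat -> finFieldType)
    (iota : forall k, {rmorphism F -> E k})
    (n : nat) (M : 'M[int]_n) (a : 'I_n -> F) : Prop :=
  newton_polygon (@ord_q R p C F) (Lstar_signed zeta p iota M a) = HP M.

Definition S_Delta (n : nat) (M : 'M[int]_n) : set 'cV[rat]_n :=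
  [set r : 'cV[rat]_n | (forall i, 0 <= r i 0 < 1) /\
           exists u : 'cV[int]_n, intmx_to rat M *m r = intmx_to rat u].

Definition l1norm (n : nat) (r : 'cV[rat]_n) : rat := \sum_i r i 0.

Definition p_action (p n : nat) (r : 'cV[rat]_n) : 'cV[rat]_n :=
  \col_i (p%:R * r i 0 - (Num.floor (p%:R * r i 0))%:~R).

Definition norm_stable (p n : nat) (M : 'M[int]_n) : Prop :=
  forall r, S_Delta M r -> l1norm (p_action p r) = l1norm r.

(* The lattice points of the fundamental domain are the u = M r with r in
   S(Delta), and {p u} = M {p r}. *)
Definition weight_stable (R : realType) (p n : nat) (M : 'M[int]_n) : Prop :=
  forall (u : 'cV[int]_n) (r : 'cV[rat]_n),
    S_Delta M r -> intmx_to rat u = intmx_to rat M *m r ->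
    weight M (map_mx (ratr : rat -> R) (intmx_to rat M *m p_action p r))
    = weight M (intmx_to R u).

(* Main.v *)
(* Expanding the additive character into Gauss sums turns S_k^* into a sum over
   the r in S(Delta) fixed by q^k, the term of r being, up to roots of unity, a
   product of Gauss sums.  By the Hasse-Davenport relation these terms are powers
   of a number gamma_O attached to the orbit O of r under r |-> {q r}, so that
   L^* to the power (-1)^(n-1) is the product of the 1 - gamma_O T^|O|.  By
   Stickelberger's theorem the slopes of its Newton polygon are the averages of
   |r| over the p-orbits, while inclusion-exclusion shows that the slopes of
   HP(Delta) are the |r| themselves.  Two such polygons agree iff their Legendre
   transforms sum_r min(0, slope_r - tau) agree for all tau, and by concavity
   this happens only if |r| is constant on the p-orbits. *)
From HB Require Import structures.
Require Import Defs.
From mathcomp Require Import all_fingroup all_boot all_order all_algebra all_field.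
From mathcomp Require Import finmap ring_quotient qfpoly cyclic.
From mathcomp Require Import boolp classical_sets functions cardinality.
From mathcomp Require Import reals constructive_ereal.
From mathcomp Require Import ring lra zify.

(** The fields [E k] come only with embeddings of [F] and are not nested, so characters of different
    [E k] have no relation given in advance. All of them are embedded, over one embedding of [F],
    into the residue field of [Omega]; composing with Teichmueller lifts gives one coherent family
    of multiplicative characters, as the Hasse-Davenport relation needs. Writing r = t/N with N =
    |det M| replaces index sets that depend on q^k by one finite set of integer vectors t modulo N,
    which multiplication by p permutes because p is prime to N. The formula for L^* is proved by
    comparing logarithmic derivatives modulo powers of T; in characteristic 0 these determine a
    series with constant term 1. The transform min_i (ord c_i - tau i) is the right invariant of a
    Newton polygon because it is additive on products, by Gauss's lemma: every factor 1 - gamma T^d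
    contributes separately and no slopes have to be sorted. *)

Set Implicit Arguments.
Unset Strict Implicit.
Unset Printing Implicit Defensive.

(* For 0 <= s < q - 1 with q = p^e, this is q - 1 times the sum of the
   fractional parts {p^i s / (q - 1)}, i < e. *)
Definition frac_sum (p e s : nat) : nat :=
  \sum_(i < e) (p ^ i * s %% (p ^ e).-1).

(** * Base-p digits and the exponent in Stickelberger's theorem *)

Section FracSum.

Variables (p e : nat).
Hypotheses (p_gt1 : 1 < p) (e_gt0 : 0 < e).
Let q := p ^ e.

Let q_gt0 : 0 < q. Proof. by rewrite expn_gt0 ltnW. Qed.

(** Multiplication by p permutes the summands cyclically, since q = 1 modulo q - 1. *)
Lemma frac_sum_frob s : frac_sum p e (p * s) = frac_sum p e s.
Proof.
have key : q * s = s %[mod q.-1].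
  by rewrite -{1}(prednK q_gt0) mulSn addnC mulnC modnMDl.
move: key; rewrite /frac_sum /q.
case: e e_gt0 => // e' _; rewrite big_ord_recr big_ord_recl /= addnC => key.
congr (_ + _); first by rewrite mulnA -expnSr key mul1n.
by apply: eq_bigr => i _; rewrite mulnA -expnSr.
Qed.

(** In base p, multiplication by p^i modulo q - 1 rotates the e digits of s: the top i digits move
    to the bottom. The bound s < q - 1 excludes the word with all digits p - 1, whose rotation would
    not be reduced. *)
Lemma frac_sum_rotate s i : s < q.-1 -> i < e ->
  p ^ i * s %% q.-1 = s %/ p ^ (e - i) + p ^ i * (s %% p ^ (e - i)).
Proof.
move=> lt_s lt_i; set m := p ^ (e - i).
have qE : q = p ^ i * m by rewrite -expnD subnKC // ltnW.
have m_gt0 : 0 < m by rewrite expn_gt0 ltnW.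
have pi_gt0 : 0 < p ^ i by rewrite expn_gt0 ltnW.
have es := divn_eq s m.
have lt_a : s %/ m < p ^ i by rewrite ltn_divLR // -qE (leq_trans lt_s) // leq_pred.
have lt_b : s %% m < m by rewrite ltn_mod.
set a := s %/ m in es lt_a *; set b := s %% m in es lt_b *.
have eps : p ^ i * s = a * q.-1 + (a + p ^ i * b).
  rewrite es mulnDr mulnCA -qE addnA; congr (_ + _).
  by rewrite -{1}(prednK q_gt0) mulnS addnC.
rewrite eps modnMDl modn_small //; clear eps.
move: lt_s; rewrite es qE; move: m_gt0 pi_gt0 lt_a lt_b; clear.
move: (p ^ i) m a b => P m a b m0 P0 ltaP ltbm lt_s.
(* Failure would force quotient and remainder to be maximal, that is s = q - 1. *)
rewrite ltnNge; apply/negP => ge_s.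
have hb : b = m.-1.
  have : P * (m - b) <= P * 1 by rewrite mulnBr; lia.
  by rewrite leq_pmul2l //; lia.
have ha : a = P.-1 by rewrite hb in ge_s; nia.
by move: lt_s; rewrite ha hb; case: P m m0 P0 {ge_s ltaP ltbm ha hb} => [|P] [|m] //= _ _; nia.
Qed.

(** As p does not divide s + 1, passing from s to s + 1 raises the last digit without a carry, and
    the i-th rotation puts that digit in position i. In effect [frac_sum] is (q - 1)/(p - 1) times
    the digit sum. *)
Lemma frac_sumS s : s.+1 < q.-1 -> ~~ (p %| s.+1) ->
  frac_sum p e s.+1 = frac_sum p e s + \sum_(i < e) p ^ i.
Proof.
move=> lt_s ps; rewrite -big_split; apply: eq_bigr => i _ /=.
have lt_i := ltn_ord i.
rewrite !frac_sum_rotate //; last exact: ltnW.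
set m := p ^ (e - i).
have pm : p %| m by rewrite dvdn_exp // subn_gt0.
have nm : ~~ (m %| s.+1) by apply: contra ps; apply: dvdn_trans.
have m_gt0 : 0 < m by rewrite expn_gt0 ltnW.
by rewrite (modnS s m) (divnS s m_gt0) (negbTE nm) /= add0n mulnS addnCA addnC.
Qed.

Lemma frac_sum0 : frac_sum p e 0 = 0.
Proof. by apply: big1 => i _; rewrite muln0 mod0n. Qed.

Lemma predn_mul_sum_exp : p.-1 * \sum_(i < e) p ^ i = q.-1.
Proof. by rewrite /q predn_exp. Qed.

Lemma coprime_exp_pred i : coprime q.-1 (p ^ i).
Proof.
apply: coprimeXr; rewrite coprime_sym.
have : coprime q q.-1 by rewrite -{1}(prednK q_gt0) coprimeSn.
by rewrite /q coprime_pexpl.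
Qed.

(** Paired summands are both nonzero because p^i is prime to q - 1, and their sum is a multiple of q
    - 1 strictly between 0 and 2(q - 1). *)
Lemma frac_sum_compl s : 0 < s < q.-1 ->
  frac_sum p e s + frac_sum p e (q.-1 - s) = e * q.-1.
Proof.
move=> /andP[s0 lt_s]; rewrite -big_split /=.
rewrite (eq_bigr (fun=> q.-1)) => [|i _]; first by rewrite sum_nat_const card_ord.
have q1 : 0 < q.-1 by apply: leq_trans lt_s.
have nd t : 0 < t < q.-1 -> 0 < p ^ i * t %% q.-1.
  move=> /andP[t0 lt_t]; rewrite lt0n; apply/negP => /eqP /eqP.
  rewrite -/(q.-1 %| _) Gauss_dvdr ?coprime_exp_pred // => /(dvdn_leq t0).
  by rewrite leqNgt lt_t.
have a0 := nd s; have b0 := nd (q.-1 - s).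
have : q.-1 %| p ^ i * s %% q.-1 + p ^ i * (q.-1 - s) %% q.-1.
  by rewrite /dvdn modnDm -mulnDr subnKC ?modnMl // ltnW.
have lta := ltn_pmod (p ^ i * s) q1; have ltb := ltn_pmod (p ^ i * (q.-1 - s)) q1.
have {}a0 : 0 < p ^ i * s %% q.-1 by apply: a0; rewrite s0.
have {}b0 : 0 < p ^ i * (q.-1 - s) %% q.-1 by apply: b0; lia.
rewrite -/q; move: (_ %% _) (_ %% _) lta ltb a0 b0 => a b lta ltb a0 b0.
move=> /dvdnP[c ec]; have c1 : c = 1 by nia.
by rewrite ec c1 mul1n.
Qed.

End FracSum.

Import Order.TTheory GRing.Theory Num.Theory.
Local Open Scope ring_scope.

(** * Conjugates and characteristic polynomials over finite fields *)

Lemma card_pchar (F : finFieldType) p : p \in [pchar F] ->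
  #|F| = (p ^ logn p #|F|)%N.
Proof. move=> chF; exact: card_pprimeChar chF. Qed.

Lemma frobenius_rmorphism (p : nat) (L : fieldType) (i : nat) :
  p \in [pchar L] ->
  exists phi : {rmorphism L -> L}, forall x, phi x = x ^+ (p ^ i).
Proof.
move=> chL; elim: i => [|k [phi phiE]].
  by exists idfun => x; rewrite expr1.
exists ((pFrobenius_aut chL \o phi) : {rmorphism L -> L}) => x.
by rewrite /= pFrobenius_autE phiE -exprM expnSr.
Qed.

Section ConjPoly.

Variables (F E : finFieldType) (emb : {rmorphism F -> E}) (d : nat).
Hypotheses (d_gt0 : (0 < d)%N) (cardE : #|E| = (#|F| ^ d)%N).
Let Q := #|F|.

Lemma finField_frobenius i :
  exists phi : {rmorphism E -> E}, forall x, phi x = x ^+ (#|F| ^ i).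
Proof.
have [p prp chF] := finPcharP F.
have chE : p \in [pchar E] by rewrite (fmorph_pchar emb).
have [phi phiE] := frobenius_rmorphism (logn p #|F| * i) chE.
by exists phi => x; rewrite phiE expnM -card_pchar.
Qed.

Lemma frobenius_fixed (x : E) : x ^+ Q = x -> exists a, x = emb a.
Proof.
move=> xQ; have := congr1 (fun P => (map_poly emb P).[x]) (finField_genPoly F).
rewrite rmorphB rmorphXn /= map_polyX !hornerE xQ subrr => /esym /eqP.
rewrite rmorph_prod horner_prod /= prodf_seq_eq0 => /hasP[a _ /=].
rewrite rmorphB /= map_polyX map_polyC !hornerE subr_eq0 => /eqP.
by exists a.
Qed.

Lemma expf_cardX (x : E) i : x ^+ (Q ^ (d * i)) = x.
Proof.
rewrite expnM -cardE; elim: i => [|i IHi]; first by rewrite expr1.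
by rewrite expnSr exprM IHi expf_card.
Qed.

Definition emb_inv (y : E) : F := odflt 0 [pick a | emb a == y].

Lemma embK : cancel emb emb_inv.
Proof.
move=> a; rewrite /emb_inv; case: pickP => [b /eqP /fmorph_inj //|/(_ a)].
by rewrite eqxx.
Qed.

Lemma emb_invK y : y ^+ Q = y -> emb (emb_inv y) = y.
Proof. by move=> /frobenius_fixed[a ->]; rewrite embK. Qed.

(** Conjugates with multiplicity: there are always d entries, even if x generates a smaller field,
    so the product of the X - y is the characteristic polynomial and not the minimal one. *)
Definition conjs (x : E) : seq E := mkseq (fun i => x ^+ (Q ^ i)) d.

Lemma size_conjs x : size (conjs x) = d.
Proof. exact: size_mkseq. Qed.

Lemma mem_conjs x : x \in conjs x.
Proof. by apply/mapP; exists 0%N; rewrite ?mem_iota ?expr1. Qed.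

Definition embed_poly_conjs x : {poly E} := \prod_(y <- conjs x) ('X - y%:P).

(** Frobenius shifts the list of conjugates cyclically, because x^(Q^d) = x. *)
Lemma big_conjs_frob (T : Type) (idx : T) (op : Monoid.com_law idx)
    (f : E -> T) x :
  \big[op/idx]_(y <- conjs x) f (y ^+ Q) = \big[op/idx]_(y <- conjs x) f y.
Proof.
have [d' dE] : exists d', d = d'.+1 by exists d.-1; rewrite prednK.
have xQ : x ^+ (Q ^ d) = x by rewrite -[d]muln1 expf_cardX.
have bigE g : \big[op/idx]_(i <- iota 0 d) g i = \big[op/idx]_(i < d) g i.
  by rewrite -(big_mkord xpredT) /index_iota subn0.
rewrite !big_map !{}bigE.
rewrite {}dE in xQ *; rewrite big_ord_recr big_ord_recl /= Monoid.mulmC expr1.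
rewrite -exprM -expnSr xQ; congr (op _ _).
by apply: eq_bigr => i _; rewrite -exprM -expnSr.
Qed.

Lemma sum_conjs_fixed x : (\sum_(y <- conjs x) y) ^+ Q = \sum_(y <- conjs x) y.
Proof.
have [phi] := finField_frobenius 1; rewrite expn1 => phiE.
rewrite -phiE rmorph_sum -[RHS](big_conjs_frob _ id).
by apply: eq_bigr => y _; rewrite phiE.
Qed.

Lemma prod_conjs_fixed x : (\prod_(y <- conjs x) y) ^+ Q = \prod_(y <- conjs x) y.
Proof. by rewrite -prodrXl -[RHS](big_conjs_frob _ id). Qed.

(** The characteristic polynomial of x over [F]. The coefficients upstairs are fixed by Frobenius,
    so [emb_inv] never falls back on its default value. *)
Definition conj_poly x : {poly F} := map_poly emb_inv (embed_poly_conjs x).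

Lemma map_conj_poly x : map_poly emb (conj_poly x) = \prod_(y <- conjs x) ('X - y%:P).
Proof.
have [phi] := finField_frobenius 1; rewrite expn1 => phiE.
have emb_inv0 : emb_inv 0 = 0 by rewrite -(rmorph0 emb) embK.
have phiP : map_poly phi (embed_poly_conjs x) = embed_poly_conjs x.
  rewrite rmorph_prod -[RHS](big_conjs_frob _ (fun y => 'X - y%:P)).
  by apply: eq_bigr => y _; rewrite rmorphB /= map_polyX map_polyC /= phiE.
rewrite /conj_poly -/(embed_poly_conjs x).
apply/polyP => i; rewrite !coef_map_id0 ?rmorph0 // emb_invK //.
by rewrite -phiE -coef_map /= phiP.
Qed.

Lemma size_conj_poly x : size (conj_poly x) = d.+1.
Proof. by rewrite -(size_map_poly emb) map_conj_poly size_prod_XsubC size_conjs. Qed.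

Lemma monic_conj_poly x : conj_poly x \is monic.
Proof. by rewrite -(map_monic emb) map_conj_poly monic_prod_XsubC. Qed.

Lemma root_conj_poly x : root (map_poly emb (conj_poly x)) x.
Proof. by rewrite map_conj_poly root_prod_XsubC mem_conjs. Qed.

Lemma root_frob (P : {poly F}) x i :
  root (map_poly emb P) x -> root (map_poly emb P) (x ^+ (Q ^ i)).
Proof.
have [phi phiE] := finField_frobenius i.
move=> /rootP Px; rewrite /root -phiE.
suff <- : phi (map_poly emb P).[x] = (map_poly emb P).[phi x].
  by rewrite Px rmorph0.
rewrite -horner_map -map_poly_comp /=; congr _.[_].
have aQ (a : F) : a ^+ (#|F| ^ i) = a.
  by elim: (i) => [|k IHk]; rewrite ?expr1 // expnSr exprM IHk expf_card.
by apply: eq_map_poly => a /=; rewrite phiE -[in RHS](aQ a) rmorphXn.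
Qed.

(** P also vanishes at the conjugate y, and polynomials that are coprime over [F] stay coprime in
    [E], hence share no root there. *)
Lemma root_irreducible_conj (P : {poly F}) x y :
  irreducible_poly P -> root (map_poly emb P) x ->
  y \in conjs x -> forall R, irreducible_poly R -> root (map_poly emb R) y -> R %= P.
Proof.
move=> irrP Px /mapP[i _ ->] R irrR Ry.
have Py := root_frob i Px.
apply: (apply_irredp irrP); first by rewrite gtn_eqF //; case: irrR.
apply: contraLR Py => nRP; have : coprimep R P by rewrite irreducible_poly_coprime.
by rewrite -(coprimep_map emb) => /coprimep_root /(_ Ry).
Qed.

End ConjPoly.

(** The class of X lives in the field F[X]/(P), whose cardinality is the exponent in question. *)
Lemma monic_irreducible_dvd_Xq (F : finFieldType) (P : {poly F}) :
  irreducible_poly P -> P \is monic -> P %| 'X^(#|F| ^ (size P).-1) - 'X.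
Proof.
move=> irrP monP; have hI : monic_irreducible_poly P by split.
pose x : {poly %/ P with hI} := in_qpoly P 'X.
have := expf_card x; rewrite card_qfpoly => /eqP; rewrite -subr_eq0.
have -> : x ^+ (#|F| ^ (size P).-1) - x =
    in_qpoly P ('X^(#|F| ^ (size P).-1) - 'X).
  by rewrite [RHS]rmorphB [in RHS]rmorphXn.
move=> /eqP /(congr1 val) /=.
by rewrite -Pdiv.IdomainMonic.modpE ?mk_monicE // => /eqP.
Qed.

Lemma monic_irreducible_factor (F : finFieldType) (h : {poly F}) :
  (1 < size h)%N ->
  exists P, [/\ irreducible_poly P, P \is monic & P %| h].
Proof.
have [n] := ubnP (size h); elim: n h => // n IHn h; rewrite ltnS => le_n h_gt1.
have h0 : h != 0 by rewrite -size_poly_gt0 (ltn_trans _ h_gt1).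
have [irr|nirr] := irreducibleP h.
  exists ((lead_coef h)^-1 *: h); split.
  - have lc0 : (lead_coef h)^-1 != 0 by rewrite invr_eq0 lead_coef_eq0.
    split; first by rewrite size_scale.
    move=> q q1; rewrite dvdpZr // => /(apply_irredp irr q1).
    by rewrite eqp_sym => /(eqp_trans _); rewrite eqp_sym; apply; rewrite eqp_scale.
  - by rewrite monicE lead_coefZ mulVf // lead_coef_eq0.
  - by rewrite dvdpZl // invr_eq0 lead_coef_eq0.
have [q [q1 qh nqh]] : exists q : {poly F}, [/\ size q != 1%N, q %| h & ~~ (q %= h)].
  apply: contrapT => nex; apply: nirr; split=> // q q1 qh.
  by apply: contrapT => /negP nqh; apply: nex; exists q.
have q0 : q != 0 by apply: contraNneq h0 => q0; rewrite q0 dvd0p in qh.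
have ltqh : (size q < size h)%N.
  by rewrite ltn_neqAle dvdp_leq // andbT dvdp_size_eqp.
have [||P [irrP monP Pq]] := IHn q.
- exact: leq_trans ltqh _.
- by rewrite ltn_neqAle eq_sym q1 size_poly_gt0.
by exists P; split=> //; apply: dvdp_trans qh.
Qed.

Lemma size_monic_exp (R : nzRingType) (P : {poly R}) j :
  P \is monic -> size (P ^+ j) = (j * (size P).-1).+1.
Proof.
move=> monP; elim: j => [|j IHj]; first by rewrite expr0 size_poly1.
rewrite exprS size_monicM ?monic_neq0 ?monic_exp // IHj mulSn addnS /=.
by rewrite -addSn prednK // size_poly_gt0 monic_neq0.
Qed.

Lemma monic_prime_power (F : finFieldType) (P C : {poly F}) :
  P \is monic -> C \is monic ->
  (forall R, irreducible_poly R -> R \is monic -> R %| C -> R = P) ->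
  exists j, C = P ^+ j.
Proof.
move=> monP; have [n] := ubnP (size C); elim: n C => // n IHn C.
rewrite ltnS => le_n monC uniqC.
have [C1|C_gt1] := leqP (size C) 1.
  exists 0%N; rewrite expr0; move: monC; rewrite (size1_polyC C1) monicE.
  by rewrite lead_coefC => /eqP ->.
have [R [irrR monR RC]] := monic_irreducible_factor C_gt1.
have eR := uniqC R irrR monR RC; subst R.
have [C' eC] := dvdpP _ _ RC.
have monC' : C' \is monic by rewrite eC monicMr in monC.
have [||S ? ? SC|j eC'] := IHn C'.
- apply: leq_trans le_n; rewrite eC size_Mmonic ?monic_neq0 //.
  by case: irrR => + _; have := monic_neq0 monC'; rewrite -size_poly_gt0; clear; move: (size C') (size P) => a b; lia.
- by [].
- by apply: uniqC => //; rewrite eC dvdp_mulr.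
by exists j.+1; rewrite eC eC' exprSr.
Qed.

Section CountFactors.

Variables (F E : finFieldType) (emb : {rmorphism F -> E}) (d : nat).
Hypotheses (d_gt0 : (0 < d)%N) (cardE : #|E| = (#|F| ^ d)%N).

Lemma irreducible_factor_conj_poly (x : E) (R : {poly F}) :
  irreducible_poly R -> R %| conj_poly emb d x ->
  exists2 y, y \in conjs F d x & root (map_poly emb R) y.
Proof.
move=> irrR; rewrite -(dvdp_map emb) map_conj_poly // => RC.
apply: contrapT => noroot.
have : coprimep (map_poly emb R) (map_poly emb R).
  apply: coprimep_dvdr RC _; rewrite big_seq.
  elim/big_rec: _ => [|y p yC Hp]; first exact: coprime1p.
  rewrite coprimepMl Hp coprimep_sym coprimep_XsubC andbT.
  by apply/negP => Ry; apply: noroot; exists y.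
by rewrite coprimepp size_map_poly; case: irrR => R_gt1 _; rewrite gtn_eqF.
Qed.

(** All conjugates of x have minimal polynomial P, so the characteristic polynomial has no other
    irreducible factor. *)
Lemma conj_poly_power (x : E) (P : {poly F}) :
  irreducible_poly P -> P \is monic -> root (map_poly emb P) x ->
  exists j, conj_poly emb d x = P ^+ j.
Proof.
move=> irrP monP Px; apply: monic_prime_power (monic_conj_poly _ _ _ _) _ => //.
move=> R irrR monR /(irreducible_factor_conj_poly irrR)[y yC Ry].
apply/eqP; rewrite -eqp_monic //.
exact: (root_irreducible_conj irrP Px yC irrR Ry).
Qed.

Lemma conj_poly_irreducible (x : E) :
  exists P j, [/\ irreducible_poly P, P \is monic, root (map_poly emb P) x
    & conj_poly emb d x = P ^+ j].
Proof.
have C_gt1 : (1 < size (conj_poly emb d x))%N by rewrite size_conj_poly.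
have [P [irrP monP PC]] := monic_irreducible_factor C_gt1.
have [_ /mapP[i + ->] Py] := irreducible_factor_conj_poly irrP PC => iI.
have Px : root (map_poly emb P) x.
  move: iI; rewrite mem_iota add0n => /andP[_ /ltnW lt_id].
  have := root_frob (d - i) Py.
  by rewrite -exprM -expnD subnKC // -[d]muln1 expf_cardX.
by have [j ->] := conj_poly_power irrP monP Px; exists P, j.
Qed.

(** A characteristic polynomial is a power of one irreducible polynomial. If that is not P, the
    extra factor P changes nothing; if it is P, only the exponent e + 1 is gained. *)
Lemma dvd_conj_polyM (x : E) (P h : {poly F}) e :
  irreducible_poly P -> P \is monic -> P ^+ e %| h -> ~~ (P ^+ e.+1 %| h) ->
  (conj_poly emb d x %| P * h) =
  (conj_poly emb d x %| h) || (conj_poly emb d x == P ^+ e.+1).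
Proof.
move=> irrP monP Peh nPeh; have P0 := monic_neq0 monP.
apply/idP/orP => [CPh|[Ch|/eqP ->]]; last 2 first.
- exact: dvdp_mull.
- by rewrite exprS dvdp_mul2l.
have [R [j [irrR monR _ eC]]] := conj_poly_irreducible x; rewrite eC in CPh *.
have [eRP|nRP] := eqVneq R P.
  rewrite eRP in CPh *; have [je|ej|->] := ltngtP j e.+1; last by right.
    by left; apply: dvdp_trans Peh; apply: dvdp_exp2l.
  case/negP: nPeh; rewrite -(dvdp_mul2l _ _ P0) -exprS.
  by apply: dvdp_trans CPh; apply: dvdp_exp2l.
left; move: CPh; rewrite Gauss_dvdpr //; apply: coprimep_expl.
rewrite irreducible_poly_coprime //; apply: contra_neqN nRP => RP.
apply/eqP; rewrite -eqp_monic //; apply: (apply_irredp irrP) => //.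
by rewrite gtn_eqF //; case: irrR.
Qed.

(** As deg P divides d, P divides X^(q^d) - X, which splits into distinct linear factors over
    [E]. *)
Lemma card_roots_irreducible (P : {poly F}) e :
  irreducible_poly P -> P \is monic -> d = (e * (size P).-1)%N ->
  #|[set x | root (map_poly emb P) x]| = (size P).-1.
Proof.
move=> irrP monP dE; set m := (size P).-1.
have Pdvd : P %| 'X^(#|F| ^ d) - 'X.
  apply: dvdp_trans (monic_irreducible_dvd_Xq irrP monP) _; rewrite -/m.
  rewrite dE mulnC; elim: e {dE} => [|e IHe].
    by rewrite muln0 expr1 subrr dvdp0.
  rewrite mulnS expnD exprM; set k := (#|F| ^ (m * e))%N in IHe *; set Y := 'X^(#|F| ^ m).
  have -> : Y ^+ k - 'X = (Y ^+ k - 'X^k) + ('X^k - 'X) by ring.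
  by rewrite dvdp_add // subrXX dvdp_mulr.
have Pdvd' : map_poly emb P %| \prod_(y : E) ('X - y%:P).
  rewrite -finField_genPoly cardE.
  by move: Pdvd; rewrite -(dvdp_map emb) rmorphB rmorphXn /= map_polyX.
have [s Ps] := dvdp_prod_XsubC Pdvd'.
have uniq_s : uniq (mask s (index_enum E)) by rewrite mask_uniq // index_enum_uniq.
have -> : [set x | root (map_poly emb P) x] = [set x in mask s (index_enum E)].
  by apply/setP => x; rewrite !inE (eqp_root Ps) root_prod_XsubC.
rewrite cardsE (card_uniqP uniq_s) /m -(size_map_poly emb P).
by rewrite (eqp_size Ps) size_prod_XsubC.
Qed.

(** By degrees P^e can be a characteristic polynomial only if e deg P = d, and then it is that of
    exactly the roots of P. *)
Lemma card_conj_poly_power (P : {poly F}) e :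
  irreducible_poly P -> P \is monic ->
  #|[set x : E | conj_poly emb d x == P ^+ e]| =
  if (e * (size P).-1 == d)%N then (size P).-1 else 0%N.
Proof.
move=> irrP monP.
have P_gt1 : (0 < (size P).-1)%N by case: irrP; case: (size P) => [|[]].
case: eqP => [dE|neq]; last first.
  apply/eqP; rewrite cards_eq0; apply/eqP/setP => x; rewrite !inE.
  apply/negbTE/eqP => eC; apply: neq; apply: succn_inj.
  by rewrite -!size_monic_exp // -eC size_conj_poly.
rewrite -[RHS](@card_roots_irreducible P e) //; congr #|pred_of_set _|.
apply/setP => x; rewrite !inE; apply/eqP/idP => [eC|Px].
  have := root_conj_poly emb d_gt0 cardE x; rewrite eC rmorphXn /= => Pex.
  apply: contraTT Pex => nPx; rewrite /root horner_exp expf_eq0 negb_and.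
  by rewrite nPx orbT.
have [j eC] := conj_poly_power irrP monP Px; rewrite eC; congr (_ ^+ _).
apply/eqP; rewrite -(eqn_pmul2r P_gt1) dE -eqSS -!size_monic_exp // -eC.
by rewrite size_conj_poly.
Qed.

End CountFactors.

(** * The Hasse-Davenport relation *)

Section HasseDavenport.

Variables (F : finFieldType) (E : nat -> finFieldType).
Variable emb : forall k, {rmorphism F -> E k}.
Hypothesis cardE : forall k, #|E k| = (#|F| ^ k.+1)%N.

Local Notation cpoly k x := (conj_poly (emb k) k.+1 x).
Local Notation factors k h := [set x : E k | cpoly k x %| h].

(** The analogue of sum_(d | n) Lambda(d) = log n. By unique factorization deg h is the sum of deg P
    over the prime powers P^e dividing h, and P^e is the characteristic polynomial of deg P
    elements, all in the extension of degree e deg P. *)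
Lemma sum_card_conj_poly_dvd (h : {poly F}) m :
  h \is monic -> (size h <= m.+1)%N ->
  (\sum_(k < m) #|factors k h| = (size h).-1)%N.
Proof.
have [n] := ubnP (size h); elim: n h => // n IHn h.
rewrite ltnS => le_n monh le_m.
have [h1|h_gt1] := leqP (size h) 1.
  have -> : h = 1.
    by move: monh; rewrite (size1_polyC h1) monicE lead_coefC => /eqP ->.
  rewrite size_poly1 /= big1 // => k _; apply/eqP.
  rewrite cards_eq0; apply/eqP/setP => x; rewrite !inE dvdp1.
  by rewrite size_conj_poly.
have [P [irrP monP]] := monic_irreducible_factor h_gt1.
move=> /dvdpP[h' eh]; rewrite mulrC in eh.
have P_gt1 : (1 < size P)%N by case: irrP.
have monh' : h' \is monic by rewrite eh monicMl in monh.
have szh : size h = ((size P).-1 + size h')%N.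
  rewrite eh size_monicM ?monic_neq0 //; move: P_gt1; clear.
  by move: (size P) (size h') => a b; lia.
have h'_gt0 : (0 < size h')%N by rewrite size_poly_gt0 monic_neq0.
(* With e the multiplicity of P in h' = h / P, restoring P adds the single prime power divisor
   P^(e+1). *)
have [e [Peh' nPeh']] : exists e, P ^+ e %| h' /\ ~~ (P ^+ e.+1 %| h').
  have exP : exists e, ~~ (P ^+ e.+1 %| h').
    exists (size h'); apply/negP => /dvdp_leq; rewrite monic_neq0 // => /(_ isT).
    rewrite size_monic_exp // ltn_geF //.
    by move: (size P) (size h') P_gt1; nia.
  case: (ex_minnP exP) => -[|e] nPe minPe; first by exists 0%N; rewrite expr0 dvd1p.
  exists e.+1; split=> //; apply: contraT => /minPe; lia.
have sz_le : (e.+1 * (size P).-1 <= m)%N.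
  have := dvdp_leq (monic_neq0 monh') Peh'; rewrite size_monic_exp // => le_e.
  move: P_gt1 szh le_e le_m; clear.
  by move: (size P) (size h') (size h) => a b c; nia.
transitivity (\sum_(k < m) (#|factors k h'| +
   (if (e.+1 * (size P).-1 == k.+1) then (size P).-1 else 0)))%N.
  apply: eq_bigr => k _.
  have -> : factors k h =
    factors k h' :|: [set x : E k | cpoly k x == P ^+ e.+1].
    by apply/setP => x; rewrite !inE eh (@dvd_conj_polyM _ _ _ _ _ _ _ _ _ e).
  rewrite cardsU card_conj_poly_power //.
  have -> : factors k h' :&: [set x | cpoly k x == P ^+ e.+1]
     = finset.set0.
    apply/setP => x; rewrite !inE; apply/negbTE/andP => -[+ /eqP eC].
    by rewrite eC (negbTE nPeh').
  by rewrite cards0 subn0.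
rewrite big_split /= IHn //; last 2 first.
- by apply: leq_trans le_n; rewrite szh; move: P_gt1; clear; move: (size P) (size h') => a b; lia.
- by apply: leq_trans le_m; rewrite szh leq_addl.
have pos : (0 < e.+1 * (size P).-1)%N by rewrite muln_gt0; move: (size P) P_gt1; lia.
have lt_m : ((e.+1 * (size P).-1).-1 < m)%N by rewrite prednK.
rewrite (bigD1 (Ordinal lt_m)) //= prednK // eqxx big1 => [|k /negbTE].
  by rewrite szh; move: h'_gt0; move: (size P).-1 (size h') => a b; lia.
rewrite -val_eqE /= => nk; case: eqP => // ek; case/eqP: nk.
by rewrite ek.
Qed.


Variables (K : idomainType) (psi chi : F -> K).
Hypothesis psi0 : psi 0 = 1.
Hypothesis psiD : forall x y, psi (x + y) = psi x * psi y.
Hypothesis psi_nontrivial : exists x, psi x != 1.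
Hypothesis chi1 : chi 1 = 1.
Hypothesis chiM : forall x y, chi (x * y) = chi x * chi y.

(* For h = X^m - c_1 X^(m-1) + ... + (-1)^m c_m, this is psi(c_1) chi(c_m);
   the factor 'X makes the formula valid for m = 0 as well. *)
Definition weil_char (h : {poly F}) : K :=
  psi (- ('X * h)`_(size h).-1) * chi ((-1) ^+ (size h).-1 * h`_0).

Lemma weil_char1 : weil_char 1 = 1.
Proof. by rewrite /weil_char size_poly1 mulr1 coefX coef1 oppr0 psi0 !mul1r chi1. Qed.

Lemma coefM_subleading (R : comNzRingType) (p q : {poly R}) a b :
  (size p <= a.+2)%N -> (size q <= b.+2)%N ->
  (p * q)`_(a + b).+1 = p`_a * q`_b.+1 + p`_a.+1 * q`_b.
Proof.
move=> sp sq; rewrite coefM.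
have la : (a < (a + b).+2)%N by lia.
have la1 : (a.+1 < (a + b).+2)%N by lia.
rewrite (bigD1 (Ordinal la)) //= (bigD1 (Ordinal la1)) /=; last first.
  by rewrite -val_eqE /= gtn_eqF.
rewrite big1 => [|i]; last first.
  rewrite -!val_eqE /= => /andP[ia ia1].
  have [lt_ia|le_ai] := ltnP i a.
    by rewrite [q`_ _]nth_default ?mulr0 // (leq_trans sq) //; lia.
  by rewrite [p`_ _]nth_default ?mul0r // (leq_trans sp) //; lia.
by rewrite addr0 -addnS addKn addnS subSS addKn.
Qed.

(** Under products of monic polynomials the subleading coefficient is additive and the signed
    constant term multiplicative, like trace and norm. *)
Lemma weil_charM h1 h2 : h1 \is monic -> h2 \is monic ->
  weil_char (h1 * h2) = weil_char h1 * weil_char h2.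
Proof.
move=> mon1 mon2; rewrite /weil_char.
have s1 : (0 < size h1)%N by rewrite size_poly_gt0 monic_neq0.
have s2 : (0 < size h2)%N by rewrite size_poly_gt0 monic_neq0.
rewrite size_monicM ?monic_neq0 //.
have -> : (size h1 + size h2).-1.-1 = ((size h1).-1 + (size h2).-1)%N by lia.
have lead1 : h1`_(size h1).-1 = 1 by apply/eqP; rewrite -monicE.
have lead2 : h2`_(size h2).-1 = 1 by apply/eqP; rewrite -monicE.
have -> : ('X * (h1 * h2))`_((size h1).-1 + (size h2).-1) =
    ('X * h1)`_(size h1).-1 + ('X * h2)`_(size h2).-1.
  have := @coefM_subleading _ ('X * h1) ('X * h2) (size h1).-1 (size h2).-1.
  have szX (h : {poly F}) : h \is monic -> size ('X * h) = (size h).+1.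
    by move=> ?; rewrite mulrC size_mulX ?monic_neq0.
  rewrite !szX // !prednK // => /(_ (leqnn _) (leqnn _)).
  have XM (h : {poly F}) i : ('X * h)`_i.+1 = h`_i by rewrite coefXM.
  by rewrite mulrACA -mulrA XM -(XM h1) -(XM h2) !prednK // in lead1 lead2 * => ->; rewrite lead1 lead2 mulr1 mul1r.
rewrite opprD psiD exprD coef0M [RHS]mulrACA -chiM; congr (_ * chi _).
by rewrite mulrACA.
Qed.

(** Row vectors parametrize the monic polynomials of degree m, so that sums over these run over a
    finite type. *)
Definition monic_of_row m (v : 'rV[F]_m) : {poly F} := 'X^m + rVpoly v.

Lemma size_monic_of_row m (v : 'rV[F]_m) : size (monic_of_row v) = m.+1.
Proof.
rewrite /monic_of_row size_polyDl ?size_polyXn // ltnS.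
exact: size_poly.
Qed.

Lemma monic_monic_of_row m (v : 'rV[F]_m) : monic_of_row v \is monic.
Proof.
rewrite monicE /lead_coef size_monic_of_row coefD coefXn eqxx /=.
by rewrite [X in _ + X]nth_default ?addr0 //; apply: size_poly.
Qed.

Lemma monic_of_rowK m (h : {poly F}) : h \is monic -> size h = m.+1 ->
  monic_of_row (poly_rV (h - 'X^m) : 'rV_m) = h.
Proof.
move=> monh szh; have lead_h : h`_m = 1.
  by move: monh; rewrite monicE /lead_coef szh => /eqP.
rewrite /monic_of_row poly_rV_K; first by rewrite addrC subrK.
apply/leq_sizeP => j; rewrite leq_eqVlt coefB coefXn => /orP[/eqP <-|lt_mj].
  by rewrite eqxx lead_h subrr.
by rewrite gtn_eqF // nth_default ?szh // subr0.
Qed.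

Lemma monic_of_row_inj m : injective (@monic_of_row m).
Proof. by move=> v w /addrI /(can_inj rVpolyK). Qed.

(** The coefficient of T^m in the L-series of [weil_char]. *)
Definition weil_sum m : K := \sum_(v : 'rV[F]_m) weil_char (monic_of_row v).

Lemma weil_sum0 : weil_sum 0 = 1.
Proof.
rewrite /weil_sum (big_pred1 0) => [|v]; last by apply/esym/eqP; rewrite [LHS]thinmx0.
by rewrite /monic_of_row expr0 raddf0 addr0 weil_char1.
Qed.

Lemma weil_sum1 : weil_sum 1 = \sum_x psi x * chi x.
Proof.
rewrite /weil_sum.
(* The row with entry -x stands for the polynomial X - x, on which [weil_char] is psi(x) chi(x). *)
rewrite (reindex (fun x : F => (- x)%:M : 'rV_1)) /=; last first.
  exists (fun v : 'rV_1 => - v 0 0) => [x _|v _]; first by rewrite mxE /= opprK.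
  by rewrite opprK -mx11_scalar.
apply: eq_bigr => x _.
have rE : rVpoly ((- x)%:M : 'rV_1) = - x%:P.
  rewrite -polyCN; apply/polyP => i; rewrite coef_rVpoly coefC.
  case: insubP => [[j lt_j1] _ /= <-|]; last by case: i.
  by move: j lt_j1 => [|//] ?; rewrite mxE.
rewrite /weil_char size_monic_of_row /= /monic_of_row rE expr1 coefXM /=.
rewrite !coefB !coefX !coefC /=.
by rewrite expr1 mulN1r sub0r opprK.
Qed.

(** For m > 1 the coefficient of X^(m-1) is not the constant term. Subtracting b from it permutes
    the monic polynomials and multiplies every summand by psi(b), and b is chosen with psi(b) !=
    1. *)
Lemma weil_sum_eq0 m : (1 < m)%N -> weil_sum m = 0.
Proof.
case: m => [|[|m]] // _; have [b psib] := psi_nontrivial.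
suff eqS : weil_sum m.+2 = psi b * weil_sum m.+2.
  apply/eqP; have /eqP : (1 - psi b) * weil_sum m.+2 = 0.
    by rewrite mulrBl mul1r -eqS subrr.
  by rewrite mulf_eq0 subr_eq0 eq_sym (negbTE psib).
rewrite {1}/weil_sum (reindex_inj (addrI (- b *: delta_mx 0 ord_max))) /=.
rewrite /weil_sum mulr_sumr; apply: eq_bigr => v _.
rewrite /weil_char !size_monic_of_row /=.
have -> : monic_of_row (- b *: delta_mx 0 ord_max + v) =
    monic_of_row v - b *: 'X^(m.+1).
  by rewrite /monic_of_row linearD linearZ /= rVpoly_delta /= scaleNr addrCA addrC.
rewrite !coefXM /= !coefB !coefZ !coefXn eqxx /= mulr0 subr0 mulr1 opprB psiD.
by rewrite mulrA.
Qed.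

Definition weil_power_sum k : K := \sum_(x : E k) weil_char (cpoly k x).

(** The two coefficients of the characteristic polynomial are trace and norm, so this is the sum
    over [E k] of psi and chi lifted along trace and norm. *)
Lemma weil_power_sumE k : weil_power_sum k =
  \sum_(x : E k) psi (emb_inv (emb k) (\sum_(y <- conjs F k.+1 x) y)) *
                 chi (emb_inv (emb k) (\prod_(y <- conjs F k.+1 x) y)).
Proof.
apply: eq_bigr => x _; rewrite /weil_char size_conj_poly //=.
have sz : size (conjs F k.+1 x) = k.+1 by rewrite size_conjs.
congr (psi _ * chi _); apply: (fmorph_inj (emb k)); rewrite emb_invK ?sum_conjs_fixed ?prod_conjs_fixed //.
  rewrite rmorphN coefXM /= -coef_map map_conj_poly //.
  by rewrite -[X in _`_X]/(k.+1.-1) -[in X in _`_X]sz coefPn_prod_XsubC ?sz // opprK.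
rewrite rmorphM rmorphXn rmorphN1 -coef_map map_conj_poly //.
by rewrite coef0_prod_XsubC sz mulrA -exprMn mulrNN mulr1 expr1n mul1r.
Qed.

(* With L = sum_m (weil_sum m) T^m, this is T L' = L sum_k (weil_power_sum k) T^(k+1);
   both sides sum weil_char h over the pairs (h, x) with cpoly k x %| h. *)
Lemma weil_recursion m :
  m%:R * weil_sum m = \sum_(k < m) weil_power_sum k * weil_sum (m - k.+1).
Proof.
transitivity (\sum_(v : 'rV[F]_m) \sum_(k < m)
   \sum_(x : E k | cpoly k x %| monic_of_row v) weil_char (monic_of_row v)).
  rewrite /weil_sum mulr_sumr; apply: eq_bigr => v _.
  under eq_bigr => k _.
    rewrite sumr_const.
    over.
  rewrite sumrMnr mulr_natl; congr (_ *+ _).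
  have := @sum_card_conj_poly_dvd (monic_of_row v) m (monic_monic_of_row v).
  rewrite size_monic_of_row => /(_ (leqnn _)) /= /esym eq_m; rewrite [LHS]eq_m.
  by apply: eq_bigr => k _; apply: eq_card => x; rewrite !inE.
rewrite exchange_big /=; apply: eq_bigr => k _.
rewrite (exchange_big_dep xpredT) //= mulr_suml; apply: eq_bigr => x _.
set C := cpoly k x; have monC : C \is monic by apply: monic_conj_poly.
have szC : size C = k.+2 by apply: size_conj_poly.
pose f (w : 'rV[F]_(m - k.+1)) : 'rV[F]_m := poly_rV (C * monic_of_row w - 'X^m).
have fE w : monic_of_row (f w) = C * monic_of_row w.
  apply: monic_of_rowK; first by rewrite monicMl // monic_monic_of_row.
  rewrite size_monicM ?monic_neq0 ?monic_monic_of_row // szC size_monic_of_row.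
  by have := ltn_ord k; lia.
pose g (v : 'rV[F]_m) : 'rV[F]_(m - k.+1) := poly_rV (monic_of_row v %/ C - 'X^(m - k.+1)).
rewrite (reindex_onto f g) /=.
  rewrite mulr_sumr; apply: eq_big => [w|w _].
    rewrite fE dvdp_mulr //= /g fE mulrC mulpK ?monic_neq0 //.
    by rewrite [monic_of_row w]addrC addrK rVpolyK eqxx.
  by rewrite fE weil_charM // monic_monic_of_row.
move=> v Cv; apply: monic_of_row_inj; rewrite fE.
have eq_v : C * (monic_of_row v %/ C) = monic_of_row v by rewrite mulrC divpK.
have monq : monic_of_row v %/ C \is monic.
  by have := monic_monic_of_row v; rewrite -{1}eq_v monicMl.
rewrite monic_of_rowK //.
have := size_monic_of_row v; rewrite -{1}eq_v size_monicM ?monic_neq0 // szC.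
by have := ltn_ord k; move: (size _); lia.
Qed.

(** The L-series is 1 + g T with g the Gauss sum over [F], so the recursion has only two terms left
    and each power sum is -g times the previous one. *)
Theorem hasse_davenport k :
  weil_power_sum k = (-1) ^+ k * (\sum_x psi x * chi x) ^+ k.+1.
Proof.
elim: k => [|k IHk].
  by have := weil_recursion 1; rewrite big_ord1 weil_sum0 weil_sum1 mulr1 !mul1r => ->.
have := weil_recursion k.+2; rewrite weil_sum_eq0 // mulr0 big_ord_recr big_ord_recr /=.
rewrite subnn weil_sum0 mulr1 subSnn weil_sum1 IHk big1 ?add0r => [/esym /eqP|i _].
  rewrite addrC addr_eq0 => /eqP ->.
  by rewrite -mulrA -exprSr [in RHS]exprS mulN1r mulNr.
by rewrite weil_sum_eq0 ?mulr0 //; have := ltn_ord i; lia.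
Qed.

End HasseDavenport.

(** * Embedding finite fields into fields with enough roots of unity *)

Lemma finField_generator (E : finFieldType) :
  exists2 g : E, #|E|.-1.-primitive_root g & forall x, x != 0 -> exists i, x = g ^+ i.
Proof.
have /cyclicP[u uE] := field_unit_group_cyclic [set: {unit E}].
have ou : #[u]%g = #|E|.-1 by rewrite orderE -uE card_finField_unit.
exists (FinRing.uval u).
  apply/andP; split; first by rewrite -ou fingroup.order_gt0.
  apply/forallP => i; rewrite unity_rootE; apply/eqP.
  have -> : (FinRing.uval u ^+ i.+1 == 1) = (u ^+ i.+1 == 1)%g.
    by rewrite -FinRing.val_unitX -FinRing.val_unit1 val_eqE.
  rewrite -order_dvdn ou; apply/idP/eqP => [dv|->] //.
  apply/eqP; rewrite eqn_leq ltn_ord /=.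
  by apply: dvdn_leq dv.
move=> x x0; have xU : x \is a GRing.unit by rewrite unitfE.
have : FinRing.unit E xU \in <[u]>%g by rewrite -uE inE.
case/cycleP => i /(congr1 val) /= ->; exists i.
by rewrite -FinRing.val_unitX.
Qed.

(** A generator g of the multiplicative group of [E] is sent to a root in L of its minimal
    polynomial P over [F]. The list s ensures that X^|E| - X, a multiple of P, splits in L. *)
Lemma finField_embedding (F E : finFieldType) (emb : {rmorphism F -> E}) d
    (L : fieldType) (h : {rmorphism F -> L}) (s : seq L) :
  (0 < d)%N -> #|E| = (#|F| ^ d)%N ->
  uniq s -> size s = #|E| -> {in s, forall x, x ^+ #|E| = x} ->
  exists j : {rmorphism E -> L}, forall a, j (emb a) = h a.
Proof.
move=> d_gt0 cardE uniq_s size_s sP.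
have [g _ gP] := finField_generator E.
have [P [_ [irrP monP Pg _]]] := conj_poly_irreducible emb d_gt0 cardE g.
have kerP R : root (map_poly emb R) g -> P %| R.
  move=> Rg; apply: contraLR Rg => nPR.
  have : coprimep P R by rewrite irreducible_poly_coprime.
  by rewrite -(coprimep_map emb) => /coprimep_root /(_ Pg).
have PX : P %| 'X^#|E| - 'X.
  apply: kerP; rewrite rmorphB rmorphXn /= map_polyX /root !hornerE.
  by rewrite expf_card subrr.
have [z Pz] : exists z, root (map_poly h P) z.
  (* Without a root of P, all |E| members of s would be roots of the cofactor T, whose degree is too
     small. *)
  apply: contrapT => noroot; have [T eT] := dvdpP _ _ PX.
  have X0 : 'X^#|E| - 'X != 0 :> {poly F}.
    by rewrite -size_poly_eq0 size_polyDl ?size_polyXn // size_polyN size_polyX ltnS finNzRing_gt1.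
  have T0 : T != 0 by apply: contraNneq X0 => T0; rewrite eT T0 mul0r.
  have Ts : all (root (map_poly h T)) s.
    apply/allP => x xs; have := congr1 (fun R => (map_poly h R).[x]) eT.
    rewrite rmorphB rmorphXn rmorphM /= map_polyX !hornerE sP // subrr => /esym /eqP.
    by rewrite mulf_eq0 => /orP[//|Px]; case: noroot; exists x.
  have := max_poly_roots _ Ts uniq_s; rewrite map_poly_eq0 T0 size_map_poly => /(_ isT).
  rewrite size_s; have := congr1 (fun R : {poly F} => size R) eT.
  rewrite size_polyDl ?size_polyXn ?size_polyN ?size_polyX ?ltnS ?finNzRing_gt1 //.
  rewrite size_Mmonic //; case: irrP => + _; clear.
  by move: (size T) (size P) => a b; lia.
have exR x : exists R : {poly F}, (map_poly emb R).[g] = x.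
  have [->|/gP[i ->]] := eqVneq x 0; first by exists 0; rewrite rmorph0 horner0.
  by exists 'X^i; rewrite rmorphXn /= map_polyX !hornerE.
have [rep repP] := choice exR.
(* x is written as a polynomial in g, which is then evaluated at z; [kerP] makes the result
   independent of the polynomial. *)
pose j x := (map_poly h (rep x)).[z].
have jP R x : (map_poly emb R).[g] = x -> j x = (map_poly h R).[z].
  move=> Rx; apply/eqP; rewrite -subr_eq0 -hornerN -hornerD -rmorphN -rmorphD.
  have /dvdpP[T ->] : P %| rep x - R.
    by apply: kerP; rewrite /root rmorphB !hornerE repP Rx subrr.
  by rewrite rmorphM hornerM (rootP Pz) mulr0.
have jB : zmod_morphism j.
  move=> x y; rewrite (@jP (rep x - rep y)) ?rmorphB ?hornerE ?hornerN //.
  by rewrite !repP.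
have jM : monoid_morphism j.
  split; first by rewrite (@jP 1) ?rmorph1 ?hornerC.
  by move=> x y; rewrite (@jP (rep x * rep y)) rmorphM hornerM // !repP.
pose jA := GRing.isZmodMorphism.Build _ _ j jB.
pose jMx := GRing.isMonoidMorphism.Build _ _ j jM.
pose jR : {rmorphism E -> L} := HB.pack j jA jMx.
exists jR => a /=.
by rewrite /jR /= (@jP a%:P) map_polyC hornerC.
Qed.

(** * Valuations and residue fields *)

Section Valuation.

Variables (R : realType) (K : fieldType) (v : K -> R).
Hypothesis hv : is_valuation v.

(** Comparisons under the convention that 0 has valuation +oo; they shield later statements from the
    junk value of v at 0. *)
Definition vge (c : R) (x : K) := (x == 0) || (c <= v x).
Definition vgt (c : R) (x : K) := (x == 0) || (c < v x).

Lemma valM x y : x != 0 -> y != 0 -> v (x * y) = v x + v y.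
Proof. by case: hv => + _; apply. Qed.

Lemma val1 : v 1 = 0.
Proof.
by apply: (addrI (v 1)); rewrite -valM ?oner_eq0 // mulr1 addr0.
Qed.

Lemma valX x n : x != 0 -> v (x ^+ n) = v x *+ n.
Proof.
move=> x0; elim: n => [|n IHn]; first by rewrite expr0 val1.
by rewrite exprS valM ?expf_neq0 // IHn mulrS.
Qed.

Lemma val_unity x n : (0 < n)%N -> x ^+ n = 1 -> v x = 0.
Proof.
move=> n0 xn; have x0 : x != 0.
  by apply: contra_eqN xn => /eqP ->; rewrite expr0n gtn_eqF // eq_sym oner_eq0.
by apply/eqP; have := congr1 v xn; rewrite valX // val1 => /eqP; rewrite mulrn_eq0 gtn_eqF.
Qed.

Lemma valV x : x != 0 -> v x^-1 = - v x.
Proof.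
move=> x0; apply: (addrI (v x)).
by rewrite -valM ?invr_eq0 // divff // val1 subrr.
Qed.

Lemma valN x : v (- x) = v x.
Proof.
have [->|x0] := eqVneq x 0; first by rewrite oppr0.
rewrite -mulN1r valM ?oppr_eq0 ?oner_eq0 //.
by rewrite (@val_unity (-1) 2) ?add0r // sqrrN expr1n.
Qed.

Lemma val_prod (I : Type) (r : seq I) (P : pred I) (f : I -> K) :
  (forall i, P i -> f i != 0) ->
  v (\prod_(i <- r | P i) f i) = \sum_(i <- r | P i) v (f i).
Proof.
move=> f0; suff [_ ->] : \prod_(i <- r | P i) f i != 0 /\
    v (\prod_(i <- r | P i) f i) = \sum_(i <- r | P i) v (f i) by [].
apply: (big_rec2 (fun x y => x != 0 /\ v x = y)); first by rewrite oner_eq0 val1.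
by move=> i x y Pi [y0 <-]; rewrite mulf_neq0 ?f0 // valM // f0.
Qed.

Lemma vge_neq0 c x : x != 0 -> vge c x = (c <= v x).
Proof. by rewrite /vge => /negbTE ->. Qed.

Lemma vgt_neq0 c x : x != 0 -> vgt c x = (c < v x).
Proof. by rewrite /vgt => /negbTE ->. Qed.

Lemma vge_0 c : vge c 0. Proof. by rewrite /vge eqxx. Qed.
Lemma vgt_0 c : vgt c 0. Proof. by rewrite /vgt eqxx. Qed.

Lemma vgtW c x : vgt c x -> vge c x.
Proof. by rewrite /vgt /vge => /orP[->//|/ltW ->]; rewrite orbT. Qed.

Lemma vge_gt c d x : c < d -> vge d x -> vgt c x.
Proof. by move=> cd /orP[/eqP ->|dx]; rewrite ?vgt_0 // /vgt (lt_le_trans cd) ?orbT. Qed.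

Lemma vgeN c x : vge c (- x) = vge c x.
Proof. by rewrite /vge oppr_eq0 valN. Qed.

Lemma vgtN c x : vgt c (- x) = vgt c x.
Proof. by rewrite /vgt oppr_eq0 valN. Qed.

Lemma vgeD c x y : vge c x -> vge c y -> vge c (x + y).
Proof.
have [->|x0] := eqVneq x 0; first by rewrite add0r.
have [->|y0] := eqVneq y 0; first by rewrite addr0.
rewrite /vge (negbTE x0) (negbTE y0) /= => cx cy.
have [//|xy0] := eqVneq (x + y) 0.
case: hv => _ /(_ x y x0 y0 xy0); apply: le_trans.
by rewrite le_min cx.
Qed.

Lemma vgtD c x y : vgt c x -> vgt c y -> vgt c (x + y).
Proof.
have [->|x0] := eqVneq x 0; first by rewrite add0r.
have [->|y0] := eqVneq y 0; first by rewrite addr0.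
rewrite /vgt (negbTE x0) (negbTE y0) /= => cx cy.
have [//|xy0] := eqVneq (x + y) 0.
case: hv => _ /(_ x y x0 y0 xy0); apply: lt_le_trans.
by rewrite lt_min cx.
Qed.

Lemma vge_sum c (I : Type) (r : seq I) (P : pred I) (f : I -> K) :
  (forall i, P i -> vge c (f i)) -> vge c (\sum_(i <- r | P i) f i).
Proof. by move=> h; elim/big_ind: _ => //; [exact: vge_0|exact: vgeD]. Qed.

Lemma vgt_sum c (I : Type) (r : seq I) (P : pred I) (f : I -> K) :
  (forall i, P i -> vgt c (f i)) -> vgt c (\sum_(i <- r | P i) f i).
Proof. by move=> h; elim/big_ind: _ => //; [exact: vgt_0|exact: vgtD]. Qed.

Lemma vgeM c d x y : vge c x -> vge d y -> vge (c + d) (x * y).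
Proof.
have [->|x0] := eqVneq x 0; first by rewrite mul0r !vge_0.
have [->|y0] := eqVneq y 0; first by rewrite mulr0 !vge_0.
by rewrite !vge_neq0 ?mulf_neq0 // valM //; apply: lerD.
Qed.

Lemma vgtM c d x y : vgt c x -> vge d y -> vgt (c + d) (x * y).
Proof.
have [->|x0] := eqVneq x 0; first by rewrite mul0r !vgt_0.
have [->|y0] := eqVneq y 0; first by rewrite mulr0 !vgt_0.
rewrite vgt_neq0 // vge_neq0 // vgt_neq0 ?mulf_neq0 // valM //; exact: ltr_leD.
Qed.

Lemma vge0M x y : vge 0 x -> vge 0 y -> vge 0 (x * y).
Proof. by move=> /vgeM h /h; rewrite addr0. Qed.

Lemma vge0_nat n : vge 0 n%:R.
Proof.
elim: n => [|n IHn]; first exact: vge_0.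
by rewrite -natr1 vgeD // vge_neq0 ?oner_eq0 // val1.
Qed.

Lemma vge0_unity x n : (0 < n)%N -> x ^+ n = 1 -> vge 0 x.
Proof. by move=> n0 xn; rewrite /vge (val_unity n0 xn) lexx orbT. Qed.

(** If v(x + y) exceeded v(x), then x = (x + y) - y would be a sum of two terms of valuation larger
    than its own. *)
Lemma val_dominant x y : x != 0 -> vgt (v x) y -> (x + y != 0) /\ v (x + y) = v x.
Proof.
move=> x0 ygt; have xy0 : x + y != 0.
  apply: contraTneq ygt => /eqP; rewrite addr_eq0 => /eqP ex.
  by rewrite -[y]opprK -ex vgtN vgt_neq0 // ltxx.
split=> //; apply/eqP; rewrite eq_le; apply/andP; split; last first.
  rewrite -vge_neq0 //; apply: vgeD; last exact: vgtW.
  by rewrite vge_neq0.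
rewrite leNgt; apply/negP => lt_xy.
have : vgt (v x) (x + y - y) by rewrite vgtD ?vgtN // vgt_neq0.
by rewrite addrK vgt_neq0 // ltxx.
Qed.

(** The valuation property is an argument so that the subring structure can be attached to the
    predicate itself. *)
Definition valuation_ring of is_valuation v : {pred K} := [pred x | vge 0 x].

Lemma valuation_ring_subring : subring_closed (valuation_ring hv).
Proof.
split=> [|x y|x y]; rewrite !inE.
- by rewrite vge_neq0 ?oner_eq0 // val1.
- by move=> xO yO; rewrite vgeD ?vgeN.
- exact: vge0M.
Qed.

HB.instance Definition _ :=
  GRing.isSubringClosed.Build K (valuation_ring hv) valuation_ring_subring.

Record valuation_sub := ValuationSub {
  valuation_val :> K; _ : valuation_val \in valuation_ring hv }.

HB.instance Definition _ := [isSub for valuation_val].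
HB.instance Definition _ := [Choice of valuation_sub by <:].
HB.instance Definition _ := [SubChoice_isSubComNzRing of valuation_sub by <:].

Definition valuation_ideal : {pred valuation_sub} := [pred x | vgt 0 (val x)].

Lemma valuation_ideal_closed : idealr_closed valuation_ideal.
Proof.
split.
- by rewrite inE /= vgt_0.
- by rewrite inE /= vgt_neq0 ?oner_eq0 // val1 ltxx.
- move=> a x y; rewrite !inE /= => xI yI; apply: vgtD => //.
  by rewrite mulrC -[0]addr0 vgtM //; exact: (valP a).
Qed.

HB.instance Definition _ := isIdealr.Build valuation_sub valuation_ideal
  valuation_ideal_closed.

Definition residue_ring := {ideal_quot valuation_ideal}.
HB.instance Definition _ := GRing.ComNzRing.on residue_ring.

Definition residue_map : {rmorphism valuation_sub -> residue_ring} :=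
  (\pi_{ideal_quot valuation_ideal})%qT.

Lemma residue_ring_inv (a : residue_ring) : a != 0 -> exists b, b * a = 1.
Proof.
elim/quotW: a => x; rewrite piE => /= x0.
have nI : x \notin valuation_ideal.
  by move: x0; rewrite Quotient.equivE subr0.
have vx0 : val x != 0 by apply: contraNneq nI => x0'; rewrite inE /= x0' vgt_0.
have vx : v (val x) = 0.
  apply/eqP; rewrite eq_le; move: nI; rewrite inE /= vgt_neq0 // -leNgt => -> /=.
  by rewrite -vge_neq0 //; exact: (valP x).
have yO : (val x)^-1 \in valuation_ring hv.
  by rewrite inE /= vge_neq0 ?invr_eq0 // valV // vx oppr0.
exists (residue_map (ValuationSub yO)).
rewrite -/(residue_map x) -[RHS](rmorph1 residue_map) -(rmorphM residue_map).
by congr (residue_map _); apply: val_inj; rewrite /= mulVf.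
Qed.

(** The reduction is made a total function, with value 0 off the valuation ring, so that later
    statements stay in K instead of a subtype; this is why its morphism laws are relative to
    [vge 0]. *)
Lemma residue_field_exists : exists (k : fieldType) (res : K -> k),
  [/\ res 1 = 1,
      {in vge 0 &, {morph res : x y / x + y}},
      {in vge 0 &, {morph res : x y / x * y}}
    & {in vge 0, forall x, (res x == 0) = vgt 0 x}].
Proof.
have exinv (a : residue_ring) : exists b, a != 0 -> b * a = 1.
  have [->|/residue_ring_inv[b ba]] := eqVneq a 0; first by exists 0.
  by exists b.
have [inv0 inv0P] := choice exinv.
pose inv (a : residue_ring) := if a == 0 then 0 else inv0 a.
have mulVf a : a != 0 -> inv a * a = 1.
  by move=> a0; rewrite /inv (negbTE a0) inv0P.
have invr0 : inv 0 = 0 by rewrite /inv eqxx.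
pose m := GRing.ComNzRing_isField.Build residue_ring mulVf invr0.
pose k : fieldType := HB.pack residue_ring m.
pose res (x : K) : k := if insub x is Some y then residue_map y else 0.
have resE x (xO : x \in valuation_ring hv) :
  res x = residue_map (ValuationSub xO) by rewrite /res insubT.
have resO x (xO : vge 0 x) : exists y, val y = x /\ res x = residue_map y.
  have xO' : x \in valuation_ring hv by [].
  by exists (ValuationSub xO'); rewrite resE.
have res_eq x y : val y = x -> res x = residue_map y.
  by move=> yx; have /resO[z [zx ->]] : vge 0 x; [rewrite -yx; exact: (valP y)|congr (residue_map _); apply: val_inj; rewrite zx].
exists k, res; split.
- by rewrite (res_eq 1 1) // rmorph1.
- move=> x y /resO[x' [x'E ->]] /resO[y' [y'E ->]].
  by rewrite (res_eq _ (x' + y')) ?rmorphD //= x'E y'E.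
- move=> x y /resO[x' [x'E ->]] /resO[y' [y'E ->]].
  by rewrite (res_eq _ (x' * y')) ?rmorphM //= x'E y'E.
- move=> x /resO[x' [<- ->]].
  have -> : (residue_map x' == 0 :> k) = (residue_map x' == residue_map 0) by rewrite rmorph0.
  by rewrite -[LHS]Quotient.idealrBE subr0.
Qed.

End Valuation.

Section PadicOmegaFacts.

Variables (R : realType) (p : nat) (C : padicOmega R p).
Hypothesis prime_p : prime p.

Lemma Omega_valuation : is_valuation (@ord R p C).
Proof. by case: (Omega_completion C). Qed.

Lemma ord_rat (x : rat) : x != 0 ->
  ord (Qpbar_to_Omega C (Qp_to_Qpbar C (rat_to_Qp C x))) = padic_ord R p x.
Proof.
move=> x0; have [_ ext1 _ _] := Omega_completion C.
have [_ ext2 _ _] := Qp_completion C.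
by rewrite ext1 ?fmorph_eq0 // ord_Qpbar_extends ?fmorph_eq0 // ext2.
Qed.

Lemma Omega_natr_neq0 n : (0 < n)%N -> n%:R != 0 :> Omega C.
Proof.
move=> n0.
have <- : Qpbar_to_Omega C (Qp_to_Qpbar C (rat_to_Qp C n%:R)) = n%:R.
  by rewrite !rmorph_nat.
by rewrite !fmorph_eq0 pnatr_eq0 -lt0n.
Qed.

Lemma ord_p : ord (p%:R : Omega C) = 1.
Proof.
have <- : Qpbar_to_Omega C (Qp_to_Qpbar C (rat_to_Qp C p%:R)) = p%:R.
  by rewrite !rmorph_nat.
rewrite ord_rat ?pnatr_eq0 -?lt0n ?prime_gt0 //.
rewrite /padic_ord -[p%:R]/(p%:Z%:~R : rat) numq_int denq_int /= logn1 subr0.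
by rewrite logn_prime // eqxx.
Qed.

(** X^N - 1 splits in the algebraically closed field [Qpbar] and is separable because N is nonzero
    there; N distinct N-th roots of unity include a primitive one. *)
Lemma Omega_prim_root N : (0 < N)%N -> exists z : Omega C, N.-primitive_root z.
Proof.
move=> N0; have NQ : N%:R != 0 :> Qpbar C.
  by rewrite -(fmorph_eq0 (Qpbar_to_Omega C)) rmorph_nat Omega_natr_neq0.
suff [z prim_z] : exists z : Qpbar C, N.-primitive_root z.
  by exists (Qpbar_to_Omega C z); rewrite fmorph_primitive_root.
have [rs Ers] := closed_field_poly_normal ('X^N - 1 : {poly Qpbar C}).
have lc1 : lead_coef ('X^N - 1 : {poly Qpbar C}) = 1.
  by apply/eqP; rewrite -monicE monicXnsubC.
rewrite lc1 scale1r in Ers.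
have uniq_rs : uniq rs.
  by rewrite -separable_prod_XsubC -Ers separable_Xn_sub_1.
have /hasP[z _ prim_z] : has N.-primitive_root rs; last by exists z.
apply: has_prim_root => //.
  apply/allP => z zrs; rewrite /= unity_rootE -subr_eq0.
  have : root ('X^N - 1) z by rewrite Ers root_prod_XsubC.
  by rewrite /root !hornerE.
have := congr1 (fun P : {poly Qpbar C} => size P) Ers.
by rewrite size_prod_XsubC size_XnsubC // => -[->].
Qed.

End PadicOmegaFacts.

(** The interface through which the theory of Gauss sums sees [Omega]: everything up to the
    factorization of L^* is carried out in such an abstract valued field. *)
Record residue_setting (R : realType) (K : fieldType) (v : K -> R) (p : nat)
    (k : fieldType) (res : K -> k) : Prop := ResidueSetting {
  rs_valuation : is_valuation v;
  rs_prime : prime p;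
  rs_val_p : v p%:R = 1;
  rs_natr_neq0 : forall n, (0 < n)%N -> n%:R != 0 :> K;
  rs_prim_root : forall N, (0 < N)%N -> exists z : K, N.-primitive_root z;
  rs_res1 : res 1 = 1;
  rs_resD : {in vge v 0 &, {morph res : x y / x + y}};
  rs_resM : {in vge v 0 &, {morph res : x y / x * y}};
  rs_res_eq0 : {in vge v 0, forall x, (res x == 0) = vgt v 0 x} }.

Lemma residue_setting_exists (R : realType) (K : fieldType) (v : K -> R) (p : nat) :
  is_valuation v -> prime p -> v p%:R = 1 ->
  (forall n, (0 < n)%N -> n%:R != 0 :> K) ->
  (forall N, (0 < N)%N -> exists z : K, N.-primitive_root z) ->
  exists (k : fieldType) (res : K -> k), residue_setting v p res.
Proof.
move=> hv prime_p vp nat0 prim.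
have [k [res [res1 resD resM res_eq0]]] := residue_field_exists hv.
by exists k, res; exact: (ResidueSetting hv prime_p vp nat0 prim res1 resD resM res_eq0).
Qed.

Lemma Omega_residue_setting (R : realType) (p : nat) (C : padicOmega R p) :
  prime p -> exists (k : fieldType) (res : Omega C -> k), residue_setting (@ord R p C) p res.
Proof.
move=> prime_p.
exact: (residue_setting_exists (Omega_valuation C) prime_p (ord_p C prime_p)
         (@Omega_natr_neq0 R p C) (@Omega_prim_root R p C)).
Qed.

(** * Teichmueller lifts *)

Section Teichmuller.

Variables (R : realType) (K : fieldType) (v : K -> R) (p : nat).
Variables (k : fieldType) (res : K -> k).
Hypothesis S : residue_setting v p res.

Let hv : is_valuation v. Proof. exact: rs_valuation S. Qed.
Let prime_p : prime p. Proof. exact: rs_prime S. Qed.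
Let vp : v p%:R = 1. Proof. exact: rs_val_p S. Qed.
Let natr_neq0 n : (0 < n)%N -> n%:R != 0 :> K. Proof. exact: rs_natr_neq0 S n. Qed.
Let prim_root N : (0 < N)%N -> exists z : K, N.-primitive_root z.
Proof. exact: rs_prim_root S N. Qed.
Let res1 : res 1 = 1. Proof. exact: rs_res1 S. Qed.
Let resD : {in vge v 0 &, {morph res : x y / x + y}}. Proof. exact: rs_resD S. Qed.
Let resM : {in vge v 0 &, {morph res : x y / x * y}}. Proof. exact: rs_resM S. Qed.
Let res_eq0 : {in vge v 0, forall x, (res x == 0) = vgt v 0 x}.
Proof. exact: rs_res_eq0 S. Qed.

(** By Bezout, if n had positive valuation like p, so would 1. *)
Lemma val_coprime_nat n : ~~ (p %| n)%N -> v n%:R = 0.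
Proof.
move=> pn; have n0 : (0 < n)%N by rewrite lt0n; apply: contraNneq pn => ->.
have vn_ge : 0 <= v n%:R by rewrite -vge_neq0 ?natr_neq0 // vge0_nat.
apply/eqP; rewrite eq_le vn_ge andbT leNgt; apply/negP => vn_gt.
have [a b eab _] : egcdn_spec n p (egcdn n p) by apply: egcdnP.
rewrite (eqP (_ : coprime n p)) in eab; last by rewrite coprime_sym prime_coprime.
have : vgt v 0 (1 : K).
  have e1 : (a * n)%:R = (b * p)%:R + 1 :> K by rewrite eab addn1 -natr1.
  have -> : 1 = (a * n)%:R - (b * p)%:R :> K by rewrite e1 addrAC subrr add0r.
  rewrite !natrM [a%:R * _]mulrC [b%:R * _]mulrC -[0]addr0.
  apply: vgtD => //; rewrite ?vgtN //; apply: vgtM => //; rewrite ?vge0_nat //.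
    by rewrite vgt_neq0 ?natr_neq0.
  by rewrite vgt_neq0 ?natr_neq0 ?prime_gt0 // vp ltr01.
by rewrite vgt_neq0 ?oner_eq0 // (val1 hv) ltxx.
Qed.

Lemma res0 : res 0 = 0.
Proof. by apply/eqP; rewrite res_eq0 ?vgt_0 //; exact: vge_0. Qed.

Lemma res_nat n : res n%:R = n%:R.
Proof.
elim: n => [|n IHn]; first exact: res0.
by rewrite -!natr1 resD ?IHn ?res1 //; [exact: vge0_nat|exact: (vge0_nat hv 1)].
Qed.

Lemma resX x n : vge v 0 x -> res (x ^+ n) = res x ^+ n.
Proof.
move=> xO; elim: n => [|n IHn]; first by rewrite res1.
rewrite !exprS resM ?IHn //; elim: (n) => [|m IHm]; first exact: (vge0_nat hv 1).
by rewrite exprS; apply: vge0M.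
Qed.

Lemma res_sum (I : Type) (r : seq I) (P : pred I) (f : I -> K) :
  (forall i, P i -> vge v 0 (f i)) ->
  res (\sum_(i <- r | P i) f i) = \sum_(i <- r | P i) res (f i).
Proof.
move=> fO; suff [_ //] : vge v 0 (\sum_(i <- r | P i) f i) /\
  res (\sum_(i <- r | P i) f i) = \sum_(i <- r | P i) res (f i).
apply: (big_rec2 (fun x y => vge v 0 x /\ res x = y)).
  by rewrite res0 vge_0.
move=> i x y Pi [xO <-]; rewrite resD ?fO //; last exact: fO.
by split=> //; apply: vgeD => //; exact: fO.
Qed.

Lemma residue_pchar : p \in [pchar k].
Proof.
rewrite inE prime_p -res_nat res_eq0; last exact: vge0_nat.
by rewrite vgt_neq0 ?natr_neq0 ?prime_gt0 // vp ltr01.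
Qed.

Lemma residue_natr_neq0 n : ~~ (p %| n)%N -> n%:R != 0 :> k.
Proof. by rewrite (dvdn_pcharf residue_pchar). Qed.

(** If u = x / y were not 1, the sum of u^i over i < N1 N2 would vanish; reducing it, where u
    becomes 1, would give N1 N2 = 0 in a field of characteristic p. *)
Lemma unity_res_inj x y N1 N2 : (0 < N1)%N -> (0 < N2)%N ->
  ~~ (p %| N1)%N -> ~~ (p %| N2)%N -> x ^+ N1 = 1 -> y ^+ N2 = 1 ->
  res x = res y -> x = y.
Proof.
move=> N1_gt0 N2_gt0 pN1 pN2 x1 y1 eres.
have N_gt0 : (0 < N1 * N2)%N by rewrite muln_gt0 N1_gt0.
have y0 : y != 0.
  by apply: contra_eqN y1 => /eqP ->; rewrite expr0n gtn_eqF // eq_sym oner_eq0.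
pose u := x / y.
have uN : u ^+ (N1 * N2) = 1.
  by rewrite /u expr_div_n exprM x1 expr1n mulnC exprM y1 expr1n divr1.
have resu : res u = 1.
  have resy : res y != 0.
    rewrite res_eq0; last exact: (vge0_unity hv N2_gt0).
    by rewrite vgt_neq0 // (val_unity hv N2_gt0 y1) ltxx.
  apply: (mulIf resy); rewrite -resM ?inE; last 2 first.
  - exact: (vge0_unity hv N_gt0 uN).
  - exact: (vge0_unity hv N2_gt0).
  by rewrite /u divfK // mul1r.
have [u1|u1] := eqVneq u 1.
  by rewrite -[x](divfK y0) -/u u1 mul1r.
have : \sum_(i < N1 * N2) u ^+ i = 0.
  apply: (mulfI (_ : u - 1 != 0)); first by rewrite subr_eq0.
  by rewrite -subrX1 uN subrr mulr0.
move/(congr1 res); rewrite res0 res_sum => [|i _]; last first.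
  apply: (vge0_unity hv N_gt0); by rewrite exprAC uN expr1n.
under eq_bigr => i _.
  rewrite resX ?resu ?expr1n; last exact: (vge0_unity hv N_gt0 uN).
  over.
rewrite sumr_const card_ord => /eqP; rewrite (negbTE (residue_natr_neq0 _)) //.
by rewrite Euclid_dvdM // negb_or pN1.
Qed.

(** The N powers of z have distinct reductions, so these exhaust the roots of X^N - 1 in the residue
    field. *)
Lemma residue_unity_roots N : (0 < N)%N -> ~~ (p %| N)%N ->
  exists z : K, N.-primitive_root z /\
    forall y, y ^+ N = 1 -> exists i : 'I_N, y = res (z ^+ i).
Proof.
move=> N0 pN; have [z prim_z] := prim_root N0; exists z; split=> // y yN.
have zi1 i : (z ^+ i) ^+ N = 1 by rewrite exprAC (prim_expr_order prim_z) expr1n.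
pose s := [seq res (z ^+ i) | i : 'I_N].
have uniq_s : uniq s.
  rewrite map_inj_uniq ?enum_uniq // => i j /(unity_res_inj N0 N0 pN pN (zi1 i) (zi1 j)).
  move=> /eqP; rewrite (eq_prim_root_expr prim_z) !modn_small // => /eqP ij.
  exact: val_inj.
have size_s : size s = N by rewrite size_map size_enum_ord.
have : y \in s.
  apply: contraT => ys.
  have rs : all (root ('X^N - 1)) (y :: s).
    rewrite /= /root !hornerE yN subrr eqxx /=; apply/allP => _ /mapP[i _ ->].
    rewrite /root !hornerE -resX; last exact: (vge0_unity hv N0).
    by rewrite zi1 res1 subrr.
  have := max_poly_roots (_ : 'X^N - 1 != 0) rs.
  rewrite /= ys uniq_s size_XnsubC // ltnS size_s ltnn => -> //.
  by rewrite -size_poly_eq0 size_XnsubC.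
by case/mapP => i _ ->; exists i.
Qed.

(** The lift is unique by [unity_res_inj]. The default 0 is the wanted value at y = 0, which is not
    the reduction of any root of unity of order prime to p. *)
Definition teichmuller (y : k) : K := xget 0
  [set z | res z = y /\ exists N, [/\ (0 < N)%N, ~~ (p %| N)%N & z ^+ N = 1]]%classic.

Lemma teichmullerP y N : (0 < N)%N -> ~~ (p %| N)%N -> y ^+ N = 1 ->
  res (teichmuller y) = y /\ teichmuller y ^+ N = 1.
Proof.
move=> N0 pN yN; have [z [prim_z /(_ y yN)[i ey]]] := residue_unity_roots N0 pN.
have zi1 : (z ^+ i) ^+ N = 1 by rewrite exprAC (prim_expr_order prim_z) expr1n.
rewrite /teichmuller; case: xgetP => [x _ [resx [N' [N'0 pN' xN']]]|/(_ (z ^+ i))].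
  split=> //; suff -> : x = z ^+ i by [].
  by apply: (unity_res_inj N'0 N0 pN' pN xN' zi1); rewrite resx.
by case; split=> //; exists N.
Qed.

Lemma teichmuller0 : teichmuller 0 = 0.
Proof.
rewrite /teichmuller; case: xgetP => // x _ [/eqP resx [N [N0 pN xN]]].
have x0 : x != 0.
  by apply: contra_eqN xN => /eqP ->; rewrite expr0n gtn_eqF // eq_sym oner_eq0.
move: resx; rewrite res_eq0; last exact: (vge0_unity hv N0).
by rewrite vgt_neq0 // (val_unity hv N0 xN) ltxx.
Qed.

Lemma teichmullerM x y N : (0 < N)%N -> ~~ (p %| N)%N -> x ^+ N = 1 -> y ^+ N = 1 ->
  teichmuller (x * y) = teichmuller x * teichmuller y.
Proof.
move=> N0 pN xN yN.
have [resx tx] := teichmullerP N0 pN xN; have [resy ty] := teichmullerP N0 pN yN.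
have [resxy txy] : res (teichmuller (x * y)) = x * y /\ teichmuller (x * y) ^+ N = 1.
  by apply: teichmullerP => //; rewrite exprMn xN yN mulr1.
apply: (unity_res_inj N0 N0 pN pN txy); first by rewrite exprMn tx ty mulr1.
by rewrite resM ?resx ?resy ?inE //; exact: (vge0_unity hv N0).
Qed.

End Teichmuller.

Lemma prime_field_embedding (L : fieldType) p : p \in [pchar L] ->
  exists h : {rmorphism 'F_p -> L}, True.
Proof.
move=> chL; have f : {rmorphism 'F_p -> pPrimeCharType chL}.
  exact: (GRing.in_alg (pPrimeCharType chL) : {rmorphism 'F_p -> pPrimeCharType chL}).
by exists (f : {rmorphism 'F_p -> L}).
Qed.

(** As p does not divide |E| - 1, the roots of unity of that order have distinct reductions;
    together with 0 these are the |E| solutions of x^|E| = x that [finField_embedding] asks for. *)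
Lemma residue_embedding (R : realType) (K : fieldType) (v : K -> R) (p : nat)
    (k : fieldType) (res : K -> k) (F E : finFieldType) d
    (emb : {rmorphism F -> E}) (h : {rmorphism F -> k}) :
  residue_setting v p res -> p \in [pchar E] ->
  (0 < d)%N -> #|E| = (#|F| ^ d)%N ->
  exists j : {rmorphism E -> k}, forall a, j (emb a) = h a.
Proof.
move=> S chE d_gt0 cardE.
have q0 : (0 < #|E|.-1)%N by rewrite -ltnS prednK ?finNzRing_gt1 // ltnW ?finNzRing_gt1.
have eE : #|E| = #|E|.-1.+1 by rewrite prednK // ltnW ?finNzRing_gt1.
have pq : ~~ (p %| #|E|.-1)%N.
  apply/negP => dp; have : (p %| #|E|)%N.
    rewrite (card_pchar chE) dvdn_exp //; have := finNzRing_gt1 E.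
    by rewrite {1}(card_pchar chE); case: (logn _ _).
  by rewrite eE -addn1 dvdn_addr // dvdn1 => /eqP p1; have := rs_prime S; rewrite p1.
have [z [prim_z _]] := residue_unity_roots S q0 pq.
have zi1 i : (z ^+ i) ^+ #|E|.-1 = 1 by rewrite exprAC (prim_expr_order prim_z) expr1n.
have rzi1 i : res (z ^+ i) ^+ #|E|.-1 = 1.
  by rewrite -(resX S) ?zi1 ?(rs_res1 S) //; exact: (vge0_unity (rs_valuation S) q0).
pose s := 0 :: [seq res (z ^+ i) | i : 'I_#|E|.-1].
apply: (@finField_embedding _ _ emb d k h s) => //.
- rewrite /= map_inj_uniq ?enum_uniq ?andbT.
    apply/negP => /mapP[i _ /esym r0]; have := rzi1 i; rewrite r0 expr0n gtn_eqF //.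
    by move/eqP; rewrite eq_sym oner_eq0.
  move=> i l /(unity_res_inj S q0 q0 pq pq (zi1 i) (zi1 l)) /eqP.
  by rewrite (eq_prim_root_expr prim_z) !modn_small // => /eqP /val_inj.
- by rewrite /= size_map size_enum_ord.
- move=> x; rewrite inE => /orP[/eqP ->|/mapP[i _ ->]].
    by rewrite expr0n gtn_eqF // ltnW ?finNzRing_gt1.
  by move: (nat_of_ord i) => m; rewrite eE exprS rzi1 mulr1.
Qed.

(** * Absolute traces and additive characters *)

Lemma eqr_nat_pchar (L : nzRingType) p m n : p \in [pchar L] ->
  (m%:R == n%:R :> L) = (m == n %[mod p]).
Proof.
move=> chL; wlog le_nm : m n / (n <= m)%N.
  by move=> H; case/orP: (leq_total n m) => /H // E; rewrite eq_sym E eq_sym.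
by rewrite eqn_mod_dvd // -subr_eq0 -natrB // (dvdn_pcharf chL).
Qed.

Lemma prime_field_natr (L : finFieldType) p (x : L) : p \in [pchar L] ->
  x ^+ p = x -> exists2 m, (m < p)%N & m%:R = x.
Proof.
move=> chL xp; have prp := pcharf_prime chL.
have [h _] := prime_field_embedding chL.
have [a ea] : exists a, x = h a by apply: frobenius_fixed; rewrite card_Fp.
exists (a : nat).
  by have := ltn_ord a; rewrite [X in (_ < X)%N -> _]Fp_cast.
by rewrite ea -[in RHS](natr_Zp a) rmorph_nat.
Qed.

Section Trace.

Variables (p : nat) (E : finFieldType).
Hypothesis chE : p \in [pchar E].

Let prime_p : prime p. Proof. exact: pcharf_prime chE. Qed.
Let e := logn p #|E|.
Let cardE : #|E| = (p ^ e)%N. Proof. exact: card_pchar. Qed.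
Let e_gt0 : (0 < e)%N.
Proof. by have := finNzRing_gt1 E; rewrite cardE; case: e. Qed.

Lemma pcharX_exprD (x y : E) i : (x + y) ^+ (p ^ i) = x ^+ (p ^ i) + y ^+ (p ^ i).
Proof.
have [phi phiE] := frobenius_rmorphism i chE.
by rewrite -!phiE rmorphD.
Qed.

Lemma abs_traceD (x y : E) : abs_trace p (x + y) = abs_trace p x + abs_trace p y.
Proof. by rewrite -big_split; apply: eq_bigr => i _; exact: pcharX_exprD. Qed.

Lemma abs_trace_frob (x : E) : abs_trace p (x ^+ p) = abs_trace p x.
Proof.
rewrite /abs_trace -/e; have [e' ee] : exists e', e = e'.+1 by exists e.-1; rewrite prednK.
have := expf_card x; rewrite cardE ee => xQ.
rewrite big_ord_recr big_ord_recl /= addrC -exprM -expnS xQ expr1; congr (_ + _).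
by apply: eq_bigr => i _; rewrite -exprM -expnS.
Qed.

Lemma abs_trace_fixed (x : E) : abs_trace p x ^+ p = abs_trace p x.
Proof.
have [phi] := frobenius_rmorphism 1 chE; rewrite expn1 => phiE.
rewrite -[RHS]abs_trace_frob -phiE rmorph_sum; apply: eq_bigr => i _.
by rewrite phiE exprAC.
Qed.

(** The search defining [abs_trace_nat] succeeds, because the trace is fixed by Frobenius and so
    lies in the prime field. *)
Lemma abs_trace_natP (x : E) :
  (abs_trace_nat p x < p)%N /\ (abs_trace_nat p x)%:R = abs_trace p x.
Proof.
have [m lt_mp em] := prime_field_natr chE (abs_trace_fixed x).
have has_m : has (fun m : nat => m%:R == abs_trace p x) (iota 0 p).
  by apply/hasP; exists m; rewrite ?mem_iota ?em.
have lt_p : (abs_trace_nat p x < p)%N by move: has_m; rewrite has_find size_iota.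
split=> //; have := nth_find 0%N has_m; rewrite -/(abs_trace_nat p x).
by rewrite nth_iota // add0n => /eqP.
Qed.

(** The trace is a polynomial function of degree p^(e-1) < |E|. *)
Lemma abs_trace_nontrivial : exists x : E, abs_trace p x != 0.
Proof.
apply: contrapT => H; have tr0 (x : E) : abs_trace p x = 0.
  by apply: contrapT => /eqP ?; apply: H; exists x.
pose P : {poly E} := \sum_(i < e) 'X^(p ^ i).
have rP : all (root P) (enum E).
  apply/allP => x _; rewrite /root horner_sum; under eq_bigr do rewrite hornerXn.
  by rewrite -[X in X == _]/(abs_trace p x) tr0.
have szP : size P = (p ^ e.-1).+1.
  rewrite /P; have [e' ee] : exists e', e = e'.+1 by exists e.-1; rewrite prednK.
  rewrite ee big_ord_recr /= addrC size_polyDl ?size_polyXn //.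
  rewrite ltnS; apply: leq_trans (size_sum _ _ _) _; apply/bigmax_leqP => i _.
  by rewrite size_polyXn ltn_exp2l ?prime_gt1.
have := max_poly_roots _ rP (enum_uniq E); rewrite -size_poly_eq0 szP => /(_ isT).
by rewrite -cardT ltnS cardE leq_exp2l ?prime_gt1 // -ltnS prednK // ltnn.
Qed.

End Trace.

Section AdditiveCharacter.

Variables (p : nat) (E : finFieldType) (K : fieldType) (zeta : K).
Hypotheses (chE : p \in [pchar E]) (prim_zeta : p.-primitive_root zeta).

Definition add_char (x : E) : K := zeta ^+ abs_trace_nat p x.

Lemma add_char_trace (x : E) m : m%:R = abs_trace p x -> add_char x = zeta ^+ m.
Proof.
move=> mx; apply/eqP; rewrite (eq_prim_root_expr prim_zeta) -(eqr_nat_pchar _ _ chE).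
by rewrite mx; have [_ ->] := abs_trace_natP chE x.
Qed.

Lemma add_charD (x y : E) : add_char (x + y) = add_char x * add_char y.
Proof.
rewrite /add_char -exprD; apply: add_char_trace; rewrite natrD abs_traceD //.
by have [_ ->] := abs_trace_natP chE x; have [_ ->] := abs_trace_natP chE y.
Qed.

Lemma add_char0 : add_char 0 = 1.
Proof.
rewrite (@add_char_trace 0 0) // /abs_trace big1 // => i _.
by rewrite expr0n gtn_eqF // expn_gt0 prime_gt0 // (pcharf_prime chE).
Qed.

Lemma add_char_frob (x : E) : add_char (x ^+ p) = add_char x.
Proof.
rewrite [RHS]/add_char; apply: add_char_trace; rewrite abs_trace_frob //.
by have [_ ->] := abs_trace_natP chE x.
Qed.

Lemma add_char_nontrivial : exists x, add_char x != 1.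
Proof.
have [x tx] := abs_trace_nontrivial chE; exists x.
rewrite -(expr0 zeta) (eq_prim_root_expr prim_zeta) -(eqr_nat_pchar _ _ chE).
by have [_ ->] := abs_trace_natP chE x.
Qed.

Lemma add_char_sum : \sum_x add_char x = 0.
Proof.
have [b psib] := add_char_nontrivial.
have : (add_char b - 1) * \sum_x add_char x = 0.
  rewrite mulrBl mul1r mulr_sumr; apply/eqP; rewrite subr_eq0; apply/eqP.
  rewrite [RHS](reindex_inj (addrI b)); apply: eq_bigr => x _.
  by rewrite add_charD.
by move/eqP; rewrite mulf_eq0 subr_eq0 (negbTE psib) => /eqP.
Qed.

Lemma add_char_sum_scaled (c : E) : c != 0 ->
  \sum_(x | x != 0) add_char (x * c) = -1.
Proof.
move=> c0; have := add_char_sum; rewrite (reindex_inj (mulIf c0)) (bigD1 0) //=.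
by rewrite mul0r add_char0 => /eqP; rewrite addrC addr_eq0 => /eqP.
Qed.

Lemma add_char_sum_neq0 : \sum_(x | x != 0) add_char x = -1.
Proof.
by rewrite -(@add_char_sum_scaled 1 (oner_neq0 _)); apply: eq_bigr => x; rewrite mulr1.
Qed.

End AdditiveCharacter.

(** * Gauss sums and Stickelberger's theorem *)

Section GaussSum.

Variables (R : realType) (K : fieldType) (v : K -> R) (p : nat).
Variables (k : fieldType) (res : K -> k).
Hypothesis S : residue_setting v p res.
Variable (zeta : K).
Hypothesis prim_zeta : p.-primitive_root zeta.

Let hv : is_valuation v. Proof. exact: rs_valuation S. Qed.
Let prime_p : prime p. Proof. exact: rs_prime S. Qed.
Let vp : v p%:R = 1. Proof. exact: rs_val_p S. Qed.
Let natr_neq0 n : (0 < n)%N -> n%:R != 0 :> K. Proof. exact: rs_natr_neq0 S n. Qed.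

(** The p - 1 elements zeta^i - 1 divide one another, hence have equal valuation, and up to sign
    their product is p. *)
Lemma val_zeta_sub1 : zeta - 1 != 0 /\ v (zeta - 1) = (p.-1)%:R^-1.
Proof.
have p1 : (1 < p)%N := prime_gt1 prime_p.
have zn1 i : (0 < i < p)%N -> zeta ^+ i - 1 != 0.
  move=> /andP[i0 ip]; rewrite subr_eq0 -(expr0 zeta) (eq_prim_root_expr prim_zeta).
  by rewrite mod0n modn_small // -lt0n.
have vge_i a m : zeta ^+ a - 1 != 0 ->
    zeta ^+ (a * m) - 1 != 0 -> v (zeta ^+ a - 1) <= v (zeta ^+ (a * m) - 1).
  move=> a0 am0; rewrite exprM subrX1 in am0 *.
  have s0 : \sum_(i < m) (zeta ^+ a) ^+ i != 0.
    by apply: contraNneq am0 => ->; rewrite mulr0.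
  rewrite (valM hv) // lerDl -vge_neq0 //; apply: vge_sum => // i _.
  apply: (vge0_unity hv (prim_order_gt0 prim_zeta)).
  by rewrite exprAC [X in X ^+ i]exprAC (prim_expr_order prim_zeta) !expr1n.
have v_eq i : (0 < i < p)%N -> v (zeta ^+ i - 1) = v (zeta - 1).
  move=> ip; have /andP[i0 lt_ip] := ip.
  have cop : coprime i p.
    by rewrite coprime_sym prime_coprime //; apply/negP => /(dvdn_leq i0); rewrite leqNgt lt_ip.
  apply/eqP; rewrite eq_le; apply/andP; split; last first.
    by have := @vge_i 1%N i; rewrite mul1n expr1; apply; rewrite ?zn1 // -(expr1 zeta) zn1.
  have [a b eab _] : egcdn_spec i p (egcdn i p) by apply: egcdnP.
  rewrite (eqP cop) in eab.
  (* As i a = 1 modulo p, zeta is itself a power of zeta^i and divisibility also holds in the other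
     direction. *)
  have e1 : zeta = zeta ^+ (i * a).
    by rewrite mulnC eab exprD mulnC exprM (prim_expr_order prim_zeta) expr1n mul1r expr1.
  by have := vge_i i a; rewrite -e1; apply; rewrite ?zn1 // -(expr1 zeta) zn1.
split; first by rewrite -(expr1 zeta) zn1.
(* Evaluation of (X^p - 1)/(X - 1) at 1, once as a sum of powers and once as a product. *)
have prodE : p%:R = \prod_(i < p.-1) (1 - zeta ^+ i.+1) :> K.
  have X1 : 'X - 1%:P != 0 :> {poly K} by rewrite polyXsubC_eq0.
  have := factor_Xn_sub_1 prim_zeta; rewrite big_ltn ?(ltnW p1) // expr0 subrX1.
  move/(mulfI X1)/(congr1 (fun P : {poly K} => P.[1])); rewrite horner_sum horner_prod.
  rewrite big_add1 big_mkord => prodE; transitivity (\sum_(i < p) (1 : K) ^+ i).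
    by under eq_bigr do rewrite expr1n; rewrite sumr_const card_ord.
  rewrite -[RHS](_ : \prod_(i < p.-1) ('X - (zeta ^+ i.+1)%:P).[1] = _).
    by rewrite prodE; apply: eq_bigr => i _; rewrite hornerXn.
  by apply: eq_bigr => i _; rewrite !hornerE.
have := congr1 v prodE; rewrite vp val_prod //; last first.
  move=> i _; rewrite -oppr_eq0 opprB zn1 //=.
  by have := ltn_ord i; rewrite ltn_predRL.
under eq_bigr => i i0.
  rewrite -(valN hv) opprB v_eq; last first.
    by have := ltn_ord i; rewrite ltn_predRL.
  over.
rewrite sumr_const card_ord.
move=> e1.
have p10 : (p.-1)%:R != 0 :> R by rewrite pnatr_eq0; move: p1; case: (p) => [|[]].
by apply: (mulIf p10); rewrite mulr_natr -e1 mulVf.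
Qed.

Let pi := zeta - 1.

(** The first-order expansion of (1 + pi)^n. It replaces psi(x) - 1 by pi times the trace in the
    evaluation of the first Gauss sum. *)
Lemma zeta_expansion n : vge v (v pi + v pi) (zeta ^+ n - 1 - n%:R * pi).
Proof.
have [pi0 vpi] := val_zeta_sub1.
have vpi0 : 0 <= v pi by rewrite /pi vpi invr_ge0 ler0n.
elim: n => [|n IHn]; first by rewrite expr0 mul0r !subrr vge_0.
have -> : zeta ^+ n.+1 - 1 - n.+1%:R * pi =
    (zeta ^+ n - 1 - n%:R * pi) * zeta + n%:R * (pi * pi).
  by rewrite exprSr -natr1 /pi; ring.
apply: vgeD => //.
  rewrite -[X in vge _ X _]addr0; apply: vgeM => //.
  exact: (vge0_unity hv (prim_order_gt0 prim_zeta) (prim_expr_order prim_zeta)).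
rewrite -[X in vge _ X _]add0r; apply: vgeM => //; first exact: vge0_nat.
by apply: vgeM => //; rewrite vge_neq0.
Qed.

Variables (E : finFieldType) (j : {rmorphism E -> k}).
Hypothesis chE : p \in [pchar E].

Local Notation q1 := (#|E|.-1).
Local Notation e := (logn p #|E|).
Local Notation psi := (@add_char p E K zeta).

Definition tchar (x : E) : K := teichmuller p res (j x).
Local Notation w := tchar.

Lemma card_q1 : #|E| = q1.+1.
Proof. by rewrite prednK // ltnW ?finNzRing_gt1. Qed.

Lemma q1_gt0 : (0 < q1)%N.
Proof. by rewrite -ltnS -card_q1 finNzRing_gt1. Qed.

Lemma logn_card_gt0 : (0 < e)%N.
Proof. by have := finNzRing_gt1 E; rewrite {1}(card_pchar chE); case: e. Qed.

Lemma dvdn_card : (p %| #|E|)%N.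
Proof. by rewrite (card_pchar chE) dvdn_exp // logn_card_gt0. Qed.

Lemma p_ndvd_q1 : ~~ (p %| q1)%N.
Proof.
apply/negP => dp; have := dvdn_card; rewrite card_q1 -addn1 dvdn_addr // dvdn1.
by move=> /eqP p1; have := prime_p; rewrite p1.
Qed.

Lemma expf_q1 (x : E) : x != 0 -> x ^+ q1 = 1.
Proof.
by move=> x0; apply: (mulfI x0); rewrite -exprS -card_q1 expf_card mulr1.
Qed.

Lemma tchar0 : w 0 = 0.
Proof. by rewrite /w rmorph0 (teichmuller0 S). Qed.

Lemma tcharP x : x != 0 -> res (w x) = j x /\ w x ^+ q1 = 1.
Proof.
move=> x0; apply: (teichmullerP S); [exact: q1_gt0|exact: p_ndvd_q1|].
by rewrite -rmorphXn expf_q1 // rmorph1.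
Qed.

Lemma tcharM x y : w (x * y) = w x * w y.
Proof.
have [->|x0] := eqVneq x 0; first by rewrite mul0r tchar0 mul0r.
have [->|y0] := eqVneq y 0; first by rewrite mulr0 tchar0 mulr0.
rewrite /w rmorphM; apply: (teichmullerM S q1_gt0 p_ndvd_q1);
  by rewrite -rmorphXn expf_q1 // rmorph1.
Qed.

Lemma tchar_neq0 x : x != 0 -> w x != 0.
Proof.
move=> x0; have [_ wx1] := tcharP x0; apply: contra_eqN wx1 => /eqP ->.
by rewrite expr0n gtn_eqF ?q1_gt0 // eq_sym oner_eq0.
Qed.

Lemma tchar1 : w 1 = 1.
Proof.
apply: (mulfI (tchar_neq0 (oner_neq0 E))).
by rewrite -tcharM !mulr1.
Qed.

Lemma tcharX x n : w (x ^+ n) = w x ^+ n.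
Proof. by elim: n => [|n IHn]; rewrite ?tchar1 // !exprS tcharM IHn. Qed.

Lemma tcharV x : w x^-1 = (w x)^-1.
Proof.
have [->|x0] := eqVneq x 0; first by rewrite invr0 tchar0 invr0.
by apply: (mulfI (tchar_neq0 x0)); rewrite -tcharM !divff ?tchar1 ?tchar_neq0.
Qed.

Lemma val_tchar x : x != 0 -> v (w x) = 0.
Proof. by move=> /tcharP[_]; apply: (val_unity hv q1_gt0). Qed.

Lemma vge0_tchar x : vge v 0 (w x).
Proof.
have [->|x0] := eqVneq x 0; first by rewrite tchar0 vge_0.
by rewrite vge_neq0 ?tchar_neq0 // val_tchar.
Qed.

Lemma res_tchar x : res (w x) = j x.
Proof.
have [->|/tcharP[]//] := eqVneq x 0.
by rewrite tchar0 rmorph0 (res0 S).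
Qed.

Lemma tchar_inj : injective w.
Proof. by move=> x y exy; apply: (fmorph_inj j); rewrite -!res_tchar exy. Qed.

Lemma sum_mult_char (c : E -> K) :
  (forall x y, x != 0 -> y != 0 -> c (x * y) = c x * c y) ->
  (exists2 x, x != 0 & c x != 1) -> \sum_(x | x != 0) c x = 0.
Proof.
move=> cM [g g0 cg]; have : (c g - 1) * \sum_(x | x != 0) c x = 0.
  rewrite mulrBl mul1r mulr_sumr; apply/eqP; rewrite subr_eq0; apply/eqP.
  rewrite [RHS](reindex_inj (mulfI g0)); apply: eq_big => [x|x x0].
    by rewrite mulf_eq0 (negbTE g0).
  by rewrite cM.
by move/eqP; rewrite mulf_eq0 subr_eq0 (negbTE cg) => /eqP.
Qed.

Lemma tchar_nontrivial s : ~~ (q1 %| s)%N -> exists2 x, x != 0 & w x ^+ s != 1.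
Proof.
move=> qs; have [g prim_g _] := finField_generator E.
have g0 : g != 0.
  by apply: contra_eqN (prim_expr_order prim_g) => /eqP ->; rewrite expr0n gtn_eqF ?q1_gt0 // eq_sym oner_eq0.
exists g => //; apply: contra qs => /eqP ws; rewrite (prim_order_dvd prim_g).
by apply/eqP/tchar_inj; rewrite tcharX ws tchar1.
Qed.

Lemma sum_tcharX s :
  \sum_(x | x != 0) w x ^+ s = if (q1 %| s)%N then q1%:R else 0.
Proof.
case: ifPn => [/dvdnP[m ->]|qs].
  rewrite (eq_bigr (fun=> 1)) => [|x /tcharP[_ wx]]; last first.
    by rewrite mulnC exprM wx expr1n.
  by rewrite sumr_const cardC1.
apply: sum_mult_char (tchar_nontrivial qs) => x y _ _.
by rewrite tcharM exprMn.
Qed.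

Lemma sum_tcharXV s : ~~ (q1 %| s)%N -> \sum_(x | x != 0) (w x ^+ s)^-1 = 0.
Proof.
move=> qs; apply: sum_mult_char => [x y _ _|].
  by rewrite tcharM exprMn invfM.
have [x x0 wx] := tchar_nontrivial qs; exists x => //.
by rewrite invr_eq1.
Qed.

(** The multiplicative character is w to the power -s; with this sign the valuation is governed by
    the digits of s rather than of q - 1 - s. *)
Definition gauss_sum s : K := \sum_(x | x != 0) psi x / w x ^+ s.

Lemma gauss_sum_modn s : gauss_sum (s %% q1) = gauss_sum s.
Proof.
apply: eq_bigr => x /tcharP[_ wx]; congr (_ / _).
by rewrite [in RHS](divn_eq s q1) exprD mulnC exprM wx expr1n mul1r.
Qed.

Lemma gauss_sum0 : gauss_sum 0 = -1.
Proof.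
rewrite -[RHS](add_char_sum_neq0 chE prim_zeta); apply: eq_bigr => x _.
by rewrite expr0 divr1.
Qed.

Lemma gauss_sum_frob s : gauss_sum (p * s) = gauss_sum s.
Proof.
have frob_inj : injective (fun x : E => x ^+ p).
  have [phi] := frobenius_rmorphism 1 chE; rewrite expn1 => phiE x y.
  by rewrite -!phiE => /fmorph_inj.
rewrite [RHS](reindex_inj frob_inj); apply: eq_big => [x|x _].
  by rewrite expf_eq0 prime_gt0.
by rewrite (add_char_frob chE prim_zeta) tcharX exprM.
Qed.

(** In the double sum over x and y, substitute y = x z. *)
Lemma gauss_sum_prod s t : gauss_sum s * gauss_sum t =
  \sum_(z | z != 0) (w z ^+ t)^-1 *
     \sum_(x | x != 0) psi (x * (1 + z)) / w x ^+ (s + t).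
Proof.
rewrite /gauss_sum mulr_suml.
under eq_bigr => x x0.
  rewrite (reindex_inj (mulfI x0)) mulr_sumr /=.
  rewrite (eq_bigl (fun z => z != 0)) => [|z]; last by rewrite mulf_eq0 (negbTE x0).
  over.
rewrite exchange_big /=; apply: eq_bigr => z z0.
rewrite mulr_sumr; apply: eq_bigr => x x0.
rewrite tcharM mulrDr mulr1 (add_charD chE prim_zeta) exprMn exprD !invfM.
by ring.
Qed.

Lemma gauss_sum_scaled s c : c != 0 ->
  \sum_(x | x != 0) psi (x * c) / w x ^+ s = w c ^+ s * gauss_sum s.
Proof.
move=> c0; rewrite /gauss_sum [in RHS](reindex_inj (mulIf c0)) mulr_sumr.
apply: eq_big => [x|x x0]; first by rewrite mulf_eq0 (negbTE c0) orbF.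
rewrite tcharM exprMn invfM mulrCA; congr (_ * _).
by rewrite mulrCA divff ?mulr1 // expf_neq0 // tchar_neq0.
Qed.

(** J is a Jacobi sum, integral as a sum of roots of unity. The term z = -1 of [gauss_sum_prod]
    vanishes because the character of exponent s + t is nontrivial. *)
Lemma gauss_sum_jacobi s t : ~~ (q1 %| s + t)%N ->
  exists2 J, vge v 0 J & gauss_sum s * gauss_sum t = J * gauss_sum (s + t).
Proof.
move=> qst; exists (\sum_(z | (z != 0) && (z != -1)) w (1 + z) ^+ (s + t) / w z ^+ t).
  apply: vge_sum => // z /andP[z0 _]; apply: vge0M => //.
    by rewrite -tcharX; exact: vge0_tchar.
  by rewrite -tcharX -tcharV; exact: vge0_tchar.
have m10 : -1 != 0 :> E by rewrite oppr_eq0 oner_eq0.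
rewrite gauss_sum_prod (bigD1 (-1)) //=.
rewrite [X in _ * X + _](_ : _ = 0) ?mulr0 ?add0r; last first.
  rewrite -[RHS](sum_tcharXV qst); apply: eq_bigr => x _.
  by rewrite subrr mulr0 (add_char0 chE prim_zeta) div1r.
rewrite mulr_suml; apply: eq_bigr => z /andP[z0 z1].
by rewrite gauss_sum_scaled 1?addrC ?addr_eq0 // mulrCA mulrA.
Qed.

(** The exponents add up to q - 1, so the inner sum of [gauss_sum_prod] is q - 1 for z = -1 and -1
    for every other z. The common part -1 is killed by orthogonality. *)
Lemma gauss_sum_compl s : ~~ (q1 %| s)%N -> (s <= q1)%N ->
  gauss_sum (q1 - s) * gauss_sum s = #|E|%:R / w (-1) ^+ s.
Proof.
move=> qs le_s; have m10 : -1 != 0 :> E by rewrite oppr_eq0 oner_eq0.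
rewrite gauss_sum_prod subnK //.
transitivity (\sum_(z | z != 0) ((w z ^+ s)^-1 * (if z == -1 then #|E|%:R else 0) - (w z ^+ s)^-1)).
  apply: eq_bigr => z z0.
  rewrite (eq_bigr (fun x => psi (x * (1 + z)))) => [|x /tcharP[_ ->]]; last by rewrite divr1.
  case: eqP => [->|/eqP z1]; last first.
    have z1' : 1 + z != 0 by rewrite addrC addr_eq0.
    by rewrite (add_char_sum_scaled chE prim_zeta z1') mulr0 sub0r mulrN1.
  rewrite (eq_bigr (fun=> 1)) => [|x _]; last first.
    by rewrite subrr mulr0 (add_char0 chE prim_zeta).
  by rewrite sumr_const cardC1 [in RHS]card_q1 -natr1 mulrDr mulr1 addrK.
rewrite sumrB (sum_tcharXV qs) subr0 (bigD1 (-1)) //= eqxx big1 ?addr0 1?mulrC //.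
by move=> z /andP[_ /negbTE ->]; rewrite mulr0.
Qed.

Lemma val_q1 : q1%:R != 0 :> K /\ v q1%:R = 0.
Proof.
by split; [rewrite natr_neq0 ?q1_gt0|exact: (val_coprime_nat S p_ndvd_q1)].
Qed.

Lemma gauss_sum_neq0 s : (0 < s < q1)%N -> gauss_sum s != 0 /\
  v (gauss_sum s) + v (gauss_sum (q1 - s)) = e%:R.
Proof.
move=> /andP[s0 lt_s]; have m10 : -1 != 0 :> E by rewrite oppr_eq0 oner_eq0.
have qs : ~~ (q1 %| s)%N by apply/negP => /(dvdn_leq s0); rewrite leqNgt lt_s.
have E0 : #|E|%:R != 0 :> K by rewrite natr_neq0 // card_q1.
have ws0 : (w (-1) ^+ s)^-1 != 0 by rewrite invr_eq0 expf_neq0 ?tchar_neq0.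
have prod0 : gauss_sum (q1 - s) * gauss_sum s != 0.
  by rewrite gauss_sum_compl // ?(ltnW lt_s) // mulf_neq0.
have := prod0; rewrite mulf_eq0 negb_or => /andP[g0' g0]; split=> //.
rewrite addrC -(valM hv) // gauss_sum_compl // ?(ltnW lt_s) // (valM hv) //.
rewrite (valV hv) ?expf_neq0 ?tchar_neq0 // (valX hv) ?tchar_neq0 // val_tchar //.
rewrite mul0rn oppr0 addr0 (card_pchar chE) natrX (valX hv) ?natr_neq0 ?prime_gt0 //.
by rewrite vp; congr _%:R; rewrite pfactorK.
Qed.

(** Modulo pi^2 the Gauss sum is pi A, with A the sum of Tr(x)/w(x). In the residue field Tr(x) is
    the sum of the w(x)^(p^i), and orthogonality of the characters w^(p^i - 1) keeps only i = 0: A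
    reduces to q - 1, a unit. *)
Lemma val_gauss_sum1 : (1 < q1)%N -> v (gauss_sum 1) = (p.-1)%:R^-1.
Proof.
move=> q1_gt1; have [pi0 vpi] := val_zeta_sub1; rewrite -/pi in pi0 vpi.
have [q0 vq] := val_q1.
have p1_gt0 : 0 < (p.-1)%:R^-1 :> R.
  by rewrite invr_gt0 ltr0n; have := prime_gt1 prime_p; case: (p) => [|[]].
have nq1 : ~~ (q1 %| 1)%N by rewrite dvdn1 gtn_eqF.
pose A := \sum_(x : E | x != 0) (abs_trace_nat p x)%:R / w x.
have trE x : vgt v 0 ((abs_trace_nat p x)%:R - \sum_(i < e) w x ^+ (p ^ i)).
  have sO : vge v 0 (\sum_(i < e) w x ^+ (p ^ i)).
    by apply: vge_sum => // i _; rewrite -tcharX; exact: vge0_tchar.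
  have tO : vge v 0 ((abs_trace_nat p x)%:R : K) by exact: vge0_nat.
  have sO' : vge v 0 (- \sum_(i < e) w x ^+ (p ^ i)) by rewrite (vgeN hv).
  rewrite -(rs_res_eq0 S); last exact: (vgeD hv tO sO').
  have rN y : vge v 0 y -> res (- y) = - res y.
    move=> yO; have yO' : vge v 0 (- y) by rewrite (vgeN hv).
    by apply/eqP; rewrite -addr_eq0 -(rs_resD S) // addNr (res0 S).
  rewrite (rs_resD S) // rN // (res_nat S) subr_eq0.
  rewrite (res_sum S) => [|i _]; last by rewrite -tcharX; exact: vge0_tchar.
  rewrite -(rmorph_nat j); have [_ ->] := abs_trace_natP chE x.
  rewrite rmorph_sum; apply/eqP; apply: eq_bigr => i _.
  by rewrite (resX S) ?vge0_tchar // res_tchar rmorphXn.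
have AE : vgt v 0 (A - q1%:R).
  have -> : A - q1%:R = \sum_(x : E | x != 0)
      ((abs_trace_nat p x)%:R - \sum_(i < e) w x ^+ (p ^ i)) / w x.
    rewrite (eq_bigr (fun x => (abs_trace_nat p x)%:R / w x -
      \sum_(i < e) w x ^+ (p ^ i).-1)) => [|x x0]; last first.
      rewrite mulrBl mulr_suml; congr (_ - _); apply: eq_bigr => i _.
      have pi_gt0 : (0 < p ^ i)%N by rewrite expn_gt0 prime_gt0.
      by rewrite -[in LHS](prednK pi_gt0) exprSr mulfK ?tchar_neq0.
    rewrite sumrB; congr (_ - _); rewrite exchange_big /=.
    under eq_bigr do rewrite sum_tcharX.
    rewrite (bigD1 (Ordinal logn_card_gt0)) //= dvdn0 big1 ?addr0 // => i i0.
    case: ifPn => // /dvdn_leq dv; exfalso; have lt_ie := ltn_ord i.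
    have i_gt0 : (0 < i)%N by rewrite lt0n; apply: contra i0 => /eqP i0; apply/eqP/val_inj.
    have p_gt1 := prime_gt1 prime_p.
    have lt_pi : (p ^ i < #|E|)%N by rewrite {2}(card_pchar chE) ltn_exp2l.
    have pi_gt1 : (1 < p ^ i)%N by rewrite -(expn0 p) ltn_exp2l.
    have pi1_gt0 : (0 < (p ^ i).-1)%N by rewrite -ltnS prednK // ltnW.
    by have := dv pi1_gt0; rewrite leqNgt -ltnS -card_q1 prednK ?(ltnW pi_gt1) // lt_pi.
  apply: vgt_sum => // x x0; rewrite -[0]addr0; apply: vgtM => //.
  by rewrite -tcharV; exact: vge0_tchar.
have [A0 vA] : A != 0 /\ v A = 0.
  have := val_dominant hv q0; rewrite vq => /(_ _ AE).
  by rewrite addrC subrK.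
have piA0 : pi * A != 0 by rewrite mulf_neq0.
have vpiA : v (pi * A) = v pi by rewrite (valM hv) // vA addr0.
rewrite -vpi -vpiA.
have -> : gauss_sum 1 = pi * A + (\sum_(x : E | x != 0)
    (zeta ^+ abs_trace_nat p x - 1 - (abs_trace_nat p x)%:R * pi) / w x).
  rewrite mulr_sumr -big_split /=.
  transitivity (gauss_sum 1 - \sum_(x | x != 0) (w x ^+ 1)^-1).
    by rewrite (sum_tcharXV nq1) subr0.
  rewrite -sumrB; apply: eq_bigr => x x0.
  by rewrite expr1 /add_char; ring.
apply: (proj2 (val_dominant hv piA0 _)); apply: vgt_sum => // x x0.
rewrite vpiA; apply: (@vge_gt _ _ _ _ (v pi + v pi)).
  by rewrite ltrDl vpi.
rewrite -[X in vge _ X _]addr0; apply: vgeM => //; first exact: zeta_expansion.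
by rewrite -tcharV; exact: vge0_tchar.
Qed.

(** Induction on s. If p divides s, both sides are unchanged by s -> s / p. Otherwise g(s - 1) g(1)
    = J g(s) with J integral, so the valuation grows by at most v(g(1)) = 1/(p - 1), which is the
    increment of the right-hand side. *)
Lemma val_gauss_sum_le s : (0 < s < q1)%N ->
  v (gauss_sum s) <= (frac_sum p e s)%:R / q1%:R.
Proof.
have p_gt1 := prime_gt1 prime_p.
have cardE := card_pchar chE.
have q1R : q1%:R != 0 :> R by rewrite pnatr_eq0 -lt0n q1_gt0.
have sum_p : ((\sum_(i < e) p ^ i)%N)%:R / q1%:R = (p.-1)%:R^-1 :> R.
  have := @predn_mul_sum_exp p e; rewrite -cardE => <-.
  rewrite natrM invfM mulrCA divff ?mulr1 // pnatr_eq0.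
  have := q1_gt0; rewrite {1}cardE -predn_mul_sum_exp.
  by rewrite muln_gt0 lt0n => /andP[_]; rewrite lt0n.
have [n] := ubnP s; elim: n s => // n IHn s; rewrite ltnS => le_n /andP[s0 lt_s].
have [/dvdnP[s' es]|ps] := boolP (p %| s)%N.
  rewrite es mulnC gauss_sum_frob frac_sum_frob ?logn_card_gt0 //.
  have s'0 : (0 < s')%N by move: s0; rewrite es muln_gt0 => /andP[].
  have lt_s' : (s' < s)%N by rewrite es ltn_Pmulr.
  by apply: IHn; [apply: leq_trans lt_s' _|rewrite s'0 (ltn_trans lt_s')].
case: s s0 lt_s le_n ps => // t _ lt_s le_n pt.
have lt_s' : (t.+1 < (p ^ e).-1)%N by rewrite -cardE.
rewrite frac_sumS ?logn_card_gt0 // natrD mulrDl sum_p.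
have q1_gt1 : (1 < q1)%N by apply: leq_ltn_trans lt_s.
have v1 := val_gauss_sum1 q1_gt1.
have [t0|t_gt0] := posnP t; first by rewrite t0 frac_sum0 mul0r add0r v1.
have ndvd : ~~ (q1 %| t + 1)%N.
  by rewrite addn1; apply/negP => /(dvdn_leq (ltn0Sn t)); rewrite leqNgt lt_s.
have [J JO eJ] := gauss_sum_jacobi ndvd.
have [gt0 _] : gauss_sum t != 0 /\ _ := gauss_sum_neq0 (introT andP (conj t_gt0 (ltnW lt_s))).
have [g10 _] : gauss_sum 1 != 0 /\ _ := @gauss_sum_neq0 1 q1_gt1.
have J0 : J != 0.
  by apply: contraNneq (mulf_neq0 gt0 g10) => J0; rewrite eJ J0 mul0r.
have gt10 : gauss_sum (t + 1) != 0.
  by apply: contraNneq (mulf_neq0 gt0 g10) => h; rewrite eJ h mulr0.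
have := congr1 v eJ; rewrite !(valM hv) // v1 addn1 => ev.
have le_t : v (gauss_sum t) <= (frac_sum p e t)%:R / q1%:R.
  by apply: IHn; [|rewrite t_gt0 (ltnW lt_s)].
move: JO; rewrite vge_neq0 // => JO.
by move: ev le_t JO; lra.
Qed.

(* The upper bounds for s and q - 1 - s add up to e, which is also the
   valuation of the product of the two Gauss sums; so both are attained. *)
Theorem stickelberger s : (s < q1)%N ->
  gauss_sum s != 0 /\ v (gauss_sum s) = (frac_sum p e s)%:R / q1%:R.
Proof.
have cardE := card_pchar chE.
have q1R : q1%:R != 0 :> R by rewrite pnatr_eq0 -lt0n q1_gt0.
have [->|s0] := posnP s => lt_s.
  by rewrite gauss_sum0 (valN hv) (val1 hv) frac_sum0 mul0r oppr_eq0 oner_eq0.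
have s_in : (0 < s < q1)%N by rewrite s0.
have s_in' : (0 < q1 - s < q1)%N by lia.
have [g0 vg] := gauss_sum_neq0 s_in; split=> //.
have := val_gauss_sum_le s_in; have := val_gauss_sum_le s_in'.
have := @frac_sum_compl p e (prime_gt1 prime_p) logn_card_gt0 s.
rewrite -cardE => /(_ s_in) /(congr1 (fun m => m%:R / q1%:R : R)).
rewrite natrD natrM mulfK // mulrDl => efr le1 le2.
by move: vg efr le1 le2; lra.
Qed.

End GaussSum.

(** * Gauss sums in towers of finite fields *)

Lemma finField_image (E : finFieldType) (k : fieldType) (j : {rmorphism E -> k}) (y : k) :
  y ^+ #|E| = y -> exists x, j x = y.
Proof.
move=> yQ; have := congr1 (fun P => (map_poly j P).[y]) (finField_genPoly E).
rewrite rmorphB rmorphXn /= map_polyX !hornerE yQ subrr => /esym /eqP.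
rewrite rmorph_prod horner_prod /= prodf_seq_eq0 => /hasP[x _ /=].
rewrite rmorphB /= map_polyX map_polyC !hornerE subr_eq0 => /eqP ->.
by exists x.
Qed.

(** The image of j is the full solution set of y^|E| = y, so it contains the image of j0, and j0
    factors through j. *)
Lemma finField_lift (E0 E : finFieldType) (k : fieldType) d
    (j0 : {rmorphism E0 -> k}) (j : {rmorphism E -> k}) :
  #|E| = (#|E0| ^ d)%N ->
  exists phi : {rmorphism E0 -> E}, forall x, j (phi x) = j0 x.
Proof.
move=> cardE; have ex x : exists y, j y = j0 x.
  apply: finField_image; rewrite -rmorphXn cardE; congr (j0 _).
  by elim: d {cardE} => [|d IHd]; rewrite ?expr1 // expnSr exprM IHd expf_card.
have [f fP] := choice ex.
have fB : zmod_morphism f.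
  by move=> x y; apply: (fmorph_inj j); rewrite rmorphB !fP rmorphB.
have fM : monoid_morphism f.
  split=> [|x y]; apply: (fmorph_inj j); first by rewrite fP !rmorph1.
  by rewrite rmorphM !fP rmorphM.
pose fA := GRing.isZmodMorphism.Build _ _ f fB.
pose fMx := GRing.isMonoidMorphism.Build _ _ f fM.
pose fR : {rmorphism E0 -> E} := HB.pack f fA fMx.
by exists fR.
Qed.

Section HasseDavenportGauss.

Variables (R : realType) (K : fieldType) (v : K -> R) (p : nat).
Variables (k : fieldType) (res : K -> k).
Hypothesis S : residue_setting v p res.
Variable (zeta : K).
Hypothesis prim_zeta : p.-primitive_root zeta.

(** Fields of equal cardinality have the same image in k; the resulting isomorphism respects traces
    and Teichmueller characters. *)
Lemma gauss_sum_indep (E E' : finFieldType) (j : {rmorphism E -> k})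
    (j' : {rmorphism E' -> k}) s :
  p \in [pchar E] -> p \in [pchar E'] -> #|E| = #|E'| ->
  gauss_sum p res zeta j s = gauss_sum p res zeta j' s.
Proof.
move=> chE chE' cardE.
have [phi phiP] : exists phi : {rmorphism E -> E'}, forall x, j' (phi x) = j x.
  by apply: (@finField_lift _ _ _ 1); rewrite expn1.
have [psi psiP] : exists psi : {rmorphism E' -> E}, forall x, j (psi x) = j' x.
  by apply: (@finField_lift _ _ _ 1); rewrite expn1.
rewrite /gauss_sum [RHS](reindex phi) /=; last first.
  exists psi => x _; [apply: (fmorph_inj j)|apply: (fmorph_inj j')].
    by rewrite psiP phiP.
  by rewrite phiP psiP.
apply: eq_big => [x|x x0]; first by rewrite fmorph_eq0.
rewrite /tchar phiP; congr (_ / _); apply/esym/(add_char_trace chE' prim_zeta).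
apply: (fmorph_inj j'); rewrite rmorph_nat -(rmorph_nat j).
have [_ ->] := abs_trace_natP chE x.
rewrite !rmorph_sum cardE; apply: eq_bigr => i _.
by rewrite !rmorphXn phiP.
Qed.

Lemma abs_trace_tower (F E : finFieldType) d (emb : {rmorphism F -> E}) (x : E) :
  p \in [pchar F] -> #|E| = (#|F| ^ d.+1)%N ->
  abs_trace p x = emb (abs_trace p (emb_inv emb (\sum_(y <- conjs F d.+1 x) y))).
Proof.
move=> chF cardE; have chE : p \in [pchar E] by rewrite (fmorph_pchar emb).
have prp := pcharf_prime chF.
set e := logn p #|F|; have cardF : #|F| = (p ^ e)%N := card_pchar chF.
rewrite /abs_trace -/e rmorph_sum.
have -> : logn p #|E| = (d.+1 * e)%N by rewrite cardE cardF -expnM mulnC pfactorK.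
transitivity (\sum_(i < e) \sum_(y <- conjs F d.+1 x) y ^+ (p ^ i)); last first.
  apply: eq_bigr => i _; rewrite rmorphXn emb_invK; last exact: sum_conjs_fixed.
  by have [phi phiE] := frobenius_rmorphism i chE; rewrite -phiE rmorph_sum; apply: eq_bigr => y _; rewrite phiE.
rewrite exchange_big /= /conjs big_map.
have bigE (g : nat -> E) : \sum_(i <- iota 0 d.+1) g i = \sum_(i < d.+1) g i.
  by rewrite -(big_mkord xpredT) /index_iota subn0.
rewrite bigE; elim: (d.+1) => [|m IHm]; first by rewrite mul0n !big_ord0.
rewrite mulSnr big_split_ord /= IHm big_ord_recr /=; congr (_ + _).
by apply: eq_bigr => i _; rewrite -exprM cardF -expnM -expnD mulnC.
Qed.

Variable E : nat -> finFieldType.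
Hypothesis chE : forall i, p \in [pchar E i].
Hypothesis cardE : forall i, #|E i| = (#|E 0%N| ^ i.+1)%N.
Variable j : forall i, {rmorphism E i -> k}.

(** Raising to the power sum_b Q^b with Q = |E 0| is the norm to [E 0], so the exponent on the left
    is the lift of the character along the norm; psi lifts along the trace by transitivity. *)
Lemma gauss_sum_hasse_davenport i s :
  gauss_sum p res zeta (j i) (s * \sum_(b < i.+1) #|E 0%N| ^ b) =
  (-1) ^+ i * gauss_sum p res zeta (j 0%N) s ^+ i.+1.
Proof.
have exemb l : exists emb : {rmorphism E 0%N -> E l}, forall x, j l (emb x) = j 0%N x.
  exact: (finField_lift (j 0%N) (j l) (cardE l)).
pose emb l := projT1 (cid (exemb l)).
have embP l x : j l (emb l x) = j 0%N x := projT2 (cid (exemb l)) x.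
pose psi := @add_char p (E 0%N) K zeta.
(* The value 0 at 0 makes the sum over the whole field equal to the Gauss sum also for s = 0. *)
pose chi (y : E 0%N) : K := if y == 0 then 0 else (tchar p res (j 0%N) y ^+ s)^-1.
have psi0 : psi 0 = 1 := add_char0 (chE 0) prim_zeta.
have psiD x y : psi (x + y) = psi x * psi y := add_charD (chE 0) prim_zeta x y.
have psiN : exists x, psi x != 1 := add_char_nontrivial (chE 0) prim_zeta.
have chi1 : chi 1 = 1.
  by rewrite /chi oner_eq0 (tchar1 S) ?expr1n ?invr1.
have chiM x y : chi (x * y) = chi x * chi y.
  rewrite /chi mulf_eq0; case: eqP => [|_] /=; first by rewrite mul0r.
  case: eqP => [|_]; first by rewrite mulr0.
  by rewrite (tcharM S) // exprMn invfM.
have HD := hasse_davenport emb cardE psi0 psiD psiN chi1 chiM i.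
have <- : \sum_x psi x * chi x = gauss_sum p res zeta (j 0%N) s.
  rewrite (bigD1 0) //= /chi eqxx mulr0 add0r; apply: eq_bigr => x x0.
  by rewrite (negbTE x0).
rewrite -HD weil_power_sumE //.
have prodE x : \prod_(y <- conjs (E 0%N) i.+1 x) y =
    x ^+ (\sum_(b < i.+1) #|E 0%N| ^ b)%N.
  rewrite /conjs big_map -[X in iota 0 X]subn0 -/(index_iota 0 _) big_mkord.
  elim: i.+1 => [|m IHm]; first by rewrite !big_ord0.
  by rewrite !big_ord_recr /= IHm exprD.
have emb_prodE x : emb i (emb_inv (emb i) (\prod_(y <- conjs (E 0%N) i.+1 x) y)) =
    x ^+ (\sum_(b < i.+1) #|E 0%N| ^ b)%N.
  by rewrite emb_invK ?prodE // -prodE prod_conjs_fixed.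
rewrite [RHS](bigD1 0) //= [X in _ * X + _](_ : _ = 0) ?mulr0 ?add0r; last first.
  rewrite /chi -(fmorph_eq0 (emb i)) emb_prodE expr0n big_ord_recl expn0.
  by rewrite eqxx.
apply: eq_bigr => x x0; congr (_ * _).
  apply: (add_char_trace (chE i) prim_zeta).
  rewrite (abs_trace_tower (emb i) _ (chE 0) (cardE i)).
  rewrite -(rmorph_nat (emb i)); congr (emb i _).
  by have [_ ->] := abs_trace_natP (chE 0) (emb_inv (emb i) (\sum_(y <- conjs (E 0%N) i.+1 x) y)).
rewrite /chi -(fmorph_eq0 (emb i)) emb_prodE expf_eq0 (negbTE x0) andbF.
rewrite /tchar -(embP i) emb_prodE; congr (_^-1).
have e1 : teichmuller p res (j i (x ^+ (\sum_(b < i.+1) #|E 0%N| ^ b))) =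
    teichmuller p res (j i x) ^+ (\sum_(b < i.+1) #|E 0%N| ^ b).
  exact: (tcharX S (j i) (chE i)).
by rewrite e1 -exprM mulnC.
Qed.

End HasseDavenportGauss.

(** * Exponential sums *)

Section ExpSum.

Variables (R : realType) (K : fieldType) (v : K -> R) (p : nat).
Variables (k : fieldType) (res : K -> k).
Hypothesis S : residue_setting v p res.
Variable (zeta : K).
Hypothesis prim_zeta : p.-primitive_root zeta.
Variables (E : finFieldType) (j : {rmorphism E -> k}).
Hypothesis chE : p \in [pchar E].

Local Notation q1 := (#|E|.-1).
Local Notation psi := (@add_char p E K zeta).
Local Notation w := (tchar p res j).
Local Notation g := (gauss_sum p res zeta j).

Let q1_neq0 : q1%:R != 0 :> K.
Proof. by rewrite (rs_natr_neq0 S) ?q1_gt0. Qed.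

Lemma tchar_exprz (x : E) (m : int) : w (x ^ m) = w x ^ m.
Proof.
case: m => m; first by rewrite -!exprnP (tcharX S).
by rewrite !NegzE -!exprnN (tcharV S) ?(tcharX S).
Qed.

Lemma sum_tchar_exprz (m : int) :
  \sum_(x | x != 0) w x ^ m = if (q1 %| m)%Z then q1%:R else 0.
Proof.
have q10 : (q1 : int) != 0 by rewrite -lt0n q1_gt0.
have [r er] : exists r : nat, (m %% q1)%Z = r.
  by case: (m %% q1)%Z (modz_ge0 m q10) => // r _; exists r.
rewrite (eq_bigr (fun x => w x ^+ r)) => [|x x0]; last first.
  rewrite {1}(divz_eq m q1) er expfzDr ?(tchar_neq0 S) // [X in w x ^ X * _]mulrC.
  by rewrite -exprz_exp -!exprnP (proj2 (tcharP S j chE x0)) exp1rz mul1r.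
rewrite (sum_tcharX S) //; congr (if _ then _ else _).
rewrite -[LHS]/(q1%:Z %| r%:Z)%Z [in RHS](divz_eq m q1) er.
by rewrite rpredDl // dvdz_mull.
Qed.

(** Fourier inversion on the multiplicative group of [E]. *)
Lemma add_char_expansion (y : E) : y != 0 ->
  psi y = q1%:R^-1 * \sum_(s < q1) g s * w y ^+ s.
Proof.
move=> y0; apply: (mulfI q1_neq0); rewrite mulrA divff // mul1r.
rewrite /gauss_sum; under eq_bigr do rewrite mulr_suml.
rewrite exchange_big /= (bigD1 y) //= [X in _ + X]big1 ?addr0 => [|x /andP[x0 xy]].
  rewrite (eq_bigr (fun=> psi y)) => [|s _]; last by rewrite divfK ?expf_neq0 ?(tchar_neq0 S).
  by rewrite sumr_const card_ord mulr_natl.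
have wx0 := tchar_neq0 S j chE x0.
pose u := w y / w x; have u1 : u != 1.
  apply: contraNneq xy => /(congr1 ( *%R^~ (w x))); rewrite mul1r divfK // => /eqP.
  by rewrite eq_sym => /eqP /(tchar_inj S chE) ->.
rewrite (eq_bigr (fun s : 'I_q1 => psi x * u ^+ s)) => [|s _]; last first.
  by rewrite /u expr_div_n mulrAC mulrA.
rewrite -mulr_sumr [X in _ * X](_ : _ = 0) ?mulr0 //.
apply: (mulfI (_ : u - 1 != 0)); first by rewrite subr_eq0.
rewrite -subrX1 mulr0 /u expr_div_n (proj2 (tcharP S j chE x0)).
by rewrite (proj2 (tcharP S j chE y0)) divr1 subrr.
Qed.

Variables (n : nat) (M : 'M[int]_n) (b : 'I_n -> E).
Hypothesis b_neq0 : forall i, b i != 0.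

(** Expanding psi at each of the n monomials gives exponents s_l; then x_i carries the character w
    to the power (M s)_i, and orthogonality keeps the s with M s = 0 modulo |E| - 1. With as many
    variables as monomials, the factors |E| - 1 cancel. *)
Lemma exp_sum_gauss :
  exp_sum zeta p M b = \sum_(s : {ffun 'I_n -> 'I_q1} |
      [forall i, (q1%:Z %| \sum_(l < n) M i l * (s l)%:Z)%Z])
    \prod_(l < n) (g (s l) * w (b l) ^+ s l).
Proof.
pose mon (x : 'I_n -> E) l := \prod_(i < n) x i ^ (M i l).
have psi_sum (y : 'I_n -> E) : psi (\sum_l y l) = \prod_l psi (y l).
  apply: (big_morph psi) => [x z|]; first exact: (add_charD chE prim_zeta).
  exact: (add_char0 chE prim_zeta).
have wprod (I : finType) (f : I -> E) : w (\prod_i f i) = \prod_i w (f i).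
  by apply: (big_morph w) => [x z|]; [exact: (tcharM S)|exact: (tchar1 S)].
transitivity (\sum_(x : {ffun 'I_n -> E} | [forall i, x i != 0])
   \sum_(s : {ffun 'I_n -> 'I_q1}) (\prod_l (q1%:R^-1 * (g (s l) * w (b l) ^+ s l))) *
     \prod_(i < n) w (x i) ^ (\sum_(l < n) M i l * (s l)%:Z)).
  apply: eq_bigr => x /forallP x0.
  have -> : zeta ^+ abs_trace_nat p (laurent_eval M b x) = psi (\sum_l b l * mon x l) by [].
  rewrite psi_sum.
  have y0 l : b l * mon x l != 0.
    rewrite mulf_neq0 //; apply/prodf_neq0 => i _; rewrite expfz_neq0 //; exact: x0.
  under eq_bigr => l _ do rewrite (add_char_expansion (y0 l)) mulr_sumr.
  rewrite bigA_distr_bigA; apply: eq_bigr => s _ /=.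
  rewrite [X in _ = _ * X](eq_bigr (fun i => \prod_(l < n) w (x i) ^ (M i l * (s l)%:Z))) => [|i _]; last first.
    have wx0 : w (x i) != 0 by apply: (tchar_neq0 S).
    apply: (big_rec2 (fun (m : int) z => w (x i) ^ m = z)) => [|l m z _ <-].
      by rewrite expr0z.
    by rewrite expfzDr.
  rewrite exchange_big /= -big_split; apply: eq_bigr => l _ /=.
  rewrite (tcharM S) // exprMn wprod -!mulrA; congr (_ * (_ * (_ * _))).
  rewrite -prodrXl; apply: eq_bigr => i _.
  by rewrite tchar_exprz -exprz_exp -exprnP.
rewrite exchange_big /= [RHS]big_mkcond /=; apply: eq_bigr => s _.
rewrite -mulr_sumr.
have -> : \sum_(x : {ffun 'I_n -> E} | [forall i, x i != 0])
     \prod_(i < n) w (x i) ^ (\sum_(l < n) M i l * (s l)%:Z) =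
   \prod_(i < n) \sum_(y | y != 0) w y ^ (\sum_(l < n) M i l * (s l)%:Z).
  rewrite bigA_distr_big; apply: eq_bigl => x; apply/forallP/ffun_onP => x0 i; exact: x0.
under [X in _ * X]eq_bigr do rewrite sum_tchar_exprz.
case: ifPn => [/forallP ds|]; last first.
  rewrite negb_forall => /existsP[i ndi]; apply/eqP.
  by rewrite mulf_eq0; apply/orP; right; apply/prodf_eq0; exists i; rewrite // (negbTE ndi).
rewrite -big_split /=; apply: eq_bigr => l _.
by rewrite ds mulrC mulrA divff // mul1r.
Qed.

Variable N : nat.
Hypotheses (NE : N = `|\det M|%N) (N_gt0 : (0 < N)%N).

(** Multiply the congruence M s = 0 by the adjugate of M. *)
Lemma dvd_det_vector (q : nat) (s : 'I_n -> nat) l :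
  (forall i, (q%:Z %| \sum_(l < n) M i l * (s l)%:Z)%Z) -> (q %| N * s l)%N.
Proof.
move=> ds; pose sv : 'cV[int]_n := \col_l (s l)%:Z.
have e1 : \adj M *m (M *m sv) = \det M *: sv by rewrite mulmxA mul_adj_mx mul_scalar_mx.
have /matrixP /(_ l 0) := e1; rewrite !mxE => e2.
have : (q%:Z %| \det M * (s l)%:Z)%Z.
  rewrite -e2; apply: rpred_sum => i _; apply: dvdz_mull.
  rewrite mxE; under eq_bigr do rewrite mxE; exact: ds.
by rewrite dvdzE abszM NE.
Qed.

(** The same vector r is written s / (|E| - 1) and t / N: its denominators divide N by
    [dvd_det_vector]. The size of [E] now enters the index set only through the condition that (|E|
    - 1) r is integral. *)
Lemma exp_sum_lattice : exp_sum zeta p M b = \sum_(t : {ffun 'I_n -> 'I_N} |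
      [forall i, (N%:Z %| \sum_(l < n) M i l * (t l)%:Z)%Z] &&
      [forall l : 'I_n, (N %| q1 * t l)%N])
    \prod_(l < n) (g (q1 * t l %/ N)%N * w (b l) ^+ (q1 * t l %/ N)).
Proof.
have q1_0 : (0 < q1)%N := q1_gt0 E.
have ltN (t : 'I_N) : (q1 * t %/ N < q1)%N by rewrite ltn_divLR // ltn_mul2l q1_0 ltn_ord.
have ltq (s : 'I_q1) : (N * s %/ q1 < N)%N by rewrite ltn_divLR // ltn_mul2l N_gt0 ltn_ord.
pose f (t : {ffun 'I_n -> 'I_N}) : {ffun 'I_n -> 'I_q1} := [ffun l => Ordinal (ltN (t l))].
pose h (s : {ffun 'I_n -> 'I_q1}) : {ffun 'I_n -> 'I_N} := [ffun l => Ordinal (ltq (s l))].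
rewrite exp_sum_gauss (reindex_onto f h) /=; last first.
  move=> s /forallP ds; apply/ffunP => l; apply: val_inj; rewrite !ffunE /=.
  have dNs := @dvd_det_vector q1 (fun l => s l) l ds.
  by rewrite mulnC divnK // mulKn.
have scale (t : {ffun 'I_n -> 'I_N}) (s : {ffun 'I_n -> 'I_q1}) i :
    (forall l : 'I_n, (N * s l)%N = (q1 * t l)%N) ->
    (q1%:Z %| \sum_(l < n) M i l * (s l)%:Z)%Z = (N%:Z %| \sum_(l < n) M i l * (t l)%:Z)%Z.
  move=> est; have eS : N%:Z * (\sum_(l < n) M i l * (s l)%:Z) =
      q1%:Z * (\sum_(l < n) M i l * (t l)%:Z).
    rewrite !mulr_sumr; apply: eq_bigr => l _.
    by rewrite mulrCA -PoszM est PoszM mulrCA.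
  have N0 : N%:Z != 0 by rewrite -lt0n.
  have q0 : q1%:Z != 0 by rewrite -lt0n.
  by rewrite -(dvdz_mul2l N0) eS [N%:Z * q1%:Z]mulrC dvdz_mul2l.
apply: eq_big => [t|t _]; last by apply: eq_bigr => l _; rewrite !ffunE.
apply/andP/andP => [[/forallP df /eqP hft]|[/forallP dt /forallP dq]].
  have est l : (N * f t l = q1 * t l)%N.
    have := @dvd_det_vector q1 (fun l => f t l) l df.
    have e : (t l : nat) = (N * f t l %/ q1)%N by rewrite -{1}hft ffunE.
    by move=> dv; rewrite [in RHS]e mulnC [in RHS]mulnC divnK // mulnC.
  split; apply/forallP => i; first by rewrite -(@scale t (f t)).
  by rewrite -est dvdn_mulr.
have est l : (N * f t l = q1 * t l)%N by rewrite ffunE /= mulnC divnK //; exact: dq.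
split; first by apply/forallP => i; rewrite (@scale t).
apply/eqP/ffunP => l; apply: val_inj; rewrite ffunE /=.
by rewrite est mulKn.
Qed.

End ExpSum.

(** * Multiplication on S(Delta) in integral coordinates modulo N *)

Section Scaling.

Variables (n N : nat).
Hypothesis N_gt0 : (0 < N)%N.

(** For r = t / N this is r -> {m r}, and [vsize] divided by N is |r|. *)
Definition vscale (m : nat) (t : {ffun 'I_n -> 'I_N}) : {ffun 'I_n -> 'I_N} :=
  [ffun l => Ordinal (ltn_pmod (m * t l) N_gt0)].

Definition vsize (t : {ffun 'I_n -> 'I_N}) : nat := (\sum_l t l)%N.

Lemma vscaleM m m' t : vscale m (vscale m' t) = vscale (m * m') t.
Proof.
by apply/ffunP => l; apply: val_inj; rewrite !ffunE /= modnMmr mulnA.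
Qed.

Lemma vscale_modn m m' t : m = m' %[mod N] -> vscale m t = vscale m' t.
Proof.
move=> e; apply/ffunP => l; apply: val_inj; rewrite !ffunE /=.
by rewrite -modnMml e modnMml.
Qed.

Lemma vscale1 t : vscale 1 t = t.
Proof.
by apply/ffunP => l; apply: val_inj; rewrite !ffunE /= mul1n modn_small.
Qed.

Lemma vscale_eqP m t : (0 < m)%N ->
  reflect (vscale m t = t) [forall l : 'I_n, (N %| m.-1 * t l)%N].
Proof.
move=> m0; have e l : (N %| m.-1 * t l)%N = (m * t l %% N == t l :> nat)%N.
  rewrite -[X in _ == X](modn_small (ltn_ord (t l))) eqn_mod_dvd ?leq_pmull //.
  by rewrite -[X in (_ * _ - X)%N]mul1n -mulnBl subn1.
apply: (iffP forallP) => [h|h l].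
  by apply/ffunP => l; apply: val_inj; rewrite !ffunE /=; apply/eqP; rewrite -e.
by rewrite e -{2}h ffunE.
Qed.

Variable M : 'M[int]_n.

(** Integrality of M (t / N), that is, membership of t / N in S(Delta). *)
Definition in_lattice (t : {ffun 'I_n -> 'I_N}) : bool :=
  [forall i, (N%:Z %| \sum_(l < n) M i l * (t l)%:Z)%Z].

Lemma in_lattice_vscale m t : in_lattice t -> in_lattice (vscale m t).
Proof.
move=> /forallP h; apply/forallP => i.
have -> : \sum_(l < n) M i l * (vscale m t l)%:Z =
    m%:Z * (\sum_(l < n) M i l * (t l)%:Z) -
    (\sum_(l < n) M i l * (m * t l %/ N)%N%:Z) * N%:Z.
  rewrite mulr_sumr mulr_suml -sumrB; apply: eq_bigr => l _; rewrite ffunE /=.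
  rewrite mulrCA -mulrA -mulrBr; congr (_ * _).
  by rewrite -!PoszM [X in _ = Posz X - _](divn_eq (m * t l) N) PoszD addrAC subrr add0r.
by rewrite rpredB ?dvdz_mull // h.
Qed.

End Scaling.

Section Family.

Variables (R : realType) (K : fieldType) (v : K -> R) (p : nat).
Variables (k : fieldType) (res : K -> k).
Hypothesis S : residue_setting v p res.
Variable (zeta : K).
Hypothesis prim_zeta : p.-primitive_root zeta.

Variables (F : finFieldType) (E : nat -> finFieldType).
Hypothesis chF : p \in [pchar F].
Variable iota : forall i, {rmorphism F -> E i}.
Hypothesis cardE : forall i, (0 < i)%N -> #|E i| = (#|F| ^ i)%N.
Variables (jF : {rmorphism F -> k}) (j : forall i, {rmorphism E i -> k}).
Hypothesis jP : forall i x, (0 < i)%N -> j i (iota i x) = jF x.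

Variables (n N : nat) (a : 'I_n -> F).
Hypothesis a_neq0 : forall l, a l != 0.
Hypothesis N_gt0 : (0 < N)%N.

Local Notation T := {ffun 'I_n -> 'I_N}.
Local Notation q := #|F|.
Local Notation q1 i := (#|E i|.-1).
Local Notation g i := (gauss_sum p res zeta (j i)).
Local Notation wF := (tchar p res jF).

Let prime_p : prime p. Proof. exact: rs_prime S. Qed.
Let hv : is_valuation v. Proof. exact: rs_valuation S. Qed.

Let chE i : p \in [pchar E i].
Proof. by rewrite (fmorph_pchar (iota i)). Qed.

(** The minus sign on each Gauss sum absorbs the sign of the Hasse-Davenport relation, so that
    extending the field becomes a plain power; a global (-1)^n is left outside. *)
Definition orbit_term i (t : T) : K :=
  \prod_l (- g i (q1 i * t l %/ N) * wF (a l) ^+ (q1 i * t l %/ N)).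

Lemma tchar_iota i x : (0 < i)%N -> tchar p res (j i) (iota i x) = wF x.
Proof. by move=> i0; rewrite /tchar jP. Qed.

Lemma exp_sum_orbit_terms (M : 'M[int]_n) i : N = `|\det M|%N -> (0 < i)%N ->
  exp_sum zeta p M (fun l => iota i (a l)) =
  (-1) ^+ n * \sum_(t : T | in_lattice M t && (vscale N_gt0 (q ^ i) t == t)) orbit_term i t.
Proof.
move=> NE i0; have b0 l : iota i (a l) != 0 by rewrite fmorph_eq0.
rewrite (exp_sum_lattice S prim_zeta (j i) (chE i) b0 NE N_gt0) mulr_sumr.
apply: eq_big => [t|t _].
  congr (_ && _); rewrite -/(in_lattice M t).
  have qi : (0 < q ^ i)%N by rewrite expn_gt0 ltnW ?finNzRing_gt1.
  by rewrite cardE //; apply/idP/eqP => /(vscale_eqP N_gt0 t qi).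
rewrite -[n in (-1) ^+ n]card_ord -prodr_const -big_split; apply: eq_bigr => l _ /=.
by rewrite tchar_iota // !mulNr mul1r opprK.
Qed.

(** Gauss sums are invariant under s -> p s, and w(a_l)^q = w(a_l) because a_l lies in [F]. *)
Lemma orbit_term_vscale i (t : T) : (0 < i)%N -> [forall l : 'I_n, (N %| q1 i * t l)%N] ->
  orbit_term i (vscale N_gt0 q t) = orbit_term i t.
Proof.
move=> i0 /forallP dt; apply: eq_bigr => l _; rewrite ffunE /=.
set s := (q1 i * t l %/ N)%N; have sE : (s * N = q1 i * t l)%N by rewrite divnK.
have sE' : (q1 i * (q * t l %% N) %/ N = q * s %% q1 i)%N.
  have -> : (q1 i * (q * t l %% N) = q * s %% q1 i * N)%N.
    by rewrite [RHS]muln_modl -mulnA sE mulnCA -muln_modr.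
  by rewrite mulnK.
rewrite sE' (gauss_sum_modn S) //; congr (- _ * _).
  have [e ->] : exists e, q = (p ^ e)%N by exists (logn p q); exact: card_pchar.
  elim: e => [|e IHe]; first by rewrite mul1n.
  by rewrite expnS -mulnA (gauss_sum_frob S prim_zeta).
have wq : wF (a l) ^+ q = wF (a l) by rewrite -(tcharX S) // expf_card.
have wq1 : wF (a l) ^+ q1 i = 1.
  rewrite -(tchar_iota (a l) i0) (proj2 (tcharP S (j i) (chE i) _)) //.
  by rewrite fmorph_eq0.
transitivity (wF (a l) ^+ (q * s)); last by rewrite exprM wq.
by rewrite [in RHS](divn_eq (q * s) (q1 i)) exprD [(_ * q1 i)%N]mulnC exprM wq1 expr1n mul1r.
Qed.

(** Hasse-Davenport over [E d]. The powers of w(a_l) match because sum_b |E d|^b = m modulo q -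
    1. *)
Lemma orbit_term_multiple d m (t : T) : (0 < d)%N -> (0 < m)%N ->
  [forall l : 'I_n, (N %| q1 d * t l)%N] ->
  orbit_term (d * m) t = orbit_term d t ^+ m.
Proof.
move=> d0 m0 /forallP dt; rewrite -prodrXl; apply: eq_bigr => l _.
set s := (q1 d * t l %/ N)%N; have sE : (s * N = q1 d * t l)%N by rewrite divnK.
have q1dm : q1 (d * m)%N = (q1 d * \sum_(b < m) #|E d| ^ b)%N.
  by rewrite cardE ?muln_gt0 ?d0 // expnM -(cardE d0) predn_exp.
have -> : (q1 (d * m) * t l %/ N = s * \sum_(b < m) #|E d| ^ b)%N.
  by rewrite q1dm mulnAC -sE mulnAC mulnK.
rewrite exprMn -exprM; congr (_ * _).
  have [m' em] : exists m', m = m'.+1 by exists m.-1; rewrite prednK.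
  (* The tower over [E d], indexed as the relation expects. Its bottom [E (d * 1)] is not [E d] by
     conversion; [gauss_sum_indep] bridges the two. *)
  pose E' i := E (d * i.+1)%N.
  have cardE' i : #|E' i| = (#|E' 0%N| ^ i.+1)%N.
    by rewrite /E' !cardE ?muln_gt0 ?d0 // muln1 expnM.
  have HD := gauss_sum_hasse_davenport S prim_zeta (fun i => chE (d * i.+1)) cardE' (fun i => j (d * i.+1)) m' s.
  have := HD; rewrite -(gauss_sum_indep res prim_zeta (j d) (j (d * 1)) s) //; last by rewrite muln1.
  rewrite /E' muln1 -em => ->.
  by rewrite [in RHS]exprNn em [in RHS]exprS mulN1r mulNr.
have [c ec] : exists c, (s * \sum_(b < m) #|E d| ^ b = c * q.-1 + s * m)%N.
  have mE : m = (\sum_(b < m) 1)%N by rewrite sum1_card card_ord.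
  have dq : (q.-1 %| \sum_(b < m) #|E d| ^ b - m)%N.
    rewrite [X in (_ - X)%N]mE -sumnB => [|b _]; last by rewrite expn_gt0 ltnW ?finNzRing_gt1.
    apply: dvdn_sum => b _; rewrite cardE // -expnM subn1 predn_exp dvdn_mulr //.
  have le_m : (m <= \sum_(b < m) #|E d| ^ b)%N.
    rewrite [X in (X <= _)%N]mE; apply: leq_sum => b _.
    by rewrite expn_gt0 ltnW ?finNzRing_gt1.
  have [c ec] := dvdnP dq; exists (s * c)%N.
  by rewrite -mulnA -ec -mulnDr subnK.
have wq1 : wF (a l) ^+ q.-1 = 1 by rewrite (proj2 (tcharP S jF chF (a_neq0 l))).
by rewrite ec exprD [(c * _)%N]mulnC exprM wq1 expr1n mul1r.
Qed.

(** Stickelberger's theorem at s = (q^i - 1) t / N, where the residue of p^b s modulo q^i - 1 is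
    (q^i - 1)/N times that of p^b t modulo N. *)
Lemma orbit_term_val i (t : T) : (0 < i)%N -> [forall l : 'I_n, (N %| q1 i * t l)%N] ->
  orbit_term i t != 0 /\
  v (orbit_term i t) = \sum_(b < logn p q * i) (vsize (vscale N_gt0 (p ^ b) t))%:R / N%:R.
Proof.
move=> i0 /forallP dt; have q1_0 := q1_gt0 (E i).
have N0 : N%:R != 0 :> R by rewrite pnatr_eq0 -lt0n.
have q1R : (q1 i)%:R != 0 :> R by rewrite pnatr_eq0 -lt0n.
have lt_s l : (q1 i * t l %/ N < q1 i)%N by rewrite ltn_divLR // ltn_mul2l q1_0 ltn_ord.
have st l := stickelberger S prim_zeta (j i) (chE i) (lt_s l).
have w0 l : wF (a l) ^+ (q1 i * t l %/ N) != 0 by rewrite expf_neq0 // (tchar_neq0 S).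
have f0 l : - g i (q1 i * t l %/ N) * wF (a l) ^+ (q1 i * t l %/ N) != 0.
  by rewrite mulf_neq0 // oppr_eq0; case: (st l).
split; first exact/prodf_neq0.
rewrite (val_prod hv) //.
have logE : logn p #|E i| = (logn p q * i)%N by rewrite cardE // lognX mulnC.
transitivity (\sum_(l < n) \sum_(b < logn p q * i) ((p ^ b * t l %% N)%N%:R / N%:R : R)).
  apply: eq_bigr => l _; have [g0 vg] := st l.
  rewrite (valM hv) ?oppr_eq0 // (valN hv) vg (valX hv) ?(tchar_neq0 S) //.
  rewrite (val_tchar S) // mul0rn addr0 /frac_sum -(card_pchar (chE i)) logE.
  rewrite natr_sum mulr_suml; apply: eq_bigr => b _.
  apply/eqP; rewrite eqr_div // -!natrM; apply/eqP; congr _%:R.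
  rewrite !muln_modl -mulnA divnK // [(q1 i * N)%N]mulnC.
  by rewrite [(q1 i * t l)%N]mulnC mulnA.
rewrite exchange_big /=; apply: eq_bigr => b _.
rewrite /vsize natr_sum -mulr_suml; congr (_ / _).
by apply: eq_bigr => l _; rewrite ffunE.
Qed.

End Family.

(** * Logarithmic derivatives *)

Section LogDerivative.

Variable K : fieldType.
Hypothesis natr_neq0 : forall n, (0 < n)%N -> n%:R != 0 :> K.

Lemma dvdXnP m (P : {poly K}) :
  reflect (forall i, (i < m)%N -> P`_i = 0) ('X^m %| P).
Proof.
apply: (iffP idP) => [/dvdpP[Q ->] i lt_im|h]; first by rewrite coefMXn lt_im.
apply/dvdpP; exists (\poly_(i < size P) P`_(i + m)).
apply/polyP => i; rewrite coefMXn; case: ltnP => [/h //|le_mi].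
rewrite coef_poly subnK //; case: ltnP => // le_i.
by rewrite nth_default // (leq_trans le_i) // leq_subr.
Qed.

(** States that X B'/B has coefficients s up to degree m, cleared of the denominator B. *)
Definition logder (m : nat) (B : {poly K}) (s : nat -> K) : Prop :=
  'X^(m.+1) %| 'X * B^`() - (\poly_(i < m.+1) s i) * B.

Lemma coef_Xderiv (B : {poly K}) i : ('X * B^`())`_i = i%:R * B`_i.
Proof.
rewrite coefXM; case: i => [|i] /=; first by rewrite mul0r.
by rewrite coef_deriv mulr_natl.
Qed.

Lemma logderP m B s :
  logder m B s <-> forall i, (i <= m)%N -> i%:R * B`_i = \sum_(l < i.+1) s l * B`_(i - l).
Proof.
have e i : (i <= m)%N -> ('X * B^`() - (\poly_(i < m.+1) s i) * B)`_i =
    i%:R * B`_i - \sum_(l < i.+1) s l * B`_(i - l).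
  move=> le_i; rewrite coefB coef_Xderiv coefM; congr (_ - _).
  apply: eq_bigr => l _; rewrite coef_poly ifT // ltnS (leq_trans _ le_i) //.
  by rewrite -ltnS.
split=> [/dvdXnP h i le_i|h].
  by apply/eqP; rewrite -subr_eq0 -e // h.
by apply/dvdXnP => i; rewrite ltnS => le_i; rewrite e // h // subrr.
Qed.

Lemma logder_leq m m' B s : (m' <= m)%N -> logder m B s -> logder m' B s.
Proof.
move=> le_m /logderP h; apply/logderP => i le_i; apply: h.
exact: leq_trans le_m.
Qed.

Lemma eq_logder m B s s' : (forall i, (i <= m)%N -> s i = s' i) ->
  logder m B s -> logder m B s'.
Proof.
move=> e; rewrite /logder; suff -> : \poly_(i < m.+1) s i = \poly_(i < m.+1) s' i by [].
by apply/polyP => i; rewrite !coef_poly; case: ltnP => //; rewrite ltnS => /e.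
Qed.

Lemma logder1 m : logder m 1 (fun=> 0).
Proof.
by apply/logderP => i _; rewrite coef1 big1 => [|l _]; rewrite ?mul0r //;
  case: i => [|i]; rewrite ?mul0r ?mulr0.
Qed.

Lemma logderM m B1 B2 s1 s2 : logder m B1 s1 -> logder m B2 s2 ->
  logder m (B1 * B2) (fun i => s1 i + s2 i).
Proof.
rewrite /logder => h1 h2.
have -> : \poly_(i < m.+1) (s1 i + s2 i) = \poly_(i < m.+1) s1 i + \poly_(i < m.+1) s2 i.
  by apply/polyP => i; rewrite coefD !coef_poly; case: ifP => //; rewrite addr0.
set P1 := \poly_(i < _) s1 i in h1 *; set P2 := \poly_(i < _) s2 i in h2 *.
have -> : 'X * (B1 * B2)^`() - (P1 + P2) * (B1 * B2) =
    ('X * B1^`() - P1 * B1) * B2 + ('X * B2^`() - P2 * B2) * B1.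
  by rewrite derivM; ring.
by rewrite dvdp_add ?dvdp_mulr.
Qed.

Lemma logder_prod (I : eqType) (r : seq I) (B : I -> {poly K}) (s : I -> nat -> K) m :
  (forall i, i \in r -> logder m (B i) (s i)) ->
  logder m (\prod_(i <- r) B i) (fun l => \sum_(i <- r) s i l).
Proof.
elim: r => [|x r IHr] h.
  apply: (@eq_logder _ _ (fun=> 0)) => [l _|]; first by rewrite big_nil.
  by rewrite big_nil; exact: logder1.
rewrite big_cons.
apply: (@eq_logder _ _ (fun l => s x l + \sum_(i <- r) s i l)) => [l _|].
  by rewrite big_cons.
apply: logderM; first by apply: h; rewrite mem_head.
by apply: IHr => i ir; apply: h; rewrite inE ir orbT.
Qed.

(** The geometric series of -d c X^d / (1 - c X^d). *)
Lemma logder_cyclotomic m d (c : K) : (0 < d)%N ->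
  logder m (1 - c *: 'X^d)
    (fun i => if (0 < i)%N && (d %| i)%N then - (d%:R * c ^+ (i %/ d)) else 0).
Proof.
move=> d0; set s := fun i : nat => _.
have s0 : s 0%N = 0 by [].
apply/logderP => i _.
have coefB l : (1 - c *: 'X^d)`_l = (l == 0%N)%:R - c * (l == d)%:R.
  by rewrite coefB coef1 coefZ coefXn.
have coef0B : (1 - c *: 'X^d)`_0 = 1.
  by rewrite coefB [(0 == d)%N]ltn_eqF //= mulr0 subr0.
have coefdB : (1 - c *: 'X^d)`_d = - c.
  by rewrite coefB eqxx [(d == 0)%N]gtn_eqF //= mulr1 sub0r.
have coefnB l : l != 0%N -> l != d -> (1 - c *: 'X^d)`_l = 0.
  by move=> l0 ld; rewrite coefB (negbTE l0) (negbTE ld) mulr0 subr0.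
have [lt_id|le_di] := ltnP i d.
  rewrite big1 => [|l _]; last first.
    rewrite /s; case: ifP => [/andP[l0 /(dvdn_leq l0)]|]; rewrite ?mul0r //.
    by have := ltn_ord l; rewrite ltnS; lia.
  case: (posnP i) => [->|i0]; first by rewrite mul0r.
  by rewrite coefnB ?mulr0 -?lt0n // ltn_eqF.
have i0 : (0 < i)%N by apply: leq_trans le_di.
rewrite big_ord_recr /= subnn coef0B mulr1.
have lt_l : (i - d < i)%N by lia.
rewrite (bigD1 (Ordinal lt_l)) //= subKn // coefdB big1 ?addr0 => [|l]; last first.
  rewrite -val_eqE /= => nl; have lt_li := ltn_ord l.
  rewrite coefnB ?mulr0 -?lt0n ?subn_gt0 //.
  by apply: contra nl => /eqP e; apply/eqP; lia.
rewrite /s subn_gt0 i0 /= dvdn_subl //.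
have [di|ndi] := boolP (d %| i)%N; last first.
  rewrite andbF mul0r addr0 coefnB ?mulr0 -?lt0n //.
  by apply: contraNneq ndi => ->.
have [j ej] : exists j, i = (j.+1 * d)%N.
  by case/dvdnP: di => -[|j] e; [rewrite e in i0|exists j].
rewrite ej mulnK // mulSn addKn -mulSn andbT.
case: j {ej} => [|j].
  by rewrite !mul1n ltnn mul0r add0r expr1 coefdB mulrN.
rewrite mulnK // ltn_Pmull // coefnB.
- by rewrite mulr0 [c ^+ j.+2]exprS mulrN mulNr opprK [c * _]mulrC mulrA subrr.
- by rewrite -lt0n muln_gt0 d0.
- by rewrite -{2}[d]mul1n eqn_mul2r gtn_eqF.
Qed.

(** As s vanishes at 0, the recursion of [logderP] expresses i B_i by lower coefficients, and i is
    invertible. *)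
Lemma logder_unique m (B B' : {poly K}) s : s 0%N = 0 -> B`_0 = B'`_0 ->
  logder m B s -> logder m B' s -> forall i, (i <= m)%N -> B`_i = B'`_i.
Proof.
move=> s0 e0 /logderP h /logderP h' i.
have [r] := ubnP i; elim: r i => // r IHr [//|i]; rewrite ltnS => lt_i le_i.
apply: (mulfI (natr_neq0 (ltn0Sn i))); rewrite h // h' //.
rewrite [LHS]big_ord_recl [RHS]big_ord_recl s0 !mul0r !add0r; apply: eq_bigr => l _.
rewrite IHr //=; rewrite /bump /= add1n subSS.
  by apply: leq_ltn_trans lt_i; rewrite leq_subr.
by apply: leq_trans le_i; apply: leq_trans (leq_subr _ _) _.
Qed.

Definition exp_trunc m (C : {poly K}) : {poly K} :=
  \sum_(l < m.+1) (l`!%:R)^-1 *: C ^+ l.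

(** The derivative of the truncated exponential lacks only the top term C^m / m!, divisible by X^m;
    the factor X in X B' pushes the error to X^(m+1). *)
Lemma logder_exp m (C : {poly K}) : C`_0 = 0 ->
  logder m (exp_trunc m C) (fun i => i%:R * C`_i).
Proof.
move=> C0; have XC : 'X %| C.
  by rewrite -['X]expr1; apply/dvdXnP => -[|].
have dE : (exp_trunc m C)^`() = C^`() * (exp_trunc m C - (m`!%:R)^-1 *: C ^+ m).
  rewrite /exp_trunc [in RHS]big_ord_recr /= addrK linear_sum /= big_ord_recl /=.
  rewrite derivZ expr0 derivC scaler0 add0r mulr_sumr.
  apply: eq_bigr => l _; rewrite derivZ deriv_exp /= factS natrM invfM.
  rewrite -scaler_nat scalerA mulrAC mulVf ?mul1r ?natr_neq0 //.
  by rewrite scalerAr.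
have XmC : 'X^m %| C ^+ m by apply: dvdp_exp2r.
have DE : \poly_(i < m.+1) (i%:R * C`_i) = 'X * C^`() - 'X^(m.+1) * \poly_(i < size C) ('X * C^`())`_(i + m.+1).
  apply/polyP => i; rewrite coefB coef_poly coefXnM coef_Xderiv.
  case: ltnP => [_|le_i]; first by rewrite subr0.
  rewrite coef_poly subnK // coef_Xderiv; case: ltnP => [_|le_i']; first by rewrite subrr.
  by rewrite nth_default ?mulr0 ?subr0 // (leq_trans le_i') // leq_subr.
rewrite /logder DE dE; set Y := \poly_(i < _) _; set e := exp_trunc m C.
have -> : 'X * (C^`() * (e - (m`!%:R)^-1 *: C ^+ m)) - ('X * C^`() - 'X^(m.+1) * Y) * e
    = 'X^(m.+1) * (Y * e) - (m`!%:R)^-1%:P * ('X * C ^+ m * C^`()).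
  by rewrite -mul_polyC; ring.
apply: dvdp_sub; first exact: dvdp_mulr.
by apply: dvdp_mull; apply: dvdp_mulr; rewrite exprS dvdp_mul.
Qed.

Lemma exp_trunc0 m (C : {poly K}) : C`_0 = 0 -> (exp_trunc m C)`_0 = 1.
Proof.
move=> C0; rewrite coef_sum big_ord_recl big1 => [|l _].
  by rewrite coefZ expr0 coef1 fact0 invr1 mulr1 addr0.
by rewrite coefZ -horner_coef0 horner_exp horner_coef0 C0 expr0n mulr0.
Qed.

Lemma logder_fps_exp (c : nat -> K) (B : {poly K}) m : c 0%N = 0 -> B`_0 = 1 ->
  logder m B (fun i => i%:R * c i) -> forall i, (i <= m)%N -> fps_exp c i = B`_i.
Proof.
move=> c0 B0 hB i le_i.
have C0 : (fps_trunc i c)`_0 = 0 by rewrite coef_poly c0.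
have -> : fps_exp c i = (exp_trunc i (fps_trunc i c))`_i by [].
apply: (@logder_unique i _ _ (fun l => l%:R * c l)) => //.
- by rewrite mul0r.
- by rewrite exp_trunc0.
- apply: eq_logder (logder_exp i C0) => l le_l.
  by rewrite coef_poly ltnS le_l.
- exact: logder_leq hB.
Qed.

(** Logarithmic derivatives add, so that of exp(c) B is zero and B inverts exp(c) modulo X^(m+1). *)
Lemma logder_fps_inv (c : nat -> K) (B : {poly K}) m : c 0%N = 0 -> B`_0 = 1 ->
  logder m B (fun i => - (i%:R * c i)) -> fps_inv (fps_exp c) m = B`_m.
Proof.
move=> c0 B0 hB.
have C0 : (fps_trunc m c)`_0 = 0 by rewrite coef_poly c0.
have [Em Em0 hE] : exists2 E : {poly K}, E`_0 = 1 & logder m E (fun l => l%:R * c l).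
  exists (exp_trunc m (fps_trunc m c)); first exact: exp_trunc0.
  apply: eq_logder (logder_exp m C0) => l le_l.
  by rewrite coef_poly ltnS le_l.
set U := fps_trunc m (fps_exp c).
have UE : 'X^(m.+1) %| U - Em.
  apply/dvdXnP => i lt_i; rewrite coefB coef_poly lt_i.
  by rewrite (logder_fps_exp c0 Em0 hE) // subrr.
have EB : 'X^(m.+1) %| Em * B - 1.
  apply/dvdXnP => i lt_i; rewrite coefB; apply/eqP; rewrite subr_eq0; apply/eqP.
  apply: (@logder_unique m _ _ (fun=> 0)) => //.
  - by rewrite coef0M Em0 B0 coef1 mulr1.
  - by apply: eq_logder (logderM hE hB) => l _; rewrite subrr.
  - exact: logder1.
have UB : 'X^(m.+1) %| U * B - 1.
  have -> : U * B - 1 = (U - Em) * B + (Em * B - 1) by ring.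
  by rewrite dvdp_add // dvdp_mulr.
(* The geometric series behind [fps_inv]: it too inverts U modulo X^(m+1), because X divides 1 - U,
   and inverses are unique. *)
pose G := \sum_(l < m.+1) (1 - U) ^+ l.
have UG : 'X^(m.+1) %| U * G - 1.
  have -> : U * G - 1 = - (1 - U) ^+ m.+1.
    have := subrX1 (1 - U) m.+1; rewrite -/G => e.
    have -> : U * G = - ((1 - U - 1) * G) by ring.
    by rewrite -e; ring.
  rewrite dvdpNr; apply: dvdp_exp2r.
  rewrite -['X]expr1; apply/dvdXnP => -[|//] _.
  by rewrite coefB coef1 coef_poly /= (logder_fps_exp c0 Em0 hE) // Em0 subrr.
have : 'X^(m.+1) %| G - B.
  have -> : G - B = (U * G - 1) * B - (U * B - 1) * G by ring.
  by rewrite dvdp_sub // dvdp_mulr.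
move/dvdXnP => /(_ m (ltnSn m)) /eqP; rewrite coefB subr_eq0 => /eqP.
by [].
Qed.

End LogDerivative.

(** * Newton polygons *)

Section LegendreMin.

Variables (R : realType) (nz : nat -> Prop) (y : nat -> R).

(** A relation rather than a function, so that no minimum over a possibly infinite support has to be
    constructed. *)
Definition legendre_min (tau mu : R) : Prop :=
  (forall i, nz i -> mu <= y i - tau * i%:R) /\
  exists2 i, nz i & y i - tau * i%:R = mu.

End LegendreMin.

Section GaussNorm.

Variables (R : realType) (K : fieldType) (v : K -> R).
Hypothesis hv : is_valuation v.
Variable tau : R.

Definition gauss_min (B : {poly K}) (mu : R) : Prop :=
  legendre_min (fun i => B`_i != 0) (fun i => v B`_i) tau mu.

Lemma gauss_min_first B mu : gauss_min B mu ->
  exists i0, [/\ B`_i0 != 0, v B`_i0 = mu + tau * i0%:R,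
    forall i, vge v (mu + tau * i%:R) B`_i &
    forall i, (i < i0)%N -> vgt v (mu + tau * i%:R) B`_i].
Proof.
move=> [ge_mu [i1 nz1 e1]].
have geB i : vge v (mu + tau * i%:R) B`_i.
  by have [->|Bi] := eqVneq B`_i 0; [exact: vge_0|rewrite vge_neq0 // -lerBrDr ge_mu].
have ex0 : exists i, (B`_i != 0) && (v B`_i == mu + tau * i%:R).
  by exists i1; rewrite nz1 /= -e1 subrK.
case: (ex_minnP ex0) => i0 /andP[nz0 /eqP e0] min0.
exists i0; split=> // i lt_i; have [->|Bi] := eqVneq B`_i 0; first exact: vgt_0.
rewrite vgt_neq0 // lt_neqAle -vge_neq0 // geB andbT.
apply: contraL lt_i => /eqP e; rewrite -leqNgt; apply: min0.
by rewrite Bi -e eqxx.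
Qed.

(** Gauss's lemma. If i0 and j0 are the first indices where the two minima are attained, their
    product is the strictly dominant term of the coefficient of index i0 + j0. *)
Lemma gauss_minM B1 B2 mu1 mu2 : gauss_min B1 mu1 -> gauss_min B2 mu2 ->
  gauss_min (B1 * B2) (mu1 + mu2).
Proof.
move=> /gauss_min_first[i0 [nzi ei gei gti]] /gauss_min_first[j0 [nzj ej gej gtj]].
have splitE i (l : 'I_i.+1) : mu1 + mu2 + tau * i%:R =
    (mu1 + tau * l%:R) + (mu2 + tau * (i - l)%:R).
  by rewrite natrB -1?ltnS //; ring.
have geP i : vge v (mu1 + mu2 + tau * i%:R) (B1 * B2)`_i.
  rewrite coefM; apply: vge_sum => // l _; rewrite (splitE i l).
  exact: vgeM.
split=> [i nz|]; first by rewrite lerBrDr -vge_neq0.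
have lt_i0 : (i0 < (i0 + j0).+1)%N by rewrite ltnS leq_addr.
have t0 : B1`_i0 * B2`_j0 != 0 by rewrite mulf_neq0.
have vt0 : v (B1`_i0 * B2`_j0) = mu1 + mu2 + tau * (i0 + j0)%:R.
  by rewrite (valM hv) // ei ej natrD; ring.
have coefE : (B1 * B2)`_(i0 + j0) = B1`_i0 * B2`_j0 +
   \sum_(l < (i0 + j0).+1 | l != Ordinal lt_i0) B1`_l * B2`_(i0 + j0 - l).
  by rewrite coefM (bigD1 (Ordinal lt_i0)) //= addKn.
have rest : vgt v (v (B1`_i0 * B2`_j0))
    (\sum_(l < (i0 + j0).+1 | l != Ordinal lt_i0) B1`_l * B2`_(i0 + j0 - l)).
  apply: vgt_sum => // l nl; rewrite vt0 (splitE _ l).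
  have [lt_l|gt_l|e] := ltngtP l i0; last by case/eqP: nl; apply: val_inj.
    by apply: vgtM => //; apply: gti.
  rewrite addrC [B1`_l * _]mulrC; apply: vgtM => //; apply: gtj.
  by have := ltn_ord l; lia.
have [nz0 v0] := val_dominant hv t0 rest.
exists (i0 + j0)%N; rewrite coefE // v0 vt0.
by ring.
Qed.

Lemma gauss_min1 : gauss_min 1 0.
Proof.
split=> [i|]; last by exists 0%N; rewrite ?coef1 ?oner_eq0 // (val1 hv) mulr0 subrr.
by rewrite coef1; case: i => [|i] /=; rewrite ?eqxx // => _; rewrite (val1 hv) mulr0 subrr.
Qed.

Lemma gauss_min_prod (I : Type) (r : seq I) (B : I -> {poly K}) (mu : I -> R) :
  (forall i, gauss_min (B i) (mu i)) ->
  gauss_min (\prod_(i <- r) B i) (\sum_(i <- r) mu i).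
Proof.
move=> h; apply: (big_rec2 gauss_min); first exact: gauss_min1.
by move=> i B' mu' _; apply: gauss_minM.
Qed.

Lemma gauss_min_cyclotomic (c : K) d : (0 < d)%N -> c != 0 ->
  gauss_min (1 - c *: 'X^d) (Num.min 0 (v c - tau * d%:R)).
Proof.
move=> d0 c0.
have coefB l : (1 - c *: 'X^d)`_l = (l == 0%N)%:R - c * (l == d)%:R.
  by rewrite coefB coef1 coefZ coefXn.
have coef0B : (1 - c *: 'X^d)`_0 = 1.
  by rewrite coefB [(0 == d)%N]ltn_eqF //= mulr0 subr0.
have coefdB : (1 - c *: 'X^d)`_d = - c.
  by rewrite coefB eqxx [(d == 0)%N]gtn_eqF //= mulr1 sub0r.
have coefnB l : l != 0%N -> l != d -> (1 - c *: 'X^d)`_l = 0.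
  by move=> l0 ld; rewrite coefB (negbTE l0) (negbTE ld) mulr0 subr0.
split=> [i|].
  have [->|i0] := eqVneq i 0%N; first by rewrite coef0B (val1 hv) mulr0 subr0 ge_min lexx.
  have [->|id] := eqVneq i d; first by rewrite coefdB (valN hv) ge_min lexx orbT.
  by rewrite coefnB ?eqxx.
case: leP => _; first by exists 0%N; rewrite coef0B ?oner_eq0 // (val1 hv) mulr0 subr0.
by exists d; rewrite coefdB ?oppr_eq0 // (valN hv).
Qed.

End GaussNorm.

Section Polygon.

Variables (R : realType) (nz : nat -> Prop) (y : nat -> R).
Local Open Scope classical_set_scope.
Let A : set (R * R) := [set (i%:R, y i) | i in [set i | nz i]].

Variables (T : finType) (D Kmax : nat) (kk : T -> nat).
Hypotheses (D_gt0 : (0 < D)%N) (kk_le : forall t, (kk t <= Kmax)%N).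

Definition slope t : R := (kk t)%:R / D%:R.
(** Vertices are indexed by the slope level m, as in HP(Delta); vertices m and m + 1 coincide when
    no slope equals m / D. *)
Definition polygon_vertex m : R * R :=
  ((\sum_(t | (kk t < m)%N) 1)%:R, \sum_(t | (kk t < m)%N) slope t).
Definition polygon : set (R * R) :=
  [set P | exists2 m, (m <= Kmax)%N &
     segment (polygon_vertex m) (polygon_vertex m.+1) P].
(** The minimum of y - tau x on the polygon: exactly the edges of slope below tau decrease this
    function. *)
Definition slope_transform (tau : R) : R := \sum_t Num.min 0 (slope t - tau).

Local Notation V := polygon_vertex.
Local Notation phi := slope_transform.

Lemma polygon_vertexE m tau :
  (V m).2 - tau * (V m).1 = \sum_(t | (kk t < m)%N) (slope t - tau).
Proof.
by rewrite sumrB /= natr_sum mulr_sumr; congr (_ - _); apply: eq_bigr => t _; rewrite mulr1.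
Qed.

Lemma polygon_vertex_ge m tau : phi tau <= (V m).2 - tau * (V m).1.
Proof.
rewrite polygon_vertexE [leRHS]big_mkcond /=; apply: ler_sum => t _.
by case: ifP => _; rewrite ge_min lexx ?orbT.
Qed.

Lemma polygon_vertex_eq m tau :
  (forall t, (kk t < m)%N -> slope t <= tau) ->
  (forall t, (m <= kk t)%N -> tau <= slope t) ->
  (V m).2 - tau * (V m).1 = phi tau.
Proof.
move=> h1 h2; rewrite polygon_vertexE [LHS]big_mkcond /=; apply: eq_bigr => t _.
case: ltnP => [/h1 h|/h2 h]; last by rewrite min_l // subr_ge0.
by rewrite min_r // subr_le0.
Qed.

Lemma slope_lt m t : (slope t < m%:R / D%:R) = (kk t < m)%N.
Proof. by rewrite /slope ltr_pM2r ?ltr_nat // invr_gt0 ltr0n. Qed.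

Lemma slope_le m t : (m%:R / D%:R <= slope t) = (m <= kk t)%N.
Proof. by rewrite /slope ler_pM2r ?ler_nat // invr_gt0 ltr0n. Qed.

Lemma polygon_vertex_in m : (m <= Kmax.+1)%N -> polygon (V m).
Proof.
rewrite leq_eqVlt => /orP[/eqP ->|le_m].
  exists Kmax => //; exists 1; first by rewrite /= ler01 lexx.
  by rewrite subrr !mul0r !mul1r !add0r; case: (V _).
exists m; first by rewrite -ltnS.
exists 0; first by rewrite /= ler01 lexx.
by rewrite subr0 !mul0r !mul1r !addr0; case: (V m).
Qed.

Lemma polygon_ge P tau : polygon P -> phi tau <= P.2 - tau * P.1.
Proof.
move=> [m _ [t /andP[t0 t1] <-]].
have h1 := polygon_vertex_ge m tau; have h2 := polygon_vertex_ge m.+1 tau.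
move: (V m) (V m.+1) h1 h2 => [x1 y1] [x2 y2] /= h1 h2.
apply: (@le_trans _ _ ((1 - t) * (y1 - tau * x1) + t * (y2 - tau * x2))); last first.
  by rewrite le_eqVlt; apply/orP; left; apply/eqP => /=; ring.
rewrite [leLHS](_ : _ = (1 - t) * phi tau + t * phi tau); last by ring.
by apply: lerD; apply: ler_wpM2l => //; rewrite subr_ge0.
Qed.

Lemma polygon_attained tau : exists2 P, polygon P & P.2 - tau * P.1 = phi tau.
Proof.
have exm : exists m, (tau <= m%:R / D%:R) || (m == Kmax.+1) by exists Kmax.+1; rewrite eqxx orbT.
have min_m := ex_minnP exm; case: min_m => m hm minm.
have le_m : (m <= Kmax.+1)%N by apply: minm; rewrite eqxx orbT.
exists (V m); first exact: polygon_vertex_in.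
apply: polygon_vertex_eq => t ht.
  rewrite leNgt; apply: contraL ht => h; rewrite -leqNgt; apply: minm.
  by rewrite (ltW h).
case/orP: hm => [h|/eqP e]; first by apply: le_trans h _; rewrite slope_le.
by have := kk_le t; rewrite leqNgt -ltnS -e ltnS ht.
Qed.

Lemma convex_hull_ge P tau mu : (forall i, nz i -> mu <= y i - tau * i%:R) ->
  convex_hull A P -> mu <= P.2 - tau * P.1.
Proof.
move=> h [N [Q [t [AQ t0 t1 ->]]]] /=.
rewrite mulr_sumr -sumrB -[mu]mul1r -t1 mulr_suml; apply: ler_sum => i _.
have [l nzl <-] := AQ i => /=.
have -> : t i * y l - tau * (t i * l%:R) = t i * (y l - tau * l%:R) by ring.
by apply: ler_wpM2l => //; exact: h.
Qed.

Lemma convex_hull_sub P : A P -> convex_hull A P.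
Proof.
move=> AP; exists 1%N, (fun=> P), (fun=> 1); split=> //; rewrite ?big_ord1 //.
by rewrite !mul1r; case: P AP.
Qed.

(** The polygon attains its minimum at a point of the hull, and the minimizing coefficient gives a
    point of the lower hull; each minimum therefore bounds the other. *)
Lemma lower_hull_eq_polygon_transform : lower_hull A = polygon ->
  forall tau mu, legendre_min nz y tau mu -> mu = phi tau.
Proof.
move=> e tau mu [ge_mu [i nzi ei]]; apply/eqP; rewrite eq_le; apply/andP; split.
  have [P hP <-] := polygon_attained tau; rewrite -e in hP.
  by case: hP => hP _; apply: convex_hull_ge hP.
have : polygon (i%:R, y i).
  rewrite -e; split; first by apply: convex_hull_sub; exists i.
  move=> y' /= hy'; have := convex_hull_ge ge_mu hy'; rewrite /= -ei.
  by rewrite lerD2r.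
by move/(polygon_ge tau); rewrite /= ei.
Qed.

Hypothesis transform : forall tau, legendre_min nz y tau (phi tau).

(** Around [tau], halfway between the levels m - 1 and m, the transform is affine within distance
    [eps], with derivative minus the abscissa of V m. An index attaining the minimum at [tau] and
    obeying the inequality at both ends must equal that abscissa. *)
Lemma polygon_vertex_hull m : A (V m).
Proof.
have DR : 0 < D%:R :> R by rewrite ltr0n.
pose tau : R := (m%:R - 2^-1) / D%:R.
have [_ [i nzi ei]] := transform tau.
pose eps : R := 2^-1 / D%:R.
have eps0 : 0 < eps by rewrite divr_gt0 ?invr_gt0 ?ltr0n.
have tauS : tau + eps = m%:R / D%:R by rewrite /tau /eps -mulrDl subrK.
have slope_pred t : (kk t < m)%N -> slope t <= tau - eps.
  move=> lt_t; have -> : tau - eps = (m%:R - 1) / D%:R by rewrite /tau /eps -mulrBl; congr (_ / _); lra.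
  rewrite /slope ler_pM2r ?invr_gt0 // lerBrDr natr1 ler_nat //.
have eq_phi s : `|s| <= 1 -> phi (tau + s * eps) = (V m).2 - (tau + s * eps) * (V m).1.
  rewrite ler_norml => /andP[s1 s2].
  apply/esym/polygon_vertex_eq => t ht.
    apply: le_trans (slope_pred t ht) _; nra.
  apply: (@le_trans _ _ (tau + eps)); first by nra.
  by rewrite tauS slope_le.
have e0 : phi tau = (V m).2 - tau * (V m).1.
  by have := eq_phi 0; rewrite normr0 mul0r addr0 ler01 => ->.
have [ge1 _] := transform (tau + 1 * eps); have [ge2 _] := transform (tau + (-1) * eps).
have := ge1 i nzi; have := ge2 i nzi; rewrite !eq_phi ?normrN1 ?normr1 //.
move: ei; rewrite e0; move: (V m) => [x1 y1] /= ei h2 h1.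
have ex : i%:R = x1.
  have h1' : eps * (i%:R - x1) <= 0 by lra.
  have h2' : 0 <= eps * (i%:R - x1) by lra.
  have /eqP : eps * (i%:R - x1) = 0 by apply/eqP; rewrite eq_le h1'.
  by rewrite mulf_eq0 gt_eqF //= subr_eq0 => /eqP.
by exists i => //=; rewrite ex; congr (_, _); move: ei; rewrite ex; lra.
Qed.

Lemma convex_hull_convex P Q t : convex_hull A P -> convex_hull A Q -> 0 <= t <= 1 ->
  convex_hull A ((1 - t) * P.1 + t * Q.1, (1 - t) * P.2 + t * Q.2).
Proof.
move=> [N1 [Q1 [t1 [A1 p1 s1 ->]]]] [N2 [Q2 [t2 [A2 p2 s2 ->]]]] /andP[t0 tle] /=.
pose Q3 (i : 'I_(N1 + N2)) := match fintype.split i with inl l => Q1 l | inr l => Q2 l end.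
pose t3 (i : 'I_(N1 + N2)) := match fintype.split i with inl l => (1 - t) * t1 l | inr l => t * t2 l end.
have Q3l l : Q3 (lshift N2 l) = Q1 l by rewrite /Q3 (unsplitK (inl l)).
have Q3r l : Q3 (rshift N1 l) = Q2 l by rewrite /Q3 (unsplitK (inr l)).
have t3l l : t3 (lshift N2 l) = (1 - t) * t1 l by rewrite /t3 (unsplitK (inl l)).
have t3r l : t3 (rshift N1 l) = t * t2 l by rewrite /t3 (unsplitK (inr l)).
exists (N1 + N2)%N, Q3, t3; split.
- by move=> i; rewrite /Q3; case: fintype.split => l.
- move=> i; rewrite /t3; case: fintype.split => l; rewrite mulr_ge0 //.
  by rewrite subr_ge0.
- rewrite big_split_ord /=; under eq_bigr do rewrite t3l.
  under [X in _ + X]eq_bigr do rewrite t3r.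
  by rewrite -!mulr_sumr s1 s2 !mulr1 subrK.
- rewrite !big_split_ord /= !mulr_sumr.
  by congr (_ + _, _ + _); apply: eq_bigr => l _; rewrite ?Q3l ?Q3r ?t3l ?t3r mulrA.
Qed.

(** The edge from V m to V m.+1 lies on the supporting line of slope m / D. *)
Lemma polygon_sub_lower_hull P : polygon P -> lower_hull A P.
Proof.
move=> hP; have [m le_m [t t01 eP]] := hP.
have V1 := convex_hull_sub (polygon_vertex_hull m).
have V2 := convex_hull_sub (polygon_vertex_hull m.+1).
split; first by rewrite -eP; apply: convex_hull_convex.
pose tau : R := m%:R / D%:R.
have e1 : (V m).2 - tau * (V m).1 = phi tau.
  by apply: polygon_vertex_eq => l hl; rewrite /tau ?slope_le // ltW // slope_lt.
have e2 : (V m.+1).2 - tau * (V m.+1).1 = phi tau.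
  apply: polygon_vertex_eq => l hl; rewrite /tau ?slope_le //; last exact: ltnW.
  by rewrite /slope ler_pM2r ?ler_nat // invr_gt0 ltr0n.
have eP' : P.2 - tau * P.1 = phi tau.
  move: (phi tau) e1 e2 => f; rewrite -eP; move: (V m) (V m.+1) => [x1 y1] [x2 y2] /= e1 e2.
  transitivity ((1 - t) * (y1 - tau * x1) + t * (y2 - tau * x2)); first by ring.
  by rewrite e1 e2; ring.
move=> z hz; have [ge _] := transform tau.
by have := convex_hull_ge ge hz; rewrite /= -eP' lerD2r.
Qed.

(** For tau above all slopes the transform is the sum of the slopes minus tau #|T|; an index beyond
    #|T| would go below it once tau also exceeds |y i|. *)
Lemma support_le i : nz i -> (i <= #|T|)%N.
Proof.
move=> nzi; rewrite leqNgt; apply/negP => lt_i.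
pose tau : R := `|y i| + Kmax%:R / D%:R + 1.
have slope_bound t : 0 <= slope t /\ slope t <= tau.
  have h : slope t <= Kmax%:R / D%:R by rewrite /slope ler_pM2r ?ler_nat // invr_gt0 ltr0n.
  by split; [rewrite /slope divr_ge0|have := normr_ge0 (y i); rewrite /tau; lra].
have phiE : phi tau = \sum_t slope t - tau * #|T|%:R.
  rewrite /slope_transform (eq_bigr (fun t => slope t - tau)) => [|t _].
    by rewrite sumrB sumr_const mulr_natr.
  by rewrite min_r // subr_le0; case: (slope_bound t).
have [ge _] := transform tau; have := ge i nzi; rewrite phiE.
have s0 : 0 <= \sum_t slope t by apply: sumr_ge0 => t _; case: (slope_bound t).
have i1 : #|T|%:R + 1 <= i%:R :> R by rewrite natr1 ler_nat.
have k0 : 0 <= Kmax%:R / D%:R :> R by rewrite divr_ge0.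
have n0 := normr_ge0 (y i); have n1 := ler_norm (y i).
have tau1 : `|y i| + 1 <= tau by rewrite /tau; lra.
have : tau * (#|T|%:R + 1) <= tau * i%:R by apply: ler_wpM2l => //; lra.
by rewrite mulrDr mulr1; lra.
Qed.

(** A lower hull has at most one point on each vertical line, so it is enough that the polygon,
    already contained in it, covers all abscissas from 0 to #|T|. *)
Theorem lower_hull_polygon : lower_hull A = polygon.
Proof.
apply/seteqP; split; last exact: polygon_sub_lower_hull.
move=> P [hP minP].
suff [P' hP' e1] : exists2 P', polygon P' & P'.1 = P.1.
  have [hP'1 minP'] := polygon_sub_lower_hull hP'.
  have e2 : P.2 = P'.2.
    apply/eqP; rewrite eq_le minP' ?e1; last by case: (P) hP.
    by rewrite minP // -e1; case: (P') hP'1.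
  by rewrite (surjective_pairing P) -e1 e2 -surjective_pairing.
have [P1_ge P1_le] : 0 <= P.1 /\ P.1 <= #|T|%:R.
  have [N [Q [t [AQ t0 t1 ->]]]] := hP; split => /=.
    by apply: sumr_ge0 => i _; have [l _ <-] := AQ i; rewrite mulr_ge0 //= ler0n.
  rewrite [leRHS](_ : _ = (\sum_i t i) * #|T|%:R); last by rewrite t1 mul1r.
  rewrite mulr_suml; apply: ler_sum => i _.
  by have [l nzl <-] := AQ i; apply: ler_wpM2l => //=; rewrite ler_nat; exact: support_le.
have V0 : (V 0).1 = 0 by rewrite /= big_pred0.
have VK : (V Kmax.+1).1 = #|T|%:R.
  by rewrite /= -sum1_card; congr _%:R; apply: eq_bigl => t; rewrite ltnS kk_le.
have exm : exists m, P.1 <= (V m).1 by exists Kmax.+1; rewrite VK.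
case: (ex_minnP exm) => m hm minm.
have le_m : (m <= Kmax.+1)%N by apply: minm; rewrite VK.
case: m hm minm le_m => [|m] hm minm le_m.
  exists (V 0); first exact: polygon_vertex_in.
  by apply/eqP; rewrite eq_le hm V0 P1_ge.
have lt_m : (V m).1 < P.1 by rewrite ltNge; apply/negP => /minm; rewrite ltnn.
have d0 : 0 < (V m.+1).1 - (V m).1 by rewrite subr_gt0 (lt_le_trans lt_m).
pose t := (P.1 - (V m).1) / ((V m.+1).1 - (V m).1).
have t01 : 0 <= t <= 1.
  rewrite /t divr_ge0 ?ler_pdivrMr ?mul1r ?lerD2r //=; last exact: ltW.
  by rewrite subr_ge0 ltW.
exists ((1 - t) * (V m).1 + t * (V m.+1).1, (1 - t) * (V m).2 + t * (V m.+1).2).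
  by exists m => //; exists t.
rewrite [LHS]/=; have -> : (1 - t) * (V m).1 + t * (V m.+1).1 = (V m).1 + t * ((V m.+1).1 - (V m).1) by ring.
by rewrite /t divfK ?gt_eqF // addrC subrK.
Qed.

End Polygon.

(** * Weights and the Hodge polygon *)

Section Weight.

Variables (R : realType) (n : nat) (M : 'M[int]_n).
Hypothesis hM : \det M != 0.

Let N := `|\det M|%N.

Lemma absdet_gt0 : (0 < N)%N. Proof. by rewrite absz_gt0. Qed.

Lemma intmx_to_unit (K : numFieldType) : intmx_to K M \in unitmx.
Proof. by rewrite unitmxE det_map_mx unitfE intr_eq0. Qed.

Lemma dilate_Delta (x : 'cV[R]_n) (c : R) : 0 <= c ->
  dilate c (Delta M) (intmx_to R M *m x) <->
  (forall i, 0 <= x i 0) /\ \sum_i x i 0 <= c.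
Proof.
move=> c0; have U := intmx_to_unit R; split.
  move=> [_ [t [t0 t1 ->]] e].
  have -> : x = c *: t.
    rewrite -(mulKmx U x) -e -scalemxAr mulKmx //.
  split=> [i|]; first by rewrite mxE mulr_ge0.
  under eq_bigr do rewrite mxE; rewrite -mulr_sumr.
  by rewrite -[leRHS]mulr1 ler_wpM2l.
(* The dilate by 0 is the origin alone; there x = 0, its coordinates being nonnegative with sum at
   most 0. *)
move=> [x0 x1]; have [c_eq0|c_neq0] := eqVneq c 0.
  have -> : x = 0.
    apply/matrixP => i j; rewrite ord1 mxE.
    have /eqP : \sum_i x i 0 = 0.
      by apply/eqP; rewrite eq_le sumr_ge0 // andbT; move: x1; rewrite c_eq0.
    by rewrite psumr_eq0 // => /allP /(_ i (mem_index_enum _)) /eqP.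
  exists 0; last by rewrite mulmx0 scaler0.
  exists 0; split; [by move=> i; rewrite mxE|by rewrite big1 => [|i _]; rewrite ?mxE|].
  by rewrite mulmx0.
exists (c^-1 *: (intmx_to R M *m x)); last by rewrite scalerA divff // scale1r.
have cp : 0 < c by rewrite lt_neqAle eq_sym c_neq0.
exists (c^-1 *: x); split.
- by move=> i; rewrite mxE mulr_ge0 // invr_ge0.
- under eq_bigr do rewrite mxE; rewrite -mulr_sumr mulrC.
  by rewrite ler_pdivrMr // mul1r.
- by rewrite scalemxAr.
Qed.

Lemma weight_finite (x : 'cV[R]_n) : (forall i, 0 <= x i 0) ->
  weight M (intmx_to R M *m x) = (\sum_i x i 0)%:E%E.
Proof.
move=> x0; rewrite /weight; have s0 : 0 <= \sum_i x i 0 by rewrite sumr_ge0.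
apply: xget_unique.
  exists (\sum_i x i 0) => //=; split=> //; first exact/dilate_Delta.
  by move=> c' c0' /(dilate_Delta x c0')[].
move=> _ [c [c0 /(dilate_Delta x c0)[_ h1] h2] <-] /=; congr (_%:E)%E.
apply/eqP; rewrite eq_le h1 andbT; apply: h2 => //.
exact/dilate_Delta.
Qed.

Lemma weight_infinite (x : 'cV[R]_n) : ~ (forall i, 0 <= x i 0) ->
  weight M (intmx_to R M *m x) = +oo%E.
Proof.
move=> nx0; rewrite /weight; apply: xgetPN => _ [c [c0 hc _] _].
by have [] := (dilate_Delta x c0).1 hc.
Qed.

Lemma weight_fin_inv (x : 'cV[R]_n) c : weight M (intmx_to R M *m x) = c%:E%E ->
  (forall i, 0 <= x i 0) /\ \sum_i x i 0 = c.
Proof.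
have [x0|nx0] := pselect (forall i, 0 <= x i 0); last by rewrite weight_infinite.
by rewrite weight_finite // => -[].
Qed.

Definition lattice_vector (y : 'I_n -> nat) : Prop :=
  forall i, (N%:Z %| \sum_l M i l * (y l)%:Z)%Z.

(* The lattice point u = M (y / N) of the cone spanned by the V_j. *)
Definition lattice_point (y : 'I_n -> nat) : 'cV[int]_n :=
  \col_i ((\sum_l M i l * (y l)%:Z) %/ N%:Z)%Z.

Definition frac_vector (y : 'I_n -> nat) : 'cV[R]_n := \col_i ((y i)%:R / N%:R).

Lemma lattice_pointE y : lattice_vector y ->
  intmx_to R (lattice_point y) = intmx_to R M *m frac_vector y.
Proof.
have N0 : N%:R != 0 :> R by rewrite pnatr_eq0 -lt0n absdet_gt0.
move=> ly; apply/matrixP => i j; rewrite !mxE; apply: (mulIf N0).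
transitivity ((\sum_l M i l * (y l)%:Z)%:~R : R).
  by rewrite -[N%:R]/(N%:Z%:~R) -rmorphM /= divzK.
rewrite mulr_suml rmorph_sum /=; apply: eq_bigr => l _.
by rewrite !mxE rmorphM /= mulrA divfK.
Qed.

Lemma weight_lattice_point y : lattice_vector y ->
  weight M (intmx_to R (lattice_point y)) = ((\sum_l y l)%N%:R / N%:R)%:E%E.
Proof.
move=> ly; rewrite lattice_pointE // weight_finite => [|i]; last first.
  by rewrite mxE divr_ge0.
congr (_%:E)%E; rewrite natr_sum mulr_suml; apply: eq_bigr => l _.
by rewrite mxE.
Qed.

Lemma lattice_point_surj (u : 'cV[int]_n) c : weight M (intmx_to R u) = c%:E%E ->
  exists y, [/\ lattice_vector y, u = lattice_point y & c = (\sum_l y l)%N%:R / N%:R].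
Proof.
have N0 : N%:Z != 0 by rewrite -lt0n absdet_gt0.
have NR : 0 < N%:R :> R by rewrite ltr0n absdet_gt0.
(* Cramer's rule: z = N M^(-1) u, the sign turning det M into its absolute value. *)
pose z : 'cV[int]_n := Num.sg (\det M) *: (\adj M *m u).
have Mz : M *m z = N%:Z *: u.
  rewrite /z -scalemxAr mulmxA mul_mx_adj mul_scalar_mx scalerA.
  by rewrite -normrEsg abszE.
move=> wu.
have eu : intmx_to R u = intmx_to R M *m (\col_i ((z i 0)%:~R / N%:R)).
  apply/matrixP => i j; rewrite !mxE; apply: (mulIf (lt0r_neq0 NR)).
  rewrite mulr_suml; transitivity (((M *m z) i j)%:~R : R).
    by rewrite Mz mxE rmorphM /= mulrC.
  rewrite mxE rmorph_sum /=; apply: eq_bigr => l _.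
  by rewrite !mxE (ord1 j) rmorphM /= mulrA divfK ?lt0r_neq0.
rewrite eu in wu; have [z0 sz] := weight_fin_inv wu.
have zn i : exists m : nat, z i 0 = m.
  have : 0 <= z i 0.
    have := z0 i; rewrite mxE => h; rewrite -(ler0z R).
    by have := mulr_ge0 h (ltW NR); rewrite divfK ?lt0r_neq0.
  by case: (z i 0) => // m _; exists m.
have [y yE] := choice zn.
have My i : \sum_l M i l * (y l)%:Z = N%:Z * u i 0.
  have := congr1 (fun A : 'cV_n => A i 0) Mz; rewrite !mxE => <-.
  by apply: eq_bigr => l _; rewrite yE.
exists y; split.
- by move=> i; rewrite My dvdz_mulr.
- by apply/matrixP => i j; rewrite (ord1 j) mxE My mulrC mulzK.
- rewrite -sz natr_sum mulr_suml; apply: eq_bigr => l _.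
  by rewrite mxE yE.
Qed.

Lemma lattice_point_inj y y' : lattice_vector y -> lattice_vector y' ->
  lattice_point y = lattice_point y' -> y =1 y'.
Proof.
move=> ly ly' e i; have := congr1 (fun u : 'cV_n => intmx_to R u) e; rewrite !lattice_pointE //.
move=> /(congr1 (mulmx (invmx (intmx_to R M)))); rewrite !mulKmx ?intmx_to_unit //.
have N0 : N%:R != 0 :> R by rewrite pnatr_eq0 -lt0n absdet_gt0.
move=> /matrixP /(_ i 0); rewrite !mxE => /(mulIf (invr_neq0 N0)) /eqP.
by rewrite eqr_nat => /eqP.
Qed.

(** N is an admissible denominator, so a least one exists and [weight_denom] does not take its
    default 0. *)
Lemma weight_denom_spec : is_weight_denom R M (weight_denom R M).
Proof.
have hN : is_weight_denom R M N.
  split; first exact: absdet_gt0.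
  move=> u; set x := invmx (intmx_to R M) *m intmx_to R u.
  have ux : intmx_to R u = intmx_to R M *m x by rewrite mulKVmx // intmx_to_unit.
  have [x0|nx0] := pselect (forall i, 0 <= x i 0); last first.
    by left; rewrite ux weight_infinite.
  right; have e := weight_finite x0; rewrite -ux in e; rewrite e; have [y [_ _ ->]] := lattice_point_surj e.
  by exists (\sum_l y l)%N.
have exD : exists D, `[< is_weight_denom R M D >] by exists N; apply/asboolP.
case: (ex_minnP exD) => D /asboolP hD minD.
rewrite /weight_denom; case: xgetP => [D' _ [] //|/(_ D) []].
by split=> // D' hD'; apply: minD; apply/asboolP.
Qed.

Local Notation D := (weight_denom R M).

Lemma weight_denom_gt0 : (0 < D)%N.
Proof. by case: weight_denom_spec. Qed.

Lemma weight_denom_dvd y : lattice_vector y -> (N %| D * \sum_l y l)%N.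
Proof.
move=> ly; have [D0 /(_ (lattice_point y))] := weight_denom_spec.
rewrite weight_lattice_point // => -[//|[m [e]]].
have NR : N%:R != 0 :> R by rewrite pnatr_eq0 -lt0n absdet_gt0.
have DR : D%:R != 0 :> R by rewrite pnatr_eq0 -lt0n.
move/eqP: e; rewrite eqr_div // -!natrM eqr_nat => /eqP e.
by rewrite mulnC e dvdn_mull.
Qed.

End Weight.

Lemma card_fset_set_image (T : finType) (U : choiceType) (f : T -> U) (A : {set T}) :
  {in A &, injective f} -> #|` fset_set [set f x | x in [set` A]]%classic| = #|A|.
Proof.
move=> injf; have finA : finite_set [set` A]%classic by exact: finite_finset.
rewrite fset_set_image // card_in_imfset /=; last first.
  by move=> x y; rewrite !in_fset_set // !inE => xA yA; exact: injf.
rewrite cardE; apply/perm_size/uniq_perm; rewrite ?enum_uniq ?fset_uniq //.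
move=> x; rewrite mem_enum in_fset_set //.
by apply/idP/idP => [|xA]; [rewrite inE|rewrite inE].
Qed.

(** Pascal's rule for the n-th power of 1 - (shift by d). The relation is required only up to m,
    since the counts it serves live in a finite box. *)
Lemma iterated_difference (f : nat -> int -> int) (d : int) (n : nat) (m : int) :
  (forall j i, (j < n)%N -> i <= m -> f j.+1 i = f j i - f j (i - d)) -> 0 <= d ->
  f n m = \sum_(i < n.+1) (-1) ^+ i * ('C(n, i))%:Z * f 0%N (m - i%:Z * d).
Proof.
move=> h d0; elim: n m h => [|n IHn] m h.
  by rewrite big_ord1 expr0 bin0 !mul1r mul0r subr0.
have h' m' : m' <= m -> forall j i, (j < n)%N -> i <= m' -> f j.+1 i = f j i - f j (i - d).
  by move=> le_m' j i lt_j le_i; apply: h; [apply: ltnW|apply: le_trans le_m'].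
rewrite h // (IHn m) ?(IHn (m - d)); try by [apply: h'; rewrite // lerBlDr lerDl|move=> *; apply: (h' m)].
have e0 l : (-1 : int) ^+ (ord0 : 'I_l.+1) * 'C(n, (ord0 : 'I_l.+1))%:Z *
    f 0%N (m - (ord0 : 'I_l.+1)%:Z * d) = f 0%N m.
  by rewrite /= bin0 !mul1r mul0r subr0.
have e0' l : (-1 : int) ^+ (ord0 : 'I_l.+1) * 'C(n.+1, (ord0 : 'I_l.+1))%:Z *
    f 0%N (m - (ord0 : 'I_l.+1)%:Z * d) = f 0%N m.
  by rewrite /= bin0 !mul1r mul0r subr0.
rewrite [in RHS]big_ord_recl e0' [X in X - _]big_ord_recl e0 -addrA; congr (_ + _).
rewrite [in RHS](eq_bigr (fun i : 'I_n.+1 =>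
   (-1) ^+ i.+1 * ('C(n, i.+1))%:Z * f 0%N (m - i.+1%:Z * d) +
   (-1) ^+ i.+1 * ('C(n, i))%:Z * f 0%N (m - i.+1%:Z * d))); last first.
  by move=> i _; rewrite !lift0 binS PoszD; ring.
rewrite big_split /= [in RHS]big_ord_recr /= bin_small // mulr0 mul0r addr0; congr (_ + _).
rewrite -sumrN; apply: eq_bigr => i _.
have -> : m - d - i%:Z * d = m - i.+1%:Z * d by rewrite intS; ring.
by rewrite exprS; ring.
Qed.

Section Counting.

Variables (R : realType) (n : nat) (M : 'M[int]_n).
Hypothesis hM : \det M != 0.

Local Notation N := `|\det M|%N.
Local Notation D := (weight_denom R M).

Let N_gt0 : (0 < N)%N. Proof. exact: absdet_gt0. Qed.
Let D_gt0 : (0 < D)%N. Proof. exact: weight_denom_gt0. Qed.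

Variable Kmax : nat.
(** A lattice vector y of weight at most Kmax / D satisfies sum y <= D sum y <= Kmax N, so the box
    [Y] contains all of them. *)
Let B := (Kmax * N)%N.
Local Notation Y := {ffun 'I_n -> 'I_B.+1}.

Definition lattice_vectorb (y : Y) : bool :=
  [forall i, (N%:Z %| \sum_l M i l * (y l)%:Z)%Z].

Lemma lattice_vectorbP (y : Y) : reflect (lattice_vector M (fun l => y l)) (lattice_vectorb y).
Proof. exact: forallP. Qed.

(** At weight m / D, interpolates between the lattice points of the cone (j = 0) and those of the
    fundamental domain (j = n). *)
Definition level (j : nat) (m : int) : {set Y} :=
  [set y : Y | [&& lattice_vectorb y, [forall i : 'I_n, (i < j)%N ==> (y i < N)%N]
     & (D * \sum_l y l)%N%:Z == m * N%:Z]].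

Lemma W_level (m : int) : m <= Kmax%:Z -> W R M m = #|level 0 m|.
Proof.
move=> le_m; have NR : N%:R != 0 :> R by rewrite pnatr_eq0 -lt0n.
have DR : D%:R != 0 :> R by rewrite pnatr_eq0 -lt0n.
have eq_level (y : 'I_n -> nat) : ((\sum_l y l)%N%:R / N%:R == m%:~R / D%:R :> R) =
    ((D * \sum_l y l)%N%:Z == m * N%:Z).
  rewrite eqr_div // -[N%:R]/(N%:Z%:~R) -[D%:R]/(D%:Z%:~R) -[_%:R]/(Posz _)%:~R.
  by rewrite -!rmorphM /= eqr_int PoszM [in RHS]mulrC.
rewrite /W -(@card_fset_set_image _ _ (fun y : Y => lattice_point M (fun l => y l))).
  congr #|` fset_set _|; apply/seteqP; split=> [u /= wu|u /= [y]].
    have [y [ly eu ey]] := lattice_point_surj hM wu.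
    have e : (D * \sum_l y l)%N%:Z == m * N%:Z by rewrite -eq_level -ey.
    have ltB l : (y l < B.+1)%N.
      rewrite ltnS; apply: (@leq_trans (\sum_l y l)); first by rewrite (bigD1 l) //= leq_addr.
      apply: (@leq_trans (D * \sum_l y l)); first by rewrite leq_pmull.
      by rewrite -lez_nat (eqP e) /B PoszM ler_pM2r.
    exists [ffun l => Ordinal (ltB l)].
      rewrite /= inE; apply/and3P; split.
      - apply/lattice_vectorbP => i; rewrite (eq_bigr (fun l => M i l * (y l)%:Z)) => [|l _]; [exact: ly|by rewrite ffunE].
      - by apply/forallP => i; rewrite ltn0.
      - by rewrite (eq_bigr y) // => l _; rewrite ffunE.
    by rewrite eu; congr (lattice_point M _); apply/funext => l; rewrite ffunE.
  rewrite inE => /and3P[/lattice_vectorbP ly _ e] <-.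
  by rewrite weight_lattice_point //; congr (_%:E)%E; apply/eqP; rewrite eq_level.
move=> y y'; rewrite !inE => /and3P[/lattice_vectorbP ly _ _] /and3P[/lattice_vectorbP ly' _ _].
by move/(lattice_point_inj R hM ly ly') => e; apply/ffunP => l; apply: val_inj; exact: e.
Qed.

Lemma level_shift (j : nat) (lt_j : (j < n)%N) (m : int) (y z : Y) :
  let jo := Ordinal lt_j in
  z jo = (y jo + N)%N :> nat -> (forall l, l != jo -> z l = y l) ->
  (y \in level j (m - D%:Z)) = (z \in level j m).
Proof.
move=> jo zjo zl; rewrite !inE; congr [&& _, _ & _].
- apply: eq_forallb => i; rewrite [in RHS](bigD1 jo) // [in LHS](bigD1 jo) //=.
  rewrite [in RHS](eq_bigr (fun l => M i l * (y l)%:Z)) => [|l /zl -> //].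
  rewrite zjo PoszD mulrDr -addrA [M i jo * N%:Z + _]addrC addrA.
  by rewrite [in RHS]rpredDr // dvdz_mull.
- apply: eq_forallb => i; case: (ltnP i j) => //= lt_ij; rewrite zl //.
  by rewrite -val_eqE /= ltn_eqF.
- have -> : (\sum_l z l = \sum_l y l + N)%N.
    rewrite (bigD1 jo) //= zjo [in RHS](bigD1 jo) //= addnAC; congr (_ + _ + _)%N.
    by apply: eq_bigr => l /zl ->.
  rewrite mulnDr PoszD mulrBl PoszM.
  by rewrite eq_sym subr_eq eq_sym.
Qed.

(** The vectors lost from [level j] are those with y_j >= N. Subtracting N there means subtracting
    one column of M from the lattice point, which lowers the weight by 1, that is m by D. *)
Lemma level_difference (j : nat) (m : int) : (j < n)%N -> m <= Kmax%:Z ->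
  (#|level j.+1 m|%:Z = #|level j m|%:Z - #|level j (m - D%:Z)|%:Z)%R.
Proof.
move=> lt_j le_m; pose jo := Ordinal lt_j.
pose big := [set y in level j m | (N <= y jo)%N].
have -> : #|level j m| = (#|level j.+1 m| + #|big|)%N.
  rewrite -(cardsID [set y : Y | (y jo < N)%N] (level j m)); congr (_ + _)%N; apply: eq_card => y.
    rewrite !inE -!andbA; congr (_ && _); rewrite andbCA andbC; congr (_ && _).
    apply/andP/forallP => [[/forallP hy yj] i|hy].
      apply/implyP; rewrite ltnS leq_eqVlt => /orP[/eqP ei|lt_ij].
        by rewrite (_ : i = jo) //; apply: val_inj.
      by have := hy i; rewrite lt_ij.
    split; last by have := hy jo; rewrite ltnS leqnn.
    by apply/forallP => i; apply/implyP => lt_ij; have := hy i; rewrite ltnS ltnW.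
  by rewrite !inE -leqNgt andbC.
suff -> : #|big| = #|level j (m - D%:Z)| by rewrite PoszD addrK.
pose f (y : Y) : Y := [ffun l => if l == jo then inord (y l + N) else y l].
pose g (z : Y) : Y := [ffun l => if l == jo then inord (z l - N) else z l].
have fjo (y : Y) : y \in level j (m - D%:Z) -> f y jo = (y jo + N)%N :> nat.
  rewrite inE => /and3P[_ _ /eqP e]; rewrite ffunE eqxx inordK // ltnS /B.
  apply: (@leq_trans (D * (\sum_l y l + N))).
    rewrite (bigD1 jo) //= addnAC; apply: leq_trans (leq_pmull _ D_gt0).
    by rewrite leq_addr.
  rewrite -lez_nat mulnDr PoszD e mulrBl PoszM subrK PoszM.
  by rewrite ler_pM2r.
have fl (y : Y) l : l != jo -> f y l = y l by move=> nl; rewrite ffunE (negbTE nl).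
have gjo (z : Y) : (N <= z jo)%N -> z jo = (g z jo + N)%N :> nat.
  move=> le_N; rewrite ffunE eqxx inordK ?subnK //.
  by apply: leq_ltn_trans (ltn_ord (z jo)); rewrite leq_subr.
have gl (z : Y) l : l != jo -> z l = g z l by move=> nl; rewrite ffunE (negbTE nl).
have -> : big = f @: level j (m - D%:Z).
  apply/setP => z; apply/idP/imsetP => [|[y hy ->]].
    rewrite inE => /andP[hz hN]; have hgz : g z \in level j (m - D%:Z).
      by rewrite (@level_shift _ lt_j _ _ z) //; [apply: gjo|apply: gl].
    exists (g z) => //; apply/ffunP => l; apply: val_inj => /=.
    have [->|nl] := eqVneq l jo; first by rewrite fjo // gjo.
    by rewrite fl // gl.
  rewrite inE fjo // leq_addl andbT -(@level_shift _ lt_j _ y) //; first exact: fjo.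
  exact: fl.
apply: card_in_imset => y y' hy hy' e; apply/ffunP => l; apply: val_inj => /=.
have := congr1 (fun z : Y => z l : nat) e; have [->|nl] := eqVneq l jo.
  by rewrite !fjo // => /addIn.
by rewrite !fl.
Qed.

Lemma H_level (m : nat) : (m <= Kmax)%N -> H R M m = #|level n m%:Z|%:Z.
Proof.
move=> le_m.
have iter := @iterated_difference (fun j i => #|level j i|%:Z) D%:Z n m%:Z.
rewrite iter //; last first.
  by move=> j i lt_j le_i; apply: level_difference => //; apply: le_trans le_i _; rewrite lez_nat.
apply: eq_bigr => i _; congr (_ * _); rewrite PoszM W_level //.
by rewrite lerBlDr -[leLHS]addr0 lerD ?lez_nat // mulr_ge0.
Qed.

End Counting.

Lemma sum_levels (V : nmodType) (T : finType) (f : T -> nat) (F : T -> V) m :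
  \sum_(i < m) \sum_(t | f t == i) F t = \sum_(t | (f t < m)%N) F t.
Proof.
rewrite (exchange_big_dep xpredT) //= [RHS]big_mkcond /=; apply: eq_bigr => t _.
case: ltnP => [lt_m|le_m]; last first.
  by rewrite big_pred0 // => i; apply/negbTE; rewrite gtn_eqF // (leq_trans (ltn_ord i)).
by rewrite (big_pred1 (Ordinal lt_m)) // => i; rewrite -val_eqE eq_sym.
Qed.

Section HodgePolygon.

Variables (R : realType) (n : nat) (M : 'M[int]_n).
Hypothesis hM : \det M != 0.

Local Notation N := `|\det M|%N.
Local Notation D := (weight_denom R M).
Local Notation TL := {t : {ffun 'I_n -> 'I_N} | in_lattice M t}.

Let N_gt0 : (0 < N)%N. Proof. exact: absdet_gt0. Qed.
Let D_gt0 : (0 < D)%N. Proof. exact: weight_denom_gt0. Qed.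

Lemma lattice_vector_ord (t : {ffun 'I_n -> 'I_N}) :
  in_lattice M t -> lattice_vector M (fun l => t l).
Proof. by move=> /forallP. Qed.

(** D |r| for r = t / N; the division is exact because D is a denominator for all weights. *)
Definition hodge_index (t : TL) : nat := (D * vsize (val t) %/ N)%N.

Lemma hodge_indexE (t : TL) : (hodge_index t * N = D * vsize (val t))%N.
Proof.
by rewrite divnK //; apply: weight_denom_dvd => //; apply: lattice_vector_ord; exact: (valP t).
Qed.

Lemma vsize_le (t : {ffun 'I_n -> 'I_N}) : (vsize t <= n * N)%N.
Proof.
rewrite -[n in (n * N)%N]card_ord -sum_nat_const; apply: leq_sum => l _.
exact: ltnW.
Qed.

Lemma hodge_index_le (t : TL) : (hodge_index t <= n * D)%N.
Proof.
rewrite -(leq_pmul2r N_gt0) hodge_indexE [(n * D)%N]mulnC -mulnA leq_pmul2l //.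
exact: vsize_le.
Qed.

Lemma slope_hodge_index (t : TL) : slope R D hodge_index t = (vsize (val t))%:R / N%:R.
Proof.
apply/eqP; rewrite /slope eqr_div ?pnatr_eq0 -?lt0n // -!natrM hodge_indexE mulnC.
by [].
Qed.

(** H is the cardinality of [level n], where all coordinates are below N and the vectors are the
    points of S(Delta). *)
Lemma H_count m : (m <= n * D)%N -> H R M m = #|[set t : TL | hodge_index t == m]|%:Z.
Proof.
move=> le_m; rewrite (H_level R hM le_m); congr Posz.
have ltB (t : TL) (l : 'I_n) : (val t l < (n * D * N).+1)%N.
  rewrite ltnS; apply: leq_trans (ltnW (ltn_ord _)) _.
  have n0 : (0 < n)%N by apply: leq_ltn_trans (ltn_ord l).
  by rewrite leq_pmull // muln_gt0 n0.
pose f (t : TL) : {ffun 'I_n -> 'I_(n * D * N).+1} := [ffun l => Ordinal (ltB t l)].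
have fE t l : f t l = val t l :> nat by rewrite ffunE.
have -> : level R M (n * D) n m%:Z = f @: [set t | hodge_index t == m].
  apply/setP => y; apply/idP/imsetP => [|[t ht ->]].
    rewrite inE => /and3P[ly /forallP lt_y /eqP sy].
    have ltN l : (y l < N)%N by have := lt_y l; rewrite ltn_ord.
    pose t0 : {ffun 'I_n -> 'I_N} := [ffun l => Ordinal (ltN l)].
    have t0E l : t0 l = y l :> nat by rewrite ffunE.
    have lt0 : in_lattice M t0.
      apply/forallP => i; under eq_bigr do rewrite t0E.
      by move/forallP: ly.
    exists (Sub t0 lt0); last by apply/ffunP => l; apply: val_inj; rewrite [RHS]fE SubK t0E.
    rewrite inE -(eqn_pmul2r N_gt0) hodge_indexE SubK -eqz_nat PoszM.
    by rewrite [X in _ == X]PoszM -sy /vsize; under eq_bigr do rewrite t0E.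
  rewrite inE in ht; rewrite inE; apply/and3P; split.
  - apply/forallP => i; under eq_bigr do rewrite fE.
    by have /forallP := valP t.
  - by apply/forallP => i; rewrite ltn_ord /= fE.
  - under eq_bigr do rewrite fE.
    by rewrite -PoszM eqz_nat -hodge_indexE (eqP ht).
apply: card_imset => t t' e; apply: val_inj; apply/ffunP => l; apply: val_inj.
by rewrite -[LHS]fE -[RHS]fE e.
Qed.

Lemma HP_vertexE m : (m <= (n * D).+1)%N ->
  HP_vertex R M m = polygon_vertex R D hodge_index m.
Proof.
move=> le_m; have He (k : 'I_m) : H R M k = \sum_(t : TL | hodge_index t == k) 1.
  rewrite H_count; last by rewrite -ltnS (leq_trans (ltn_ord k)).
  by rewrite sumr_const natz cardsE.
rewrite /HP_vertex /polygon_vertex; congr (_, _).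
  rewrite (eq_bigr _ (fun k _ => He k)) sum_levels.
  by rewrite rmorph_sum natr_sum.
rewrite rmorph_sum mulr_suml -(sum_levels hodge_index (slope R D hodge_index) m).
apply: eq_bigr => k _; rewrite rmorphM /= He rmorph_sum /= mulr_sumr mulr_suml.
by apply: eq_bigr => t /eqP <-; rewrite mulr1.
Qed.

Lemma HP_polygon : HP M = polygon D (n * D) hodge_index :> set (R * R).
Proof.
apply/seteqP; split=> P [m le_m hP]; exists m => //.
  by rewrite -!HP_vertexE // ltnW.
by rewrite !HP_vertexE // ltnW.
Qed.

End HodgePolygon.

(** * The two stability conditions in integral coordinates *)

Section Stability.

Variables (R : realType) (n : nat) (M : 'M[int]_n) (p : nat).
Hypothesis hM : \det M != 0.

Local Notation N := `|\det M|%N.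
Hypothesis N_gt0 : (0 < N)%N.

Lemma p_action_ge0 (r : 'cV[rat]_n) i : 0 <= p_action p r i 0.
Proof. by rewrite mxE subr_ge0 floor_le. Qed.

Lemma weight_rat (x : 'cV[rat]_n) : (forall i, 0 <= x i 0) ->
  weight M (map_mx (ratr : rat -> R) (intmx_to rat M *m x)) = (ratr (l1norm x))%:E%E.
Proof.
move=> x0; have -> : map_mx (ratr : rat -> R) (intmx_to rat M *m x) =
    intmx_to R M *m map_mx ratr x.
  rewrite map_mxM; congr (_ *m _); apply/matrixP => i j.
  by rewrite !mxE /= ratr_int.
rewrite weight_finite // => [|i]; last by rewrite mxE ler0q.
congr (_%:E)%E; rewrite /l1norm rmorph_sum; apply: eq_bigr => i _.
by rewrite mxE.
Qed.

(** On nonnegative coordinates the weight is the norm, and fractional parts are nonnegative. *)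
Lemma weight_stableP : weight_stable R p M <-> norm_stable p M.
Proof.
have wu (u : 'cV[int]_n) (r : 'cV[rat]_n) : intmx_to rat u = intmx_to rat M *m r ->
    intmx_to R u = map_mx ratr (intmx_to rat M *m r).
  move=> <-; apply/matrixP => i j; by rewrite !mxE /= ratr_int.
split=> h r.
  move=> Sr; have [r01 [u hu]] := Sr; have := h u r Sr (esym hu).
  rewrite (wu u r (esym hu)) !weight_rat => [[/fmorph_inj //]|i|i].
    by case/andP: (r01 i).
  exact: p_action_ge0.
move=> r0 Sr hu; rewrite (wu _ _ hu) !weight_rat ?h // => i.
  by have [/(_ i)/andP[]] := Sr.
exact: p_action_ge0.
Qed.

Definition frac_col (t : {ffun 'I_n -> 'I_N}) : 'cV[rat]_n := \col_i ((t i)%:R / N%:R).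

(** By Cramer's rule N r is the adjugate of M applied to u = M r, up to sign, hence integral. *)
Lemma S_DeltaP (r : 'cV[rat]_n) :
  S_Delta M r <-> exists2 t, in_lattice M t & r = frac_col t.
Proof.
have NQ : N%:R != 0 :> rat by rewrite pnatr_eq0 -lt0n.
have NQ0 : 0 < N%:R :> rat by rewrite ltr0n.
split=> [[r01 [u hu]]|[t /forallP lt ->]]; last first.
  split=> [i|].
    by rewrite mxE divr_ge0 //= ltr_pdivrMr // mul1r ltr_nat.
  exists (lattice_point M (fun l => t l)); apply/matrixP => i j; rewrite !mxE.
  apply: (mulIf NQ); rewrite -[X in _ = _ * X]/(N%:Z%:~R) -rmorphM /= divzK //.
  rewrite mulr_suml rmorph_sum /=; apply: eq_bigr => l _.
  by rewrite !mxE rmorphM /= -mulrA divfK.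
pose z : 'cV[int]_n := Num.sg (\det M) *: (\adj M *m u).
have zE i : (z i 0)%:~R = N%:R * r i 0 :> rat.
  have : intmx_to rat z = N%:R *: r.
    rewrite /z /intmx_to map_mxZ map_mxM -/(intmx_to rat u) -hu mulmxA -map_mxM.
    rewrite mul_adj_mx map_scalar_mx mul_scalar_mx scalerA -rmorphM /=.
    by rewrite -normrEsg.
  by move/matrixP/(_ i 0); rewrite !mxE.
have zn i : exists m : 'I_N, z i 0 = m.
  have /andP[r0 r1] := r01 i.
  have z0 : 0 <= z i 0 by rewrite -(ler0z rat) zE mulr_ge0.
  have z1 : z i 0 < N%:Z by rewrite -(ltr_int rat) zE -[ltRHS]mulr1 ltr_pM2l.
  case: (z i 0) z0 z1 => // m _; rewrite ltz_nat => lt_m.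
  by exists (Ordinal lt_m).
have [y yE] := choice zn.
have yR i : (y i)%:R = N%:R * r i 0 :> rat by rewrite -zE yE.
exists (finfun y); last first.
  by apply/matrixP => i j; rewrite (ord1 j) mxE ffunE yR mulrC mulKf.
apply/forallP => i; under eq_bigr do rewrite ffunE.
suff -> : \sum_(l < n) M i l * (y l)%:Z = N%:Z * u i 0 by rewrite dvdz_mulr.
apply: (@intr_inj rat); rewrite rmorphM rmorph_sum /=.
have /matrixP /(_ i 0) := hu; rewrite !mxE => <-.
rewrite mulr_sumr; apply: eq_bigr => l _.
by rewrite rmorphM /= mxE -[X in _ * X = _]/((y l)%:R) yR mulrCA.
Qed.

Lemma l1norm_frac t : l1norm (frac_col t) = (vsize t)%:R / N%:R.
Proof.
by rewrite /l1norm /vsize natr_sum mulr_suml; apply: eq_bigr => i _; rewrite mxE.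
Qed.

Lemma p_action_frac t : p_action p (frac_col t) = frac_col (vscale N_gt0 p t).
Proof.
have NQ0 : 0 < N%:R :> rat by rewrite ltr0n.
apply/matrixP => i j; rewrite !mxE ffunE /= mulrA -natrM.
set m := (p * t i)%N.
have mE : m%:R = (m %/ N)%N%:R * N%:R + (m %% N)%N%:R :> rat.
  by rewrite -natrM -natrD -divn_eq.
have -> : Num.floor (m%:R / N%:R : rat) = (m %/ N)%N%:Z.
  apply: floor_def; rewrite -[((_ + 1) : int)]PoszD addn1.
  rewrite ler_pdivlMr // ltr_pdivrMr // -[_%:~R]/(_%:R) -[_%:~R]/(_%:R) -!natrM.
  by rewrite ler_nat ltr_nat leq_divM ltn_ceil.
by rewrite mE mulrDl mulfK ?gt_eqF // addrAC subrr add0r.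
Qed.

Lemma norm_stableP : norm_stable p M <->
  forall t, in_lattice M t -> vsize (vscale N_gt0 p t) = vsize t.
Proof.
have NQ0 : N%:R != 0 :> rat by rewrite pnatr_eq0 -lt0n.
have eqv t : l1norm (p_action p (frac_col t)) = l1norm (frac_col t) <->
    vsize (vscale N_gt0 p t) = vsize t.
  rewrite p_action_frac !l1norm_frac; split=> [/(mulIf (invr_neq0 NQ0)) /eqP|-> //].
  by rewrite eqr_nat => /eqP.
split=> [h t lt|h r /S_DeltaP[t lt ->]]; last by apply/eqv; apply: h.
by apply/eqv; apply: h; apply/S_DeltaP; exists t.
Qed.

End Stability.

(** * Comparison of the polygons *)

Lemma sum_iter_periodic (V : nmodType) (T : Type) (f : T -> T) (s : T -> V) d c t :
  iter d f t = t ->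
  \sum_(b < d * c) s (iter b f t) = (\sum_(b < d) s (iter b f t)) *+ c.
Proof.
move=> ft; elim: c => [|c IHc]; first by rewrite muln0 big_ord0 mulr0n.
rewrite mulnS addnC big_split_ord /= IHc mulrS addrC; congr (_ + _).
apply: eq_bigr => b _; congr s; rewrite addnC iterD; congr iter.
by elim: c {IHc} => [|c IHc]; rewrite ?muln0 // mulnS iterD IHc.
Qed.

(* By concavity of min(0, .) each average term dominates the average of the
   terms over the orbit, so equal totals force equality termwise; at
   tau = avg t this says that no value on the orbit is below the mean. *)
Lemma average_transform (R : realFieldType) (T : finType) (f : T -> T) (s : T -> R) m :
  injective f -> (1 < m)%N ->
  let avg t := (\sum_(b < m) s (iter b f t)) / m%:R in
  (forall tau, \sum_t Num.min 0 (avg t - tau) = \sum_t Num.min 0 (s t - tau)) <->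
  (forall t, s (f t) = s t).
Proof.
move=> injf m1 avg; have m0 : 0 < m%:R :> R by rewrite ltr0n ltnW.
split=> [h t|h tau]; last first.
  have sb b t : s (iter b f t) = s t by elim: b => //= b <-; rewrite h.
  apply: eq_bigr => t _; rewrite /avg; under eq_bigr do rewrite sb.
  by rewrite sumr_const card_ord -[s t *+ m]mulr_natr mulfK ?gt_eqF.
have jensen u tau : \sum_(b < m) Num.min 0 (s (iter b f u) - tau) <= m%:R * Num.min 0 (avg u - tau).
  have e : m%:R * (avg u - tau) = \sum_(b < m) (s (iter b f u) - tau).
    rewrite mulrBr /avg mulrC divfK ?gt_eqF // sumrB; congr (_ - _).
    by rewrite sumr_const card_ord mulr_natl.
  case: (leP 0 (avg u - tau)) => _; first by rewrite mulr0; apply: sumr_le0 => b _; rewrite ge_min lexx.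
  by rewrite e; apply: ler_sum => b _; rewrite ge_min lexx orbT.
have total tau : \sum_u (m%:R * Num.min 0 (avg u - tau) -
    \sum_(b < m) Num.min 0 (s (iter b f u) - tau)) = 0.
  rewrite sumrB -mulr_sumr h exchange_big /=; apply/eqP; rewrite subr_eq0; apply/eqP.
  rewrite [RHS](eq_bigr (fun=> \sum_u Num.min 0 (s u - tau))) => [|b _].
    by rewrite sumr_const card_ord mulr_natl.
  have inj_b : injective (iter b f) by elim: (b : nat) => //= c IHc x y /injf /IHc.
  by rewrite [RHS](reindex_inj inj_b).
have eqs u tau : m%:R * Num.min 0 (avg u - tau) = \sum_(b < m) Num.min 0 (s (iter b f u) - tau).
  apply/eqP; rewrite -subr_eq0; move/eqP: (total tau); rewrite psumr_eq0 => [|u' _].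
    by move/allP/(_ u (mem_index_enum _)).
  by rewrite subr_ge0.
have ge_avg (b : 'I_m) : avg t <= s (iter b f t).
  have := eqs t (avg t); rewrite subrr minxx mulr0 => /esym/eqP.
  rewrite -oppr_eq0 -sumrN psumr_eq0 => [/allP /(_ b (mem_index_enum _))|b' _]; last first.
    by rewrite oppr_ge0 ge_min lexx.
  by rewrite oppr_eq0 => /eqP min0; rewrite -subr_ge0 -min0 ge_min lexx orbT.
have eq_avg (b : 'I_m) : s (iter b f t) = avg t.
  have sum0 : \sum_(b < m) (s (iter b f t) - avg t) = 0.
    rewrite sumrB sumr_const card_ord /avg -[X in _ - X]mulr_natr divfK ?gt_eqF //.
    by rewrite subrr.
  move/eqP: sum0; rewrite psumr_eq0 => [/allP /(_ b (mem_index_enum _))|b' _].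
    by rewrite subr_eq0 => /eqP.
  by rewrite subr_ge0.
by rewrite (eq_avg (Ordinal m1)) -(eq_avg (Ordinal (ltnW m1))).
Qed.

Section Orbits.

Variables (T : finType) (f : T -> T).
Hypothesis injf : injective f.

Lemma iter_eq_order i x : (iter i f x == x) = (order f x %| i)%N.
Proof.
have fd c : iter (c * order f x) f x = x.
  by elim: c => //= c IHc; rewrite mulSn iterD IHc iter_order.
rewrite {1}(divn_eq i (order f x)) addnC iterD fd /dvdn.
have lt_r : (i %% order f x < order f x)%N by rewrite ltn_mod order_gt0.
apply/eqP/eqP => [e|-> //]; apply/eqP.
have := nth_uniq x _ _ (orbit_uniq f x); rewrite size_orbit => /(_ _ 0%N lt_r (order_gt0 f x)) <-.
by rewrite /orbit !nth_traject ?order_gt0 // e.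
Qed.

Lemma order_f x : order f (f x) = order f x.
Proof. by apply: eq_card => y; rewrite !inE -(same_fconnect1 injf). Qed.

Lemma sum_orbits (V : nmodType) (F : T -> V) : (forall x, F (f x) = F x) ->
  \sum_x F x = \sum_(x | froots f x) F x *+ order f x.
Proof.
move=> Ff; have Fc x y : fconnect f x y -> F y = F x.
  by move=> /iter_findex <-; elim: (findex _ _ _) => //= i IHi; rewrite Ff.
rewrite (partition_big (froot f) (froots f)) /= => [|x _]; last exact: roots_root (fconnect_sym injf) x.
apply: eq_bigr => r rr; rewrite (eq_bigr (fun=> F r)) => [|x /eqP rx]; last first.
  by apply: Fc; rewrite -rx fconnect_sym // connect_root.
have symf : connect_sym (frel f) := fconnect_sym injf.
have rr' : froot f r = r := eqP rr.
have E x : (froot f x == r) = fconnect f r x.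
  by rewrite -{1}rr' (root_connect symf) symf.
by rewrite sumr_const; congr (_ *+ _); apply: eq_card => x; exact: E.
Qed.

End Orbits.

Lemma scaled_valuation (R : realType) (K : fieldType) (v : K -> R) c :
  0 < c -> is_valuation v -> is_valuation (fun x => v x / c).
Proof.
move=> c0 [vM vD]; split=> [x y x0 y0|x y x0 y0 xy0].
  by rewrite vM // mulrDl.
by rewrite -minr_pMl ?invr_ge0 ?(ltW c0) // ler_pM2r ?invr_gt0 // vD.
Qed.

(** * Factorization of the L-function over orbits, and conclusion *)

Section Main.

Variables (R : realType) (n : nat) (M : 'M[int]_n) (p : nat).
Hypotheses (hM : \det M != 0) (hp : prime p).
Hypothesis hpM : ~~ (p %| `|\det M|)%N.

Local Notation N := `|\det M|%N.
Local Notation TL := {t : {ffun 'I_n -> 'I_N} | in_lattice M t}.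

Let N_gt0 : (0 < N)%N. Proof. exact: absdet_gt0. Qed.

Definition lscale m (t : TL) : TL :=
  Sub (vscale N_gt0 m (val t)) (in_lattice_vscale N_gt0 m (valP t)).

Lemma lscaleM m m' t : lscale m (lscale m' t) = lscale (m * m') t.
Proof. by apply: val_inj; rewrite !SubK vscaleM. Qed.

Lemma lscale_modn m m' t : m = m' %[mod N] -> lscale m t = lscale m' t.
Proof. by move=> e; apply: val_inj; rewrite !SubK; apply: vscale_modn. Qed.

Lemma lscale1 t : lscale 1 t = t.
Proof. by apply: val_inj; rewrite !SubK vscale1. Qed.

Lemma iter_lscale m i t : iter i (lscale m) t = lscale (m ^ i) t.
Proof. by elim: i => [|i IHi]; rewrite ?lscale1 //= IHi lscaleM -expnS. Qed.

Let p_totient : p ^ totient N = 1 %[mod N].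
Proof. by apply: Euler_exp_totient; rewrite prime_coprime. Qed.

(** By Euler's theorem multiplication by p^(i (phi(N) - 1)) is an inverse. *)
Lemma lscale_pX_inj i : injective (lscale (p ^ i)).
Proof.
move=> t t' /(congr1 (lscale (p ^ (i * (totient N).-1)))); rewrite !lscaleM.
rewrite -expnD -mulnSr prednK ?totient_gt0 // mulnC expnM.
have e : (p ^ totient N) ^ i = 1 %[mod N] by rewrite -modnXm p_totient modnXm exp1n.
by rewrite !(lscale_modn _ e) !lscale1.
Qed.

Definition lattice_slope (t : TL) : R := (vsize (val t))%:R / N%:R.

Variables (F : finFieldType) (E : nat -> finFieldType).
Hypothesis chF : p \in [pchar F].
Variable iota : forall i, {rmorphism F -> E i}.
Hypothesis cardE : forall i, (0 < i)%N -> #|E i| = (#|F| ^ i)%N.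
Variables (a : 'I_n -> F).
Hypothesis a_neq0 : forall l, a l != 0.

Local Notation q := #|F|.
Local Notation e := (logn p q).

Let cardF : q = (p ^ e)%N. Proof. exact: card_pchar. Qed.
Let e_gt0 : (0 < e)%N. Proof. exact: logn_card_gt0. Qed.

Lemma lscale_q_inj : injective (lscale q).
Proof. by rewrite cardF; exact: lscale_pX_inj. Qed.

Local Notation orb := (order (lscale q)).

Variables (K : fieldType) (v : K -> R) (k : fieldType) (res : K -> k).
Hypothesis S : residue_setting v p res.
Variable (zeta : K).
Hypothesis prim_zeta : p.-primitive_root zeta.
Variables (jF : {rmorphism F -> k}) (j : forall i, {rmorphism E i -> k}).
Hypothesis jP : forall i x, (0 < i)%N -> j i (iota i x) = jF x.

Let hv : is_valuation v. Proof. exact: rs_valuation S. Qed.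

Local Notation ot i t := (orbit_term p res zeta jF j a i (val t)).

(** The number gamma_O for the orbit of t, computed over the smallest extension of [F] in which t
    occurs: its degree is the length of the orbit. *)
Definition orbit_root (t : TL) : K := ot (orb t) t.

Lemma lscale_fixP i (t : TL) : (0 < i)%N ->
  (lscale (q ^ i) t == t) = [forall l : 'I_n, (N %| #|E i|.-1 * val t l)%N].
Proof.
move=> i0; have qi : (0 < q ^ i)%N by rewrite expn_gt0 ltnW ?finNzRing_gt1.
rewrite cardE //; apply/eqP/(vscale_eqP N_gt0 _ qi) => [/(congr1 val)|h].
  by rewrite SubK.
by apply: val_inj; rewrite SubK.
Qed.

Lemma orb_gt0 t : (0 < orb t)%N. Proof. exact: order_gt0. Qed.

Lemma lscale_orb t : [forall l : 'I_n, (N %| #|E (orb t)|.-1 * val t l)%N].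
Proof.
rewrite -lscale_fixP ?orb_gt0 // -iter_lscale; apply/eqP.
by apply: iter_order; exact: lscale_q_inj.
Qed.

Lemma orbit_root_lscale t : orbit_root (lscale q t) = orbit_root t.
Proof.
rewrite /orbit_root order_f; last exact: lscale_q_inj.
rewrite SubK; apply: (orbit_term_vscale S prim_zeta chF jP a_neq0 N_gt0).
- exact: orb_gt0.
- exact: lscale_orb.
Qed.

Definition Lpoly : {poly K} :=
  \prod_(t | froots (lscale q) t) (1 - orbit_root t *: 'X^(orb t)).

(** A point fixed by q^i has orbit length dividing i, and its term is then a power of [orbit_root],
    the same for all points of the orbit. *)
Lemma exp_sum_orbits i : (0 < i)%N ->
  exp_sum zeta p M (fun l => iota i (a l)) = (-1) ^+ n *
  \sum_(t | froots (lscale q) t)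
    (if (0 < i)%N && (orb t %| i)%N then (orb t)%:R * orbit_root t ^+ (i %/ orb t) else 0).
Proof.
move=> i0; rewrite (exp_sum_orbit_terms S prim_zeta chF cardE jP a_neq0 N_gt0 erefl i0).
congr (_ * _).
pose G (t : TL) : K := if (orb t %| i)%N then orbit_root t ^+ (i %/ orb t) else 0.
transitivity (\sum_t G t); last first.
  rewrite (@sum_orbits _ (lscale q) lscale_q_inj) => [|t]; last first.
    by rewrite /G orbit_root_lscale order_f //; exact: lscale_q_inj.
  apply: eq_bigr => t _; rewrite /G i0 /=; case: ifP => _; first by rewrite mulr_natl.
  by rewrite mul0rn.
transitivity (\sum_(t : TL | vscale N_gt0 (q ^ i) (val t) == val t) ot i t).
  exact: (big_sub_cond (in_lattice M) (fun t => vscale N_gt0 (q ^ i) t == t)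
            (orbit_term p res zeta jF j a i)).
rewrite big_mkcond /=; apply: eq_bigr => t _.
have -> : (vscale N_gt0 (q ^ i) (val t) == val t) = (orb t %| i)%N.
  by rewrite -(iter_eq_order lscale_q_inj) iter_lscale -val_eqE SubK.
rewrite /G; case: ifP => // /dvdnP[c ec].
have c0 : (0 < c)%N by move: i0; rewrite ec muln_gt0 => /andP[].
rewrite ec mulnK ?orb_gt0 // [(c * _)%N]mulnC.
exact: (orbit_term_multiple S prim_zeta chF iota cardE jF j a_neq0 N_gt0 (orb_gt0 t) c0 (lscale_orb t)).
Qed.

(** Both sides have constant term 1 and the same logarithmic derivative. The sign (-1)^(n+1) left
    over from the character sums is what selects L^* for odd n and its inverse for even n. *)
Lemma Lstar_signedE m : Lstar_signed zeta p iota M a m = Lpoly`_m.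
Proof.
have nat0 := rs_natr_neq0 S.
pose c (i : nat) : K := if i == 0%N then 0 else
    exp_sum zeta p M (fun l => iota i (a l)) / i%:R.
pose s (t : TL) (i : nat) : K :=
  if (0 < i)%N && (orb t %| i)%N then - ((orb t)%:R * orbit_root t ^+ (i %/ orb t)) else 0.
have LD : logder m Lpoly (fun i => \sum_(t | froots (lscale q) t) s t i).
  rewrite /Lpoly -big_filter; apply: (@eq_logder _ _ _ (fun i =>
     \sum_(t <- [seq t <- index_enum TL | froots (lscale q) t]) s t i)) => [i _|].
    by rewrite big_filter.
  apply: logder_prod => t _; apply: logder_cyclotomic; exact: orb_gt0.
have cE i : i%:R * c i = (-1) ^+ n.+1 * \sum_(t | froots (lscale q) t) s t i.
  rewrite /c; case: i => [|i] /=.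
    by rewrite mul0r big1 ?mulr0.
  rewrite mulrC divfK ?nat0 // exp_sum_orbits // exprSr -mulrA; congr (_ * _).
  rewrite mulN1r -sumrN; apply: eq_bigr => t _; rewrite /s /=.
  by case: ifP; rewrite ?opprK ?oppr0.
have c0 : c 0%N = 0 by [].
have L0 : Lpoly`_0 = 1.
  rewrite /Lpoly -horner_coef0 horner_prod big1 // => t _.
  by rewrite !hornerE expr0n gtn_eqF ?orb_gt0 //= mulr0 subr0.
rewrite /Lstar_signed; case: ifP => odd_n.
  apply: (@logder_fps_exp _ nat0 c Lpoly m c0 L0 _ m (leqnn m)).
  by apply: eq_logder LD => i _; rewrite cE -signr_odd /= odd_n mul1r.
apply: (@logder_fps_inv _ nat0 c Lpoly m c0 L0).
by apply: eq_logder LD => i _; rewrite cE -signr_odd /= odd_n mulN1r opprK.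
Qed.

(** A multiple of e times the length of each q-orbit, hence a period of every point under p, uniform
    in t; the factor 2 makes it exceed 1, as [average_transform] demands. *)
Definition average_period := (e * totient N * 2)%N.

Definition average_slope (t : TL) : R :=
  (\sum_(b < average_period) lattice_slope (iter b (lscale p) t)) / average_period%:R.

(** Stickelberger's theorem sums the norms of the p^b t over b < e orb(t), a full period of t;
    averaging over the longer [average_period] gives the same mean. *)
Lemma val_orbit_root t : orbit_root t != 0 /\
  v (orbit_root t) = e%:R * ((orb t)%:R * average_slope t).
Proof.
have [r0 vr] := orbit_term_val S prim_zeta chF iota cardE jF j a_neq0 N_gt0 (orb_gt0 t) (lscale_orb t).
split=> //; rewrite vr; set d := orb t.
have fixed : iter (e * d) (lscale p) t = t.
  rewrite iter_lscale expnM -cardF -iter_lscale; apply: iter_order.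
  exact: lscale_q_inj.
have ddvd : (d %| totient N * 2)%N.
  rewrite -(iter_eq_order lscale_q_inj) iter_lscale; apply/eqP.
  rewrite -[RHS]lscale1; apply: lscale_modn.
  by rewrite {1}cardF -expnM mulnC -mulnA expnM -modnXm p_totient modnXm exp1n.
have [c ec] := dvdnP ddvd.
have periodE : average_period = ((e * d) * c)%N by rewrite /average_period -mulnA ec -mulnA [(d * c)%N]mulnC.
have c0 : (0 < c)%N.
  by have := totient_gt0 N; rewrite N_gt0; move: ec; case: (c) => // /eqP; rewrite mul0n muln_eq0 orbF => /eqP ->.
rewrite /average_slope periodE (sum_iter_periodic lattice_slope c fixed).
transitivity (\sum_(b < e * d) lattice_slope (iter b (lscale p) t)).
  by apply: eq_bigr => b _; rewrite iter_lscale.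
move: (\sum_(b < _) _) => s.
have eR : e%:R != 0 :> R by rewrite pnatr_eq0 -lt0n.
have dR : d%:R != 0 :> R by rewrite pnatr_eq0 -lt0n orb_gt0.
have cR : c%:R != 0 :> R by rewrite pnatr_eq0 -lt0n.
by rewrite -[s *+ c]mulr_natr !natrM; field; rewrite eR dR cR.
Qed.

(** Gauss's lemma applied to the factors. A factor of degree orb(t) contributes orb(t) equal terms,
    which spread over the points of its orbit. *)
Lemma gauss_min_Lpoly tau : gauss_min (fun x => v x / e%:R) tau Lpoly
  (\sum_t Num.min 0 (average_slope t - tau)).
Proof.
have eR : 0 < e%:R :> R by rewrite ltr0n.
pose mu (t : TL) := Num.min 0 (v (orbit_root t) / e%:R - tau * (orb t)%:R).
have muE t : mu t = Num.min 0 (average_slope t - tau) *+ orb t.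
  have [_ vr] := val_orbit_root t; rewrite /mu vr.
  have -> : e%:R * ((orb t)%:R * average_slope t) / e%:R - tau * (orb t)%:R =
      (average_slope t - tau) * (orb t)%:R by field; rewrite gt_eqF.
  by rewrite -[RHS]mulr_natr minr_pMl // mul0r.
have avgP t : Num.min 0 (average_slope (lscale q t) - tau) = Num.min 0 (average_slope t - tau).
  have o0 : (orb t)%:R != 0 :> R by rewrite pnatr_eq0 -lt0n orb_gt0.
  apply: (mulIf o0); rewrite !mulr_natr -muE -{1}(order_f lscale_q_inj t) -muE /mu.
  by rewrite orbit_root_lscale order_f //; exact: lscale_q_inj.
rewrite (sum_orbits lscale_q_inj avgP) -big_filter.
rewrite (eq_bigr mu) => [|t _]; last by rewrite muE.
rewrite /Lpoly -big_filter; apply: gauss_min_prod; first exact: scaled_valuation.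
move=> t; apply: gauss_min_cyclotomic; first exact: scaled_valuation.
  exact: orb_gt0.
by have [] := val_orbit_root t.
Qed.

Lemma newton_eq_HP_iff :
  newton_polygon (fun x => v x / e%:R) (Lstar_signed zeta p iota M a) = HP M
  <-> norm_stable p M.
Proof.
have D_gt0 : (0 < weight_denom R M)%N := weight_denom_gt0 R hM.
have hstable : norm_stable p M <-> forall t, lattice_slope (lscale p t) = lattice_slope t.
  have N0 : N%:R != 0 :> R by rewrite pnatr_eq0 -lt0n.
  rewrite (norm_stableP p N_gt0); split=> [h t|h t lt].
    by rewrite /lattice_slope SubK (_ : vsize _ = vsize (val t)) //; apply: h; exact: valP.
  have := h (Sub t lt); rewrite /lattice_slope !SubK => /(mulIf (invr_neq0 N0)) /eqP.
  by rewrite eqr_nat => /eqP.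
have period_gt1 : (1 < average_period)%N.
  by rewrite /average_period muln2 -[1%N]/(0.*2.+1) ltn_Sdouble muln_gt0 e_gt0 totient_gt0.
have lscale_p_inj : injective (lscale p) by have := @lscale_pX_inj 1; rewrite expn1.
have avg := average_transform lattice_slope lscale_p_inj period_gt1.
rewrite hstable -avg.
have phiE tau : \sum_t Num.min 0 (lattice_slope t - tau) =
    slope_transform (weight_denom R M) (@hodge_index R n M) tau.
  by apply: eq_bigr => t _; rewrite slope_hodge_index.
rewrite HP_polygon // /newton_polygon.
rewrite (_ : Lstar_signed zeta p iota M a = fun m => Lpoly`_m); last first.
  by apply/funext => m; exact: Lstar_signedE.
split=> [eNP tau|eT].
  rewrite phiE; apply: (lower_hull_eq_polygon_transform D_gt0 (@hodge_index_le R n M hM) eNP).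
  exact: gauss_min_Lpoly.
apply: (lower_hull_polygon D_gt0 (@hodge_index_le R n M hM)) => tau.
by rewrite -phiE -eT; exact: gauss_min_Lpoly.
Qed.

End Main.

Theorem theorem3p4 (R : realType) (n : nat) (hn : (0 < n)%N)
    (M : 'M[int]_n) (hM : \det M != 0)
    (p : nat) (hp : prime p) (hpM : ~~ (p %| `|\det M|)%N)
    (F : finFieldType) (hF : p \in [pchar F])
    (E : nat -> finFieldType) (iota : forall k, {rmorphism F -> E k})
    (hE : forall k, (0 < k)%N -> #|E k| = (#|F| ^ k)%N)
    (C : padicOmega R p) (zeta : Omega C) (hzeta : p.-primitive_root zeta)
    (a : 'I_n -> F) (ha : forall j, a j != 0) :
  (ordinary zeta iota M a <-> norm_stable p M) /\
  (ordinary zeta iota M a <-> weight_stable R p M).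
Proof.
have [k [res S]] := Omega_residue_setting C hp.
have chE i : p \in [pchar E i] by rewrite (fmorph_pchar (iota i)).
have [h0 _] := prime_field_embedding (residue_pchar S).
(* Every field of characteristic p is reached from its prime field, which embeds into the residue
   field. *)
have embed (L : finFieldType) : p \in [pchar L] -> {rmorphism L -> k}.
  move=> chL; have [h1 _] := cid (prime_field_embedding chL).
  have cardL : #|L| = (#|'F_p| ^ logn p #|L|)%N by rewrite card_Fp // -card_pchar.
  exact: (projT1 (cid (residue_embedding h1 h0 S chL (logn_card_gt0 chL) cardL))).
pose jF := embed F hF.
have exj i : exists j : {rmorphism E i -> k}, (0 < i)%N -> forall x, j (iota i x) = jF x.
  (* [E 0] is irrelevant to L^*: no compatibility is asked at index 0, and any embedding will do. *)
  have [->|i0] := posnP i; first by exists (embed _ (chE 0%N)).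
  by have [j jP] := residue_embedding (iota i) jF S (chE i) i0 (hE i i0); exists j.
pose j i := projT1 (cid (exj i)).
have jP i x (i0 : (0 < i)%N) : j i (iota i x) = jF x := projT2 (cid (exj i)) i0 x.
have ord_qE : @ord_q R p C F = (fun x => ord x / (logn p #|F|)%:R).
  apply/funext => x; rewrite /ord_q; congr (_ / _).
  rewrite {1}(card_pchar hF) natrX (valX (Omega_valuation C)) ?Omega_natr_neq0 ?prime_gt0 //.
  by rewrite (ord_p C hp).
have main : ordinary zeta iota M a <-> norm_stable p M.
  rewrite /ordinary ord_qE.
  exact: (newton_eq_HP_iff hM hp hpM hF hE ha S hzeta jP).
split=> //; rewrite main; apply: iff_sym.
exact: weight_stableP.
Qed.
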